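(* Let $a,b,c:\mathbb R\to\mathbb R$ be smooth real-valued functions, $m$ a smooth compactly supported symbol on $\mathbb R^2$, $\phi(\xi,\eta)=-a(\xi+\eta)+b(\xi)+c(\eta)$, and $\Gamma=\{(\xi,\eta)\in\operatorname{Supp}m:\phi(\xi,\eta)=0\}$. Let $q\in[2,\infty]$. Then for $f,g\in L^2(\mathbb R)$ the solution $u$ of the system in the context satisfies $\|u(t)\|_{L^q}\lesssim\alpha(t)\|f\|_{L^2}\|g\|_{L^2}$, where: (a) in general, $\alpha(t)=t$; (b) if $\Gamma$ is empty, $\alpha(t)=1$; (c) if $\Gamma$ is a single point where $\phi$ vanishes at order two, $\alpha(t)=t^{\frac12+\frac1{2q}}$; (d) if $\Gamma$ is a non-characteristic curve on which $\phi$ vanishes at order one, $\alpha(t)=t^{1/q}$ for $2\le q<\infty$ and $\alpha(t)=\langle\log t\rangle$ for $q=\infty$; (e) if $\Gamma$ is a curve with non-vanishing curvature on which $\phi$ vanishes at order one, $\alpha(t)=t^{\frac14+\frac1{2q}}$; (f) if $\Gamma$ is a general smooth curve on which $\phi$ vanishes at order one, $\alpha(t)=t^{1/2}$.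
   Context: $T_m(f,g)(x)=\int_{\mathbb R^2}e^{ix(\xi+\eta)}\widehat f(\xi)\widehat g(\eta)m(\xi,\eta)\,d\xi\,d\eta$; $e^{ita(D)}$ is the Fourier multiplier with symbol $e^{ita(\xi)}$. $u$ solves $i\partial_tu+a(D)u=T_m(v,w)$, $i\partial_tv+b(D)v=0$, $i\partial_tw+c(D)w=0$ with $u(0)=0$, $v(0)=f$, $w(0)=g$, i.e. $u(t)=-ie^{ita(D)}\int_0^tT_{me^{is\phi}}(f,g)\,ds$. ''Vanishes at order two at the point'' means $\nabla\phi$ also vanishes there and the Hessian of $\phi$ there is definite; ''vanishes at order one on the curve'' means $\nabla\phi\ne0$ on $\Gamma$. A curve in the $(\xi,\eta)$-plane is characteristic at a point if its tangent there is parallel to $(1,0)$, $(0,1)$ or $(1,-1)$ (i.e. tangent to a line $\xi=$const, $\eta=$const or $\xi+\eta=$const); non-characteristic means characteristic at no point. $\langle x\rangle=\sqrt{1+x^2}$; $A\lesssim B$ means $A\le CB$ with $C$ independent of $t,f,g$. *)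

(* Defs.v *)
From HB Require Import structures.
From mathcomp Require Import all_boot all_order all_algebra.
From mathcomp Require Import all_classical all_reals all_analysis.
From mathcomp Require Import complex.
Set Implicit Arguments. Unset Strict Implicit. Unset Printing Implicit Defensive.
Import Order.TTheory GRing.Theory Num.Theory.
Import numFieldNormedType.Exports.
Local Open Scope classical_set_scope.
Local Open Scope ring_scope.
Local Open Scope complex_scope.

Section Defs.
Context {R : realType}.
Notation C := (R[i]).

Fixpoint iter_dir {V W : normedModType R} (vs : seq V) (f : V -> W) : V -> W :=
  match vs with
  | [::] => f
  | v :: vs' => fun x => derive (iter_dir vs' f) x v
  end.

Definition smooth {V W : normedModType R} (f : V -> W) : Prop :=
  forall vs : seq V, continuous (iter_dir vs f) /\
    forall (x v : V), derivable (iter_dir vs f) x v.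

Definition expi (th : R) : C := (cos th) +i* (sin th).

Definition cabs (z : C) : R := Num.sqrt (complex.Re z ^+ 2 + complex.Im z ^+ 2).

Definition cint {d} {T : measurableType d} (mu : {measure set T -> \bar R})
  (D : set T) (h : T -> C) : C :=
  (Rintegral mu D (fun x => complex.Re (h x))) +i* (Rintegral mu D (fun x => complex.Im (h x))).

Definition leb := (@lebesgue_measure R).

Definition inL2 (f : R -> C) : Prop :=
  measurable_fun setT (fun x => complex.Re (f x)) /\
  measurable_fun setT (fun x => complex.Im (f x)) /\
  (Lnorm leb 2%:E (fun x => (cabs (f x))%:E) < +oo)%E.

Definition L2norm (f : R -> C) : \bar R := Lnorm leb 2%:E (fun x => (cabs (f x))%:E).

Definition FTtrunc (f : R -> C) (n : nat) (xi : R) : C :=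
  cint leb `[- n%:R, n%:R] (fun x => expi (- (x * xi)) * f x).

Definition is_FT2 (f : R -> C) (F : R -> C) : Prop :=
  measurable_fun setT (fun x => complex.Re (F x)) /\
  measurable_fun setT (fun x => complex.Im (F x)) /\
  ((fun n : nat => Lnorm leb 2%:E (fun xi => (cabs (F xi - FTtrunc f n xi))%:E))
     @ \oo --> 0%E).

Definition phase (a b c : R -> R) (p : R * R) : R :=
  - a (p.1 + p.2) + b p.1 + c p.2.

Definition supp (m : R * R -> C) : set (R * R) := closure [set p | m p != 0].

Definition Gamma (a b c : R -> R) (m : R * R -> C) : set (R * R) :=
  [set p | supp m p /\ phase a b c p = 0].

(** the solution u(t)(x), written on the Fourier side with the Fourier data
    F = f^, G = g^ :
    u(t)(x) = -i int_{R^2} e^{ix(xi+eta)} e^{ita(xi+eta)}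
                 (int_0^t e^{is phi(xi,eta)} ds) m(xi,eta) F(xi) G(eta) *)
Definition sol (a b c : R -> R) (m : R * R -> C) (F G : R -> C) (t x : R) : C :=
  - 'i * cint (product_measure1 leb leb) setT (fun p : R * R =>
      expi (x * (p.1 + p.2)) * expi (t * a (p.1 + p.2))
      * cint leb `[0, t] (fun s => expi (s * phase a b c p))
      * m p * F p.1 * G p.2).

Definition estimate (a b c : R -> R) (m : R * R -> C) (q : \bar R)
  (alpha : R -> R) : Prop :=
  exists K : R, forall (t : R) (f g F G : R -> C),
    0 < t -> inL2 f -> inL2 g -> is_FT2 f F -> is_FT2 g G ->
    (Lnorm leb q (fun x => (cabs (sol a b c m F G t x))%:E)
       <= (K * alpha t)%:E * L2norm f * L2norm g)%E.

Definition e1 : R * R := (1, 0).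
Definition e2 : R * R := (0, 1).
Definition dphi (a b c : R -> R) (v : R * R) (p : R * R) : R :=
  derive (phase a b c) p v.
Definition d2phi (a b c : R -> R) (v w : R * R) (p : R * R) : R :=
  derive (dphi a b c w) p v.

Definition grad_zero (a b c : R -> R) (p : R * R) : Prop :=
  dphi a b c e1 p = 0 /\ dphi a b c e2 p = 0.

Definition hess_form (a b c : R -> R) (p v : R * R) : R :=
  v.1 * (v.1 * d2phi a b c e1 e1 p + v.2 * d2phi a b c e2 e1 p)
  + v.2 * (v.1 * d2phi a b c e1 e2 p + v.2 * d2phi a b c e2 e2 p).

Definition hess_definite (a b c : R -> R) (p : R * R) : Prop :=
  (forall v : R * R, v != 0 -> 0 < hess_form a b c p v) \/
  (forall v : R * R, v != 0 -> hess_form a b c p v < 0).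

Definition order_one (a b c : R -> R) (S : set (R * R)) : Prop :=
  forall p, S p -> ~ grad_zero a b c p.

Definition vel (gam : R -> R * R) (s : R) : R * R := derive gam s 1.
Definition acc (gam : R -> R * R) (s : R) : R * R := derive (vel gam) s 1.

Definition is_curve (S : set (R * R)) (gam : R -> R * R) : Prop :=
  smooth gam /\ (forall s, s \in `[0, 1] -> vel gam s != 0) /\
  S = gam @` `[0, 1].

(** tangent never parallel to (1,0), (0,1), (1,-1) *)
Definition noncharacteristic (gam : R -> R * R) : Prop :=
  forall s, s \in `[0, 1] ->
    [/\ (vel gam s).2 != 0, (vel gam s).1 != 0 &
        (vel gam s).1 + (vel gam s).2 != 0].

Definition nonzero_curvature (gam : R -> R * R) : Prop :=
  forall s, s \in `[0, 1] ->
    (vel gam s).1 * (acc gam s).2 - (vel gam s).2 * (acc gam s).1 != 0.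

Definition qinv (q : \bar R) : R := if q is r%:E then r^-1 else 0.

Definition jap (x : R) : R := Num.sqrt (1 + x ^+ 2).

End Defs.

(* Main.v *)
(** On the Fourier side |u| is controlled by the amplitude of the oscillatory integral of
    e^{ix(xi+eta)} against a weight w with
      |w| <= C min(t, 1/|phi|) 1_{m<>0} |f^(xi)| |g^(eta)|.
    For a weight bounded by 1_S |F(xi) G(eta)|, whose set S has horizontal sections of measure at
    most r1^2 and vertical ones of measure at most r2^2, Cauchy-Schwarz bounds the amplitude by
    r1 r2 |F|_2 |G|_2 in the sup norm, and by min(r1, r2) |F|_2 |G|_2 in L^2: sampling along an
    arithmetic progression of step pi/b (b a bound for the support) turns the L^2 norm into a
    Bessel inequality. Interpolation gives L^q. It remains to cut the plane dyadically according to
    the size of phi: near a point of Gamma, the sections of {|phi| <= lambda} in a given direction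
    have measure O(lambda) if the derivative of phi in that direction does not vanish, and
    O(lambda^{1/2}) if the second one does not; compactness of the support makes this uniform.
    Which of the derivatives vanish is read off the equation phi(gamma(s)) = 0, differentiated once
    (non-characteristic case) or twice (curved case). *)
Require Import Defs.
From HB Require Import structures.
From mathcomp Require Import all_boot all_order all_algebra.
From mathcomp Require Import all_classical all_reals all_analysis.
From mathcomp Require Import complex.
From mathcomp Require Import unstable measurable_realfun ess_sup_inf.
From mathcomp Require Import ring lra.
Set Implicit Arguments. Unset Strict Implicit. Unset Printing Implicit Defensive.
Import Order.TTheory GRing.Theory Num.Theory.
Import numFieldNormedType.Exports.
Local Open Scope classical_set_scope.
Local Open Scope ring_scope.

(** * Measure-theoretic preliminaries *)

Section MeasureTools.
Context (R : realType).
Notation leb := (@lebesgue_measure R).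

(** What the overview leaves out is the arithmetic of exponents. If the sections of {|phi| <= lam}
    have measure O(lam^sigma) in the better direction and O(lam^tau) in the other, interpolating sup
    and L^2 bounds gains lam^gam with gam = sigma/q + (sigma + tau)/2 (1 - 2/q). The weight there is
    of size 1/lam, so levels lam = 2^-j down to 1/t contribute the sum of 2^(j(1 - gam)). The pairs
    (1/2, 1/2), (1, 1), (1, 1/2), (1, 0) give cases (c), (d), (e), (f); the logarithm is gam = 1,
    that is (1, 1) with q infinite. The better direction may change along Gamma, so the support is
    covered by two sets on which sigma and tau are exchanged. The sampling step is pi/b although xi
    + eta ranges over [-2b, 2b]: one frequency is always frozen and acts as a mere shift, and the
    other covers [-b, b], where exponentials of spacing pi/b are orthogonal. The same argument
    replaces Plancherel for the data: the transform of f is bounded in L^2 by 6 |f|_2, at the price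
    of the sharp constant. *)

Lemma lebesgue_measure_shift (a : R) (A : set (measurableTypeR R)) : measurable A ->
  leb A = leb [set x | A (x + a)].
Proof.
have ma : measurable_fun setT (fun x : measurableTypeR R => x + a : measurableTypeR R).
  by apply: measurable_funD.
move=> mA.
transitivity (pushforward leb (fun x : measurableTypeR R => x + a : measurableTypeR R) A) => //.
apply: (@lebesgue_measure_unique R _ _ A mA) => X [[u v]]/= uv <-.
rewrite /pushforward.
have -> : (fun x : measurableTypeR R => x + a) @^-1` `]u, v] = `](u - a), (v - a)]%classic.
  by apply/seteqP; split => x /=; rewrite !in_itv/= ltrBlDr lerBrDr.
rewrite !lebesgue_measure_itv/= !lte_fin ltrD2r.
by case: ifP => // _; rewrite -!EFinB; congr EFin; ring.
Qed.

Lemma ge0_integral_shift (a : R) (f : R -> \bar R) :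
  measurable_fun setT f -> (forall x, 0 <= f x)%E ->
  (\int[leb]_x f (x + a)%R = \int[leb]_x f x)%E.
Proof.
move=> mf f0.
have ma : measurable_fun setT (fun x : measurableTypeR R => x + a : measurableTypeR R).
  by apply: measurable_funD.
have := @ge0_integral_pushforward _ _ (measurableTypeR R) (measurableTypeR R) R _ ma
  leb setT (f : measurableTypeR R -> \bar R) measurableT mf (fun (x : R) _ => f0 x).
rewrite preimage_setT => /= H; rewrite -[LHS]/(\int[leb]_x (f \o (fun x : R => x + a)%R) x)%E -H.
apply: eq_measure_integral => A mA _.
by rewrite /= /pushforward -lebesgue_measure_shift.
Qed.

End MeasureTools.

Section Norms.
Context d (T : measurableType d) (R : realType) (mu : {measure set T -> \bar R}).
Implicit Types f g : T -> R.

Lemma Lnorm_EFin_le (r A : R) f : 0 < r -> 0 <= A ->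
  (\int[mu]_x (`|f x| `^ r)%:E <= (A `^ r)%:E)%E ->
  (Lnorm mu r%:E (EFin \o f) <= A%:E)%E.
Proof.
move=> r0 A0 h; rewrite unlock /=.
have -> : A%:E = (((A `^ r)%:E) `^ r^-1)%E.
  by rewrite poweR_EFin -powRrM mulfV ?gt_eqF// powRr1.
apply: gt0_ler_poweR => //.
- by rewrite invr_ge0 ltW.
- rewrite in_itv/= leey andbT; apply: integral_ge0 => x _.
  by rewrite lee_fin powR_ge0.
- by rewrite in_itv/= lee_fin powR_ge0 leey.
Qed.

Lemma Lnorm_EFin_ge (r A : R) f : 0 < r -> 0 <= A ->
  (Lnorm mu r%:E (EFin \o f) <= A%:E)%E ->
  (\int[mu]_x (`|f x| `^ r)%:E <= (A `^ r)%:E)%E.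
Proof.
move=> r0 A0 h.
have := @powR_Lnorm _ _ _ mu (EFin \o f) r (negbT (gt_eqF r0)).
move=> /= E; rewrite -[leLHS]/(\int[mu]_x (`|(f x)%:E| `^ r)%E)%E -E -poweR_EFin.
apply: gt0_ler_poweR => //; first exact: ltW.
- by rewrite in_itv/= Lnorm_ge0 leey.
- by rewrite in_itv/= lee_fin A0 leey.
Qed.

Lemma Lnorm_mono (p : \bar R) f g : (0 < p)%E ->
  measurable_fun setT f -> measurable_fun setT g ->
  (forall x, `|f x| <= `|g x|) ->
  (Lnorm mu p (EFin \o f) <= Lnorm mu p (EFin \o g))%E.
Proof.
move=> p0 mf mg fg; rewrite unlock; case: p p0 => [r r0|p0|//] /=.
  apply: gt0_ler_poweR => //.
  - by rewrite invr_ge0 ltW.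
  - rewrite in_itv/= leey andbT; apply: integral_ge0 => x _; by rewrite lee_fin powR_ge0.
  - rewrite in_itv/= leey andbT; apply: integral_ge0 => x _; by rewrite lee_fin powR_ge0.
  apply: ge0_le_integral => //.
  - by apply/measurable_EFinP; apply: measurableT_comp (measurable_powR _) _; apply: measurableT_comp.
  - by apply/measurable_EFinP; apply: measurableT_comp (measurable_powR _) _; apply: measurableT_comp.
  - move=> x _; rewrite lee_fin; apply: ge0_ler_powR => //; rewrite ?nnegrE//.
    exact: ltW.
case: ifPn => // _; apply: le_ess_sup; apply/nearW => x.
by rewrite /= lee_fin.
Qed.

Lemma cauchy_schwarz (A B : R) f g : 0 <= A -> 0 <= B ->
  measurable_fun setT f -> measurable_fun setT g ->
  (\int[mu]_x (f x ^+ 2)%:E <= (A ^+ 2)%:E)%E ->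
  (\int[mu]_x (g x ^+ 2)%:E <= (B ^+ 2)%:E)%E ->
  (\int[mu]_x (`|f x * g x|)%:E <= (A * B)%:E)%E.
Proof.
move=> A0 B0 mf mg hf hg.
have H := @hoelder _ _ _ mu f g 2 2 mf mg (ltr0Sn _ _) (ltr0Sn _ _).
have {H} := H ltac:(lra); rewrite Lnorm1 => H; apply: (le_trans H).
rewrite EFinM; apply: lee_pmul; rewrite ?Lnorm_ge0//.
- apply: (@Lnorm_EFin_le 2) => //; rewrite powR_mulrn//.
  by under eq_integral do rewrite powR_mulrn// real_normK ?num_real//.
- apply: (@Lnorm_EFin_le 2) => //; rewrite powR_mulrn//.
  by under eq_integral do rewrite powR_mulrn// real_normK ?num_real//.
Qed.

End Norms.

(** * Trigonometric polynomials on a period *)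

Section RealContinuity.
Context (R : realType) (T : topologicalType).
Implicit Types (f g : T -> R) (x : T).

(* Pointwise forms: the library lemmas are about [f + g], which does not unify with
   a function written as an abstraction. *)
Lemma continuous_addr f g x : {for x, continuous f} -> {for x, continuous g} ->
  {for x, continuous (fun y => f y + g y)}.
Proof. by move=> cf cg; exact: (@continuousD R R^o T f g x cf cg). Qed.

Lemma continuous_subr f g x : {for x, continuous f} -> {for x, continuous g} ->
  {for x, continuous (fun y => f y - g y)}.
Proof. by move=> cf cg; exact: (@continuousB R R^o T f g x cf cg). Qed.

Lemma continuous_mulr f g x : {for x, continuous f} -> {for x, continuous g} ->
  {for x, continuous (fun y => f y * g y)}.
Proof. by move=> cf cg; exact: (continuousM cf cg). Qed.

End RealContinuity.

Section Trig.
Context (R : realType).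
Notation leb := (@lebesgue_measure R).

Lemma continuous_integrable_itv (f : R -> R) (a b : R) : continuous f ->
  leb.-integrable `[a, b] (EFin \o f).
Proof.
move=> cf; apply: continuous_compact_integrable; first exact: segment_compact.
exact: continuous_subspaceT.
Qed.

Lemma Rintegral_FTC (f F : R -> R) (a b : R) : a < b -> continuous f ->
  (forall x : R, is_derive x 1 F (f x)) ->
  Rintegral leb `[a, b] f = F b - F a.
Proof.
move=> ab cf dF.
have cF : continuous F.
  by move=> x; have [dx _] := dF x; exact: differentiable_continuous (iffLR (derivable1_diffP F x) dx).
rewrite /Rintegral (@continuous_FTC2 _ f F a b ab) //=.
- exact: continuous_subspaceT.
- split.
  + by move=> x _; exact: ex_derive.
  + exact: cvg_at_right_filter (cF a).
  + exact: cvg_at_left_filter (cF b).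
- by move=> x _; rewrite derive1E derive_val.
Qed.

Lemma Rintegral_sum d (T : measurableType d) (mu : {measure set T -> \bar R})
  (D : set T) (N : nat) (f : nat -> T -> R) : measurable D ->
  (forall n, mu.-integrable D (EFin \o f n)) ->
  Rintegral mu D (fun x => \sum_(n < N) f n x) = \sum_(n < N) Rintegral mu D (f n).
Proof.
move=> mD fi; have H : mu.-integrable D (EFin \o (fun x => \sum_(n < N) f n x)) /\
    Rintegral mu D (fun x => \sum_(n < N) f n x) = \sum_(n < N) Rintegral mu D (f n).
  elim: N => [|N [IH1 IH2]].
    have -> : (fun x => \sum_(n < 0) f n x) = cst 0 by apply/funext => x; rewrite big_ord0.
    rewrite big_ord0; split; first exact: integrable0.
    by rewrite Rintegral_cst// mul0r.
  have -> : (fun x => \sum_(n < N.+1) f n x) = (fun x => \sum_(n < N) f n x + f N x).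
    by apply/funext => x; rewrite big_ord_recr.
  split; last by rewrite big_ord_recr/= -IH2 RintegralD.
  by have := integrableD mD IH1 (fi N); exact: eq_integrable.
by case: H.
Qed.

(** With omega_n = x0 + n h, [trigc] and [trigs] are the real and imaginary parts of the sum of (c_n
    - i d_n) e^{i omega_n z}. *)
Definition trigc (c d : nat -> R) (x0 h : R) (N : nat) (z : R) : R :=
  \sum_(n < N) (c n * cos ((x0 + n%:R * h) * z) + d n * sin ((x0 + n%:R * h) * z)).

Definition trigs (c d : nat -> R) (x0 h : R) (N : nat) (z : R) : R :=
  \sum_(n < N) (c n * sin ((x0 + n%:R * h) * z) - d n * cos ((x0 + n%:R * h) * z)).

Lemma continuous_cosM (w : R) : continuous (fun z => cos (w * z)).
Proof.
move=> z; apply: (@continuous_comp _ _ _ (fun z => w * z) cos).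
  by apply: (@continuous_mulr _ _ (fun z => _) (fun z => _)); [exact: cst_continuous|].
exact: continuous_cos.
Qed.

Lemma continuous_sinM (w : R) : continuous (fun z => sin (w * z)).
Proof.
move=> z; apply: (@continuous_comp _ _ _ (fun z => w * z) sin).
  by apply: (@continuous_mulr _ _ (fun z => _) (fun z => _)); [exact: cst_continuous|].
exact: continuous_sin.
Qed.

Lemma continuous_trigc c d x0 h N : continuous (trigc c d x0 h N).
Proof.
rewrite /trigc; elim: N => [|N IH].
  by under eq_fun do rewrite big_ord0; move=> z; exact: cst_continuous.
under eq_fun do rewrite big_ord_recr/=.
move=> z; apply: (@continuous_addr _ _ (fun z => _) (fun z => _)); first exact: IH.
by apply: (@continuous_addr _ _ (fun z => _) (fun z => _)); apply: (@continuous_mulr _ _ (fun z => _) (fun z => _));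
  try exact: cst_continuous;
  [exact: continuous_cosM|exact: continuous_sinM].
Qed.

Lemma continuous_trigs c d x0 h N : continuous (trigs c d x0 h N).
Proof.
rewrite /trigs; elim: N => [|N IH].
  by under eq_fun do rewrite big_ord0; move=> z; exact: cst_continuous.
under eq_fun do rewrite big_ord_recr/=.
move=> z; apply: (@continuous_addr _ _ (fun z => _) (fun z => _)); first exact: IH.
by apply: (@continuous_subr _ _ (fun z => _) (fun z => _)); apply: (@continuous_mulr _ _ (fun z => _) (fun z => _));
  try exact: cst_continuous;
  [exact: continuous_sinM|exact: continuous_cosM].
Qed.

Lemma is_derive_sin_affine (w eta x : R) :
  is_derive x 1 (fun x => sin (w * (x + eta))) (cos (w * (x + eta)) * w).
Proof.
have h : is_derive x 1 (fun x : R => w * (x + eta)) w.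
  by apply: is_derive_eq; rewrite /GRing.scale/= addr0 mulr1.
exact: (@is_derive1_comp R sin _ x _ _ (is_derive_sin (w * (x + eta))) h).
Qed.

Lemma is_derive_cos_affine (w eta x : R) :
  is_derive x 1 (fun x => cos (w * (x + eta))) (- sin (w * (x + eta)) * w).
Proof.
have h : is_derive x 1 (fun x : R => w * (x + eta)) w.
  by apply: is_derive_eq; rewrite /GRing.scale/= addr0 mulr1.
exact: (@is_derive1_comp R cos _ x _ _ (is_derive_cos (w * (x + eta))) h).
Qed.

(** The hypothesis [w * B = - (k%:R * pi)] makes [[- B, B]] consist of k full periods, so the
    antiderivative [F] takes the same value at both ends. The sign is that of omega_n - omega_N with
    n < N, the frequency to which this is applied. *)
Lemma Rintegral_trig_period (al be w eta B : R) (k : nat) : 0 < B -> w != 0 ->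
  w * B = - (k%:R * pi) ->
  Rintegral leb `[- B, B]
    (fun x => al * cos (w * (x + eta)) - be * sin (w * (x + eta))) = 0.
Proof.
move=> B0 w0 wB.
have cw : continuous (fun x : R => x + eta).
  by move=> x; apply: (@continuous_addr _ _ (fun z => _) (fun z => _)) => //; exact: cst_continuous.
pose F x := (al * sin (w * (x + eta)) + be * cos (w * (x + eta))) / w.
pose f x := al * cos (w * (x + eta)) - be * sin (w * (x + eta)).
have cf : continuous f.
  move=> x; apply: (@continuous_subr _ _ (fun z => _) (fun z => _));
    apply: (@continuous_mulr _ _ (fun z => _) (fun z => _));
    try exact: cst_continuous.
  + exact: (continuous_comp (cw x) (@continuous_cosM w _)).
  + exact: (continuous_comp (cw x) (@continuous_sinM w _)).
have dF (x : R) : is_derive x 1 F (f x).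
  have := is_deriveZ w^-1 (is_deriveD (is_deriveZ al (is_derive_sin_affine w eta x))
    (is_deriveZ be (is_derive_cos_affine w eta x))).
  have -> : w^-1 \*: ((al \*: (fun x => sin (w * (x + eta)))) +
      (be \*: (fun x => cos (w * (x + eta))))) = F.
    by apply/funext => y; rewrite /F mulrC.
  have -> // : w^-1 *: (al *: (cos (w * (x + eta)) * w) + be *: (- sin (w * (x + eta)) * w)) = f x.
  by rewrite /f /GRing.scale/=; field.
have nB : - B < B by rewrite gtrN.
transitivity (F B - F (- B)); first exact: (@Rintegral_FTC f F _ _ nB cf dF).
rewrite /F.
have e : w * (- B + eta) = w * (B + eta) + (pi *+ 2) *+ k.
  by rewrite !mulrDr mulrN wB -mulrnA -[pi *+ _]mulr_natr natrM; ring.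
by rewrite e (periodicn (@sinD2pi R)) (periodicn (@cosD2pi R)) subrr.
Qed.

(** Orthogonality holds for complex exponentials, not for their real parts: x0 being arbitrary,
    products of cosines also contain the frequencies omega_n + omega_N, which need not fit the
    period. The square of [trigs] is therefore added, the integral [E] of the sum is computed
    exactly by induction on N, and dropping [trigs] gives the inequality. The shift [eta] only
    changes phases. *)
Lemma trigc_period_l2 (c d : nat -> R) (x0 h B eta : R) (N : nat) : 0 < B -> h * B = pi ->
  (\int[leb]_(x in `[(- B)%R, B]) ((trigc c d x0 h N (x + eta)%R) ^+ 2)%:E <=
   (2 * B * \sum_(n < N) (c n ^+ 2 + d n ^+ 2))%:E)%E.
Proof.
move=> B0 hB.
have cw : continuous (fun x : R => x + eta).
  by move=> x; apply: (@continuous_addr _ _ (fun z => _) (fun z => _)) => //; exact: cst_continuous.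
have ctc n (x : R) : {for x, continuous (fun x : R => trigc c d x0 h n (x + eta))}.
  by apply: continuous_comp (cw x) _; exact: continuous_trigc.
have cts n (x : R) : {for x, continuous (fun x : R => trigs c d x0 h n (x + eta))}.
  by apply: continuous_comp (cw x) _; exact: continuous_trigs.
pose E n := Rintegral leb `[- B, B] (fun x : R =>
   trigc c d x0 h n (x + eta) ^+ 2 + trigs c d x0 h n (x + eta) ^+ 2).
have EE : E N = 2 * B * \sum_(n < N) (c n ^+ 2 + d n ^+ 2).
  elim: N => [|N IH].
    rewrite /E /trigc /trigs; under eq_Rintegral do rewrite !big_ord0 expr0n addr0.
    by rewrite Rintegral_cst//= mul0r big_ord0 mulr0.
  rewrite big_ord_recr mulrDr /= -IH /E.
  (* Cross term of the modes n and N in the squared modulus: twice the real part of (c_n - i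
     d_n)(c_N + i d_N) e^{i(omega_n - omega_N)(x + eta)}. Its frequency is a nonzero multiple of h,
     so it integrates to zero. *)
  pose g n x := 2 * ((c n * c N + d n * d N) * cos (- ((N - n)%:R * h) * (x + eta))
     - (c n * d N - d n * c N) * sin (- ((N - n)%:R * h) * (x + eta))).
  have cg n : continuous (g n).
    move=> x; apply: (@continuous_mulr _ _ (fun z => _) (fun z => _)); first exact: cst_continuous.
    apply: (@continuous_subr _ _ (fun z => _) (fun z => _)); apply: (@continuous_mulr _ _ (fun z => _) (fun z => _));
      try exact: cst_continuous.
    + exact: (continuous_comp (cw x) (@continuous_cosM _ _)).
    + exact: (continuous_comp (cw x) (@continuous_sinM _ _)).
  transitivity (Rintegral leb `[- B, B] (fun x : R =>
    (trigc c d x0 h N (x + eta) ^+ 2 + trigs c d x0 h N (x + eta) ^+ 2) +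
    ((c N ^+ 2 + d N ^+ 2) + \sum_(n < N) g n x))).
    apply: eq_Rintegral => x _; rewrite /trigc /trigs !big_ord_recr/=.
    set P := \sum_(i < N) _; set Q := \sum_(i < N) _.
    set u := (x0 + N%:R * h) * (x + eta).
    have -> : \sum_(n < N) g n x = 2 * (P * (c N * cos u + d N * sin u) + Q * (c N * sin u - d N * cos u)).
      rewrite /P /Q !mulr_suml -big_split/= mulr_sumr; apply: eq_bigr => n _.
      rewrite /g; congr (2 * _).
      have -> : - ((N - n)%:R * h) * (x + eta) = (x0 + n%:R * h) * (x + eta) - u.
        by rewrite /u natrB ?(ltnW (ltn_ord n))//; ring.
      by rewrite cosB sinB; ring.
    have := cos2Dsin2 u; move: (cos u) (sin u) => C S CS.
    transitivity (P^+2 + Q^+2 + ((c N ^+ 2 + d N ^+ 2) * (C ^+ 2 + S ^+ 2) +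
      2 * (P * (c N * C + d N * S) + Q * (c N * S - d N * C)))); first by ring.
    by rewrite CS mulr1.
  have i1 : continuous (fun x : R => trigc c d x0 h N (x + eta) ^+ 2 + trigs c d x0 h N (x + eta) ^+ 2).
    by move=> x; apply: (@continuous_addr _ _ (fun z => _) (fun z => _));
      apply: (@continuous_mulr _ _ (fun z => _) (fun z => _)); first [exact: ctc | exact: cts].
  have i2 : continuous (fun x => \sum_(n < N) g n x).
    elim: (N) => [|n IHn]; first by under eq_fun do rewrite big_ord0; exact: cst_continuous.
    under eq_fun do rewrite big_ord_recr/=.
    by move=> x; apply: (@continuous_addr _ _ (fun z => _) (fun z => _)); [exact: IHn|exact: cg].
  have i3 : continuous (fun x => (c N ^+ 2 + d N ^+ 2) + \sum_(n < N) g n x).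
    by move=> x; apply: (@continuous_addr _ _ (fun z => _) (fun z => _)); [exact: cst_continuous|exact: i2].
  rewrite RintegralD//; try exact: continuous_integrable_itv.
  congr (_ + _).
  rewrite RintegralD//; try (apply: continuous_integrable_itv => //; exact: cst_continuous).
  have -> : Rintegral leb `[- B, B] (fun x : R => \sum_(n < N) g n x) =
      \sum_(n < N) Rintegral leb `[- B, B] (g n).
    by apply: Rintegral_sum => // n; exact: continuous_integrable_itv.
  rewrite big1 ?addr0; last first.
    move=> n _; rewrite /g RintegralZl//; last first.
      apply: continuous_integrable_itv => x; apply: (@continuous_subr _ _ (fun z => _) (fun z => _));
        apply: (@continuous_mulr _ _ (fun z => _) (fun z => _)); try exact: cst_continuous.
      + exact: (continuous_comp (cw x) (@continuous_cosM _ _)).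
      + exact: (continuous_comp (cw x) (@continuous_sinM _ _)).
    rewrite (@Rintegral_trig_period _ _ _ _ _ (N - n)) ?mulr0//.
    + rewrite oppr_eq0 mulf_neq0 ?pnatr_eq0 -?lt0n ?subn_gt0//.
      by apply/eqP => h0; move: hB (pi_gt0 R); rewrite h0 mul0r => <-; rewrite ltxx.
    + by rewrite mulNr -mulrA hB.
  rewrite Rintegral_cst//= lebesgue_measure_itv/= lte_fin gtrN//= opprK mulrC; congr (_ * _).
  by ring.
have iN : continuous (fun x : R => trigc c d x0 h N (x + eta) ^+ 2 + trigs c d x0 h N (x + eta) ^+ 2).
  by move=> x; apply: (@continuous_addr _ _ (fun z => _) (fun z => _));
    apply: (@continuous_mulr _ _ (fun z => _) (fun z => _)); first [exact: ctc | exact: cts].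
rewrite -EE /E /Rintegral fineK; last first.
  by apply: integrable_fin_num => //; exact: continuous_integrable_itv.
apply: ge0_le_integral => //.
- by move=> x _; rewrite lee_fin sqr_ge0.
- apply/measurable_EFinP; apply: measurable_funTS; apply: continuous_measurable_fun.
  by move=> x; apply: (@continuous_mulr _ _ (fun z => _) (fun z => _)); exact: ctc.
- by apply/measurable_EFinP; apply: measurable_funTS; apply: continuous_measurable_fun.
- by move=> x _; rewrite lee_fin lerDl sqr_ge0.
Qed.

End Trig.

(** * Bessel inequality for oscillatory integrals *)

Section Lipschitz.
Context (R : realType).

Lemma lipschitz_of_derive (F f : R -> R) (M : R) :
  (forall x : R, is_derive x 1 F (f x)) -> (forall x, `|f x| <= M) ->
  forall x y, `|F x - F y| <= M * `|x - y|.
Proof.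
move=> dF fM x y.
have cF : continuous F.
  by move=> z; have [dz _] := dF z; exact: differentiable_continuous (iffLR (derivable1_diffP F z) dz).
wlog xy : x y / y <= x.
  move=> H; have [|/ltW] := leP y x; first exact: H.
  by move=> /H; rewrite distrC [`|x - y|]distrC.
have [c _ ->] := @MVT_segment R F f y x xy (fun z _ => dF z) (continuous_subspaceT cF).
by rewrite normrM ler_wpM2r.
Qed.

Lemma cos_lipschitz (x y : R) : `|cos x - cos y| <= `|x - y|.
Proof.
rewrite -[leRHS]mul1r; apply: (@lipschitz_of_derive cos (fun x => - sin x)) => z.
by rewrite normrN ler_norml sin_geN1 sin_le1.
Qed.

Lemma sin_lipschitz (x y : R) : `|sin x - sin y| <= `|x - y|.
Proof.
rewrite -[leRHS]mul1r; apply: (@lipschitz_of_derive sin cos) => z.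
by rewrite ler_norml cos_geN1 cos_le1.
Qed.

Lemma lipschitz_continuous (g : R -> R) (K : R) :
  (forall x y, `|g x - g y| <= K * `|x - y|) -> continuous g.
Proof.
move=> gK x; apply/cvgrPdist_le => /= e e0.
have K1 : 0 < `|K| + 1 by rewrite ltr_wpDl.
near=> y.
have h : `|x - y| <= e / (`|K| + 1).
  near: y; apply: (@cvgr_dist_le _ _ _ _ _ id x) => //; exact: divr_gt0.
apply: (le_trans (gK _ _)); apply: (@le_trans _ _ ((`|K| + 1) * `|x - y|)).
  by apply: ler_wpM2r => //; rewrite (le_trans (ler_norm K))// lerDl.
by rewrite mulrC -ler_pdivlMr.
Unshelve. all: by end_near.
Qed.

End Lipschitz.

Section OscillatoryIntegral.
Context d (T : measurableType d) (R : realType) (mu : {measure set T -> \bar R}).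
Implicit Types (z w k f : T -> R).

Lemma integrable_bounded_mul k w (C : R) : measurable_fun setT k ->
  (forall p, `|k p| <= C) -> mu.-integrable setT (EFin \o w) ->
  mu.-integrable setT (EFin \o (fun p => k p * w p)).
Proof.
move=> mk kC iw.
have /measurable_EFinP mw := measurable_int _ iw.
apply: (@le_integrable _ _ _ mu _ measurableT _ (fun p => C%:E * (EFin \o w) p)%E).
- by apply/measurable_EFinP; exact: measurable_funM.
- move=> p _; rewrite /= !normrM lee_fin; apply: ler_wpM2r => //.
  by rewrite (le_trans (kC p))// ler_norm.
- exact: integrableZl.
Qed.

Lemma normr_Rintegral_le f (A : R) : mu.-integrable setT (EFin \o f) ->
  (\int[mu]_p `|f p|%:E <= A%:E)%E -> `|Rintegral mu setT f| <= A.
Proof.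
move=> fi fA; rewrite -lee_fin EFin_normr_Rintegral//.
apply: le_trans fA; apply: (le_trans (le_abse_integral _ _ _)) => //.
exact: measurable_int fi.
Qed.

Lemma integrable_of_abs f (A : R) : measurable_fun setT f ->
  (\int[mu]_p `|f p|%:E <= A%:E)%E -> mu.-integrable setT (EFin \o f).
Proof.
move=> mf fA; apply/integrableP; split; first exact/measurable_EFinP.
exact: (le_lt_trans fA (ltry _)).
Qed.

Definition osc_cos z w (x : R) : R := Rintegral mu setT (fun p => cos (x * z p) * w p).
Definition osc_sin z w (x : R) : R := Rintegral mu setT (fun p => sin (x * z p) * w p).
(** For a real weight this is comparable to the modulus of the integral of e^{ixz} w. The sum of
    absolute values is subadditive in [w] at once and avoids complex numbers. *)
Definition osc_amp z w (x : R) : R := `|osc_cos z w x| + `|osc_sin z w x|.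

Lemma measurable_cosM z x : measurable_fun setT z -> measurable_fun setT (fun p => cos (x * z p)).
Proof.
move=> mz; apply: measurableT_comp; first exact: continuous_measurable_fun (@continuous_cos R).
by apply: measurable_funM => //; exact: measurable_cst.
Qed.

Lemma measurable_sinM z x : measurable_fun setT z -> measurable_fun setT (fun p => sin (x * z p)).
Proof.
move=> mz; apply: measurableT_comp; first exact: continuous_measurable_fun (@continuous_sin R).
by apply: measurable_funM => //; exact: measurable_cst.
Qed.

Lemma cos_le1n (x : R) : `|cos x| <= 1.
Proof. by rewrite ler_norml cos_geN1 cos_le1. Qed.

Lemma sin_le1n (x : R) : `|sin x| <= 1.
Proof. by rewrite ler_norml sin_geN1 sin_le1. Qed.

Lemma integrable_osc_cos z w x : measurable_fun setT z -> mu.-integrable setT (EFin \o w) ->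
  mu.-integrable setT (EFin \o (fun p => cos (x * z p) * w p)).
Proof.
move=> mz; apply: (@integrable_bounded_mul _ _ 1); first exact: measurable_cosM.
by move=> p; exact: cos_le1n.
Qed.

Lemma integrable_osc_sin z w x : measurable_fun setT z -> mu.-integrable setT (EFin \o w) ->
  mu.-integrable setT (EFin \o (fun p => sin (x * z p) * w p)).
Proof.
move=> mz; apply: (@integrable_bounded_mul _ _ 1); first exact: measurable_sinM.
by move=> p; exact: sin_le1n.
Qed.

Lemma le_int_abs f w (K A : R) : 0 <= K -> measurable_fun setT f -> measurable_fun setT w ->
  (forall p, `|f p| <= K * `|w p|) -> (\int[mu]_p `|w p|%:E <= A%:E)%E ->
  (\int[mu]_p `|f p|%:E <= (K * A)%:E)%E.
Proof.
move=> K0 mf mw fw wA.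
apply: (@le_trans _ _ (\int[mu]_p (K%:E * `|w p|%:E))%E).
  apply: ge0_le_integral => //.
  - by apply/measurable_EFinP; exact: measurableT_comp.
  - by apply/measurable_EFinP; apply: measurable_funM => //; exact: measurableT_comp.
  - by move=> p _; rewrite -EFinM lee_fin.
rewrite ge0_integralZl//; last by apply/measurable_EFinP; exact: measurableT_comp.
by rewrite EFinM lee_wpmul2l.
Qed.

Lemma osc_cos_le z w A x : measurable_fun setT z -> measurable_fun setT w ->
  (\int[mu]_p `|w p|%:E <= A%:E)%E -> `|osc_cos z w x| <= A.
Proof.
move=> mz mw wA; have iw := integrable_of_abs mw wA.
apply: normr_Rintegral_le; first exact: integrable_osc_cos.
rewrite -[A]mul1r; apply: le_int_abs wA => //.
  by apply: measurable_funM => //; exact: measurable_cosM.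
by move=> p; rewrite normrM ler_wpM2r// cos_le1n.
Qed.

Lemma osc_sin_le z w A x : measurable_fun setT z -> measurable_fun setT w ->
  (\int[mu]_p `|w p|%:E <= A%:E)%E -> `|osc_sin z w x| <= A.
Proof.
move=> mz mw wA; have iw := integrable_of_abs mw wA.
apply: normr_Rintegral_le; first exact: integrable_osc_sin.
rewrite -[A]mul1r; apply: le_int_abs wA => //.
  by apply: measurable_funM => //; exact: measurable_sinM.
by move=> p; rewrite normrM ler_wpM2r// sin_le1n.
Qed.

(** Varying x brings down a factor [z], which is bounded on the support of [w]. The estimate serves
    to make the transform continuous in x, hence measurable. *)
Lemma osc_cos_lipschitz z w A Z : 0 <= Z -> measurable_fun setT z -> measurable_fun setT w ->
  (\int[mu]_p `|w p|%:E <= A%:E)%E -> (forall p, w p != 0 -> `|z p| <= Z) ->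
  forall x y, `|osc_cos z w x - osc_cos z w y| <= Z * A * `|x - y|.
Proof.
move=> Z0 mz mw wA zZ x y; have iw := integrable_of_abs mw wA.
rewrite /osc_cos -RintegralB//; try exact: integrable_osc_cos.
rewrite mulrAC [_ * A]mulrC [A * _]mulrC.
have mf : measurable_fun setT (fun p => cos (x * z p) * w p - cos (y * z p) * w p).
  by apply: measurable_funB; apply: measurable_funM => //; exact: measurable_cosM.
have H : (\int[mu]_p `|cos (x * z p) * w p - cos (y * z p) * w p|%:E <= (Z * `|x - y| * A)%:E)%E.
  apply: le_int_abs wA => //; first exact: mulr_ge0.
  move=> p; rewrite -mulrBl normrM; have [->|w0] := eqVneq (w p) 0.
    by rewrite normr0 !mulr0.
  apply: ler_wpM2r => //; apply: (le_trans (cos_lipschitz _ _)).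
  by rewrite -mulrBl normrM mulrC ler_wpM2r// zZ.
by apply: normr_Rintegral_le => //; exact: integrable_of_abs H.
Qed.

Lemma osc_sin_lipschitz z w A Z : 0 <= Z -> measurable_fun setT z -> measurable_fun setT w ->
  (\int[mu]_p `|w p|%:E <= A%:E)%E -> (forall p, w p != 0 -> `|z p| <= Z) ->
  forall x y, `|osc_sin z w x - osc_sin z w y| <= Z * A * `|x - y|.
Proof.
move=> Z0 mz mw wA zZ x y; have iw := integrable_of_abs mw wA.
rewrite /osc_sin -RintegralB//; try exact: integrable_osc_sin.
rewrite mulrAC [_ * A]mulrC [A * _]mulrC.
have mf : measurable_fun setT (fun p => sin (x * z p) * w p - sin (y * z p) * w p).
  by apply: measurable_funB; apply: measurable_funM => //; exact: measurable_sinM.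
have H : (\int[mu]_p `|sin (x * z p) * w p - sin (y * z p) * w p|%:E <= (Z * `|x - y| * A)%:E)%E.
  apply: le_int_abs wA => //; first exact: mulr_ge0.
  move=> p; rewrite -mulrBl normrM; have [->|w0] := eqVneq (w p) 0.
    by rewrite normr0 !mulr0.
  apply: ler_wpM2r => //; apply: (le_trans (sin_lipschitz _ _)).
  by rewrite -mulrBl normrM mulrC ler_wpM2r// zZ.
by apply: normr_Rintegral_le => //; exact: integrable_of_abs H.
Qed.

(* Testing [w] against the trigonometric polynomial whose coefficients are the sampled
   values themselves gives [S <= A sqrt S] for the sum [S] of their squares. *)
Lemma bessel z w (A : R) (x0 h : R) (N : nat) : 0 <= A -> measurable_fun setT z ->
  mu.-integrable setT (EFin \o w) ->
  (forall c d : nat -> R, (\int[mu]_p `|trigc c d x0 h N (z p) * w p|%:E <=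
     (A * Num.sqrt (\sum_(n < N) (c n ^+ 2 + d n ^+ 2)))%:E)%E) ->
  \sum_(n < N) (osc_cos z w (x0 + n%:R * h) ^+ 2 + osc_sin z w (x0 + n%:R * h) ^+ 2) <= A ^+ 2.
Proof.
move=> A0 mz iw H.
pose c n := osc_cos z w (x0 + n%:R * h); pose d' n := osc_sin z w (x0 + n%:R * h).
set S := (X in X <= _); have S0 : 0 <= S.
  by apply: sumr_ge0 => n _; apply: addr_ge0; exact: sqr_ge0.
pose g (n : nat) p := c n * (cos ((x0 + n%:R * h) * z p) * w p) + d' n * (sin ((x0 + n%:R * h) * z p) * w p).
have ig n : mu.-integrable setT (EFin \o g n).
  have := integrableD measurableT
    (integrableZl measurableT (c n) (integrable_osc_cos (x0 + n%:R * h) mz iw))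
    (integrableZl measurableT (d' n) (integrable_osc_sin (x0 + n%:R * h) mz iw)).
  by apply: eq_integrable => // p _ /=; rewrite /g EFinD !EFinM.
have gE p : \sum_(n < N) g n p = trigc c d' x0 h N (z p) * w p.
  by rewrite /trigc mulr_suml; apply: eq_bigr => n _; rewrite /g; ring.
have SE : S = Rintegral mu setT (fun p => \sum_(n < N) g n p).
  rewrite Rintegral_sum//; apply: eq_bigr => n _.
  rewrite /g RintegralD//; last 2 first.
  - have := integrableZl measurableT (c n) (integrable_osc_cos (x0 + n%:R * h) mz iw).
    by apply: eq_integrable => // p _ /=; rewrite EFinM.
  - have := integrableZl measurableT (d' n) (integrable_osc_sin (x0 + n%:R * h) mz iw).
    by apply: eq_integrable => // p _ /=; rewrite EFinM.
  by rewrite !RintegralZl//; [exact: integrable_osc_sin|exact: integrable_osc_cos].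
have SA : S <= A * Num.sqrt S.
  rewrite {1}SE; apply: le_trans (ler_norm _) _.
  under eq_Rintegral do rewrite gE.
  apply: normr_Rintegral_le; last exact: H.
  apply: (integrable_of_abs _ (H c d')).
  apply: measurable_funM; last by apply/measurable_EFinP; exact: measurable_int iw.
  by apply: measurableT_comp => //; apply: continuous_measurable_fun; exact: continuous_trigc.
have [S00|Sp] := leP S 0; first by rewrite (le_trans S00)// sqr_ge0.
have sS : 0 < Num.sqrt S by rewrite sqrtr_gt0.
have : Num.sqrt S <= A.
  by rewrite -(ler_pM2r sS) -expr2 sqr_sqrtr.
by move=> h1; rewrite -(sqr_sqrtr S0) ler_sqr// nnegrE sqrtr_ge0.
Qed.

End OscillatoryIntegral.

(** * From sums over arithmetic progressions to integrals over the line *)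

Section Periodization.
Context (R : realType).
Notation leb := (@lebesgue_measure R).

(** Cutting the line into cells of length h and folding them onto []0, h]] turns the integral into
    that of sums over progressions of step h, each at most M. This is where the base point of the
    progression has to be arbitrary. *)
Lemma ge0_integral_periodized (g : R -> R) (h M : R) : 0 < h -> measurable_fun setT g ->
  (forall x, 0 <= g x) ->
  (forall x0 N, \sum_(n < N) g (x0 + n%:R * h) <= M) ->
  (\int[leb]_x (g x)%:E <= (h * M)%:E)%E.
Proof.
move=> h0 mg g0 gM.
have mge : measurable_fun setT (EFin \o g) by exact/measurable_EFinP.
have mgs a : measurable_fun setT (fun x : R => g (x + a)).
  by apply: measurableT_comp => //; apply: measurable_funD => //; exact: measurable_cst.
have step a : (\int[leb]_(x in `]a, (a + h)%R]) (g x)%:E =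
    \int[leb]_(x in `]0%R, h]) (g (x + a)%R)%:E)%E.
  rewrite integral_mkcond [RHS]integral_mkcond -(@ge0_integral_shift R a); last 2 first.
  - by apply: (iffLR (measurable_restrictT _ _)); [exact: measurable_itv|exact: (measurable_funTS mge)].
  - by move=> x; rewrite erestrict_ge0// => y _; rewrite lee_fin.
  apply: eq_integral => x _; rewrite /patch !mem_setE !in_itv/=.
  by rewrite -ltrBlDr subrr addrC lerD2l.
have sumE a N : (\int[leb]_(x in `]a, (a + N%:R * h)%R]) (g x)%:E =
    \int[leb]_(x in `]0%R, h]) (\sum_(n < N) g (x + a + n%:R * h)%R)%:E)%E.
  elim: N => [|N IH].
    rewrite mul0r addr0 set_itvoc0 integral_set0.
    by under eq_integral do rewrite big_ord0; rewrite integral0.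
  have -> : `]a, (a + N.+1%:R * h)]%classic =
     `]a, (a + N%:R * h)]%classic `|` `](a + N%:R * h), (a + N%:R * h + h)]%classic.
    have -> : a + N.+1%:R * h = a + N%:R * h + h by rewrite -[N.+1]addn1 natrD; ring.
    by rewrite -itv_bndbnd_setU// bnd_simp lerDl ?(ltW h0)// mulr_ge0// ltW.
  rewrite ge0_integral_setU//; last 3 first.
  - exact: measurable_funTS.
  - by move=> x _; rewrite lee_fin.
  - apply/disj_setPS => x [] /=; rewrite !in_itv/= => /andP[_ l1] /andP[l2 _].
    by move: (lt_le_trans l2 l1); rewrite ltxx.
  rewrite IH step -ge0_integralD//; last 4 first.
  - by move=> x _; rewrite lee_fin sumr_ge0.
  - apply: measurable_funTS; apply/measurable_EFinP; apply: measurable_sum => n.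
    under eq_fun do rewrite -addrA; exact: mgs.
  - by move=> x _; rewrite lee_fin.
  - by apply: measurable_funTS; apply/measurable_EFinP; exact: mgs.
  by apply: eq_integral => x _; rewrite big_ord_recr/= EFinD addrA.
have bnd a N : (\int[leb]_(x in `]a, (a + N%:R * h)%R]) (g x)%:E <= (h * M)%:E)%E.
  rewrite sumE; apply: (@le_trans _ _ (\int[leb]_(x in `]0%R, h]) (cst M%:E) x)%E).
    apply: ge0_le_integral => //.
    - by move=> x _; rewrite lee_fin sumr_ge0.
    - apply: measurable_funTS; apply/measurable_EFinP; apply: measurable_sum => n.
      under eq_fun do rewrite -addrA; exact: mgs.
    - by move=> x _; rewrite lee_fin; exact: gM.
  by rewrite integral_cst//= lebesgue_measure_itv/= lte_fin h0 oppr0 adde0 -EFinM mulrC.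
(* The windows ]-nh, nh], with the right end written as left end plus 2n cells to fit [bnd]; they
   exhaust the line, and monotone convergence concludes. *)
pose F (n : nat) : set R := `](- (n%:R * h)), (- (n%:R * h) + (n + n)%:R * h)]%classic.
have ndF : {homo F : n m / (n <= m)%N >-> (n <= m)%O}.
  move=> n m nm; apply/subsetPset => x; rewrite /F /= !in_itv/= !natrD.
  have : n%:R * h <= m%:R * h by rewrite ler_wpM2r ?ler_nat// ltW.
  by move=> nmh /andP[l1 l2]; apply/andP; split; lra.
have UF : \bigcup_i F i = setT.
  apply/seteqP; split => // x _.
  have [n nx] : exists n : nat, `|x| / h < n%:R.
    by exists (Num.bound (`|x| / h)); apply: archi_boundP; rewrite divr_ge0// ltW.
  exists n => //; rewrite /F /= in_itv/= natrD.
  move: nx; rewrite ltr_pdivrMr// => nx.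
  by have := ler_norm x; have := ler_norm (- x); rewrite normrN => *; apply/andP; split; lra.
have := @ge0_nondecreasing_set_cvg_integral _ (measurableTypeR R) R F (EFin \o g) leb ndF
  (fun i => measurable_itv _) (fun i => measurable_funTS mge)
  (fun i x _ => g0 x).
rewrite UF => cv.
rewrite -(cvg_lim _ cv)//; apply: lime_le; first by apply/cvg_ex; eexists; exact: cv.
by apply: nearW => n; exact: bnd.
Qed.

End Periodization.

(** * Weights dominated by a product *)

Section PlaneKernels.
Context (R : realType).
Notation leb := (@lebesgue_measure R).
Notation leb2 := (product_measure1 leb leb).
Notation plane := (measurableTypeR R * measurableTypeR R)%type.
Implicit Types (F G H : R -> R) (K w : plane -> R) (S : set plane).

(** Tonelli with the second variable integrated first: the sections of [K] cost [s], and the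
    integral of [H] is left. It is applied with [K] an indicator, whose sections have small measure,
    and with [K] a squared trigonometric polynomial cut off to one period. *)
Lemma int_kernel_fst K H (s A : R) : measurable_fun setT K -> measurable_fun setT H ->
  (forall p, 0 <= K p) -> (forall x, 0 <= H x) -> 0 <= s ->
  (forall x, (\int[leb]_y (K (x, y))%:E <= s%:E)%E) ->
  (\int[leb]_x (H x)%:E <= A%:E)%E ->
  (\int[leb2]_p (K p * H p.1)%:E <= (s * A)%:E)%E.
Proof.
move=> mK mH K0 H0 s0 Ks HA.
have mKH : measurable_fun setT (fun p : plane => (K p * H p.1)%:E).
  apply/measurable_EFinP; apply: measurable_funM => //.
  by apply: measurableT_comp => //; exact: measurable_fst.
rewrite (@fubini_tonelli1 _ _ _ _ R leb leb _ mKH); last by move=> p; rewrite lee_fin mulr_ge0.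
apply: (@le_trans _ _ (\int[leb]_x (s%:E * (H x)%:E))%E).
  apply: ge0_le_integral => //.
  - by move=> x _; apply: integral_ge0 => y _; rewrite lee_fin mulr_ge0.
  - by apply: measurable_fun_fubini_tonelli_F => // p; rewrite lee_fin mulr_ge0.
  - by apply/measurable_EFinP; apply: measurable_funM => //; exact: measurable_cst.
  - move=> x _; rewrite /fubini_F /=.
    under eq_integral do rewrite EFinM.
    rewrite ge0_integralZr//; last 3 first.
    + by apply/measurable_EFinP; apply: measurableT_comp => //; exact: measurable_pair1.
    + by move=> y _; rewrite lee_fin.
    + by rewrite lee_fin.
    by apply: lee_wpmul2r; [rewrite lee_fin|exact: Ks].
rewrite ge0_integralZl ?lee_fin//; last 2 first.
- exact/measurable_EFinP.
- by move=> x _; rewrite lee_fin.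
by rewrite EFinM lee_wpmul2l// lee_fin.
Qed.

Lemma int_kernel_snd K H (s A : R) : measurable_fun setT K -> measurable_fun setT H ->
  (forall p, 0 <= K p) -> (forall x, 0 <= H x) -> 0 <= s ->
  (forall y, (\int[leb]_x (K (x, y))%:E <= s%:E)%E) ->
  (\int[leb]_x (H x)%:E <= A%:E)%E ->
  (\int[leb2]_p (K p * H p.2)%:E <= (s * A)%:E)%E.
Proof.
move=> mK mH K0 H0 s0 Ks HA.
have mKH : measurable_fun setT (fun p : plane => (K p * H p.2)%:E).
  apply/measurable_EFinP; apply: measurable_funM => //.
  by apply: measurableT_comp => //; exact: measurable_snd.
rewrite (@fubini_tonelli2 _ _ _ _ R leb leb _ mKH); last by move=> p; rewrite lee_fin mulr_ge0.
apply: (@le_trans _ _ (\int[leb]_x (s%:E * (H x)%:E))%E).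
  apply: ge0_le_integral => //.
  - by move=> x _; apply: integral_ge0 => y _; rewrite lee_fin mulr_ge0.
  - by apply: measurable_fun_fubini_tonelli_G => // p; rewrite lee_fin mulr_ge0.
  - by apply/measurable_EFinP; apply: measurable_funM => //; exact: measurable_cst.
  - move=> x _; rewrite /fubini_G /=.
    under eq_integral do rewrite EFinM.
    rewrite ge0_integralZr//; last 3 first.
    + by apply/measurable_EFinP; apply: measurableT_comp => //; exact: measurable_pair2.
    + by move=> y _; rewrite lee_fin.
    + by rewrite lee_fin.
    by apply: lee_wpmul2r; [rewrite lee_fin|exact: Ks].
rewrite ge0_integralZl ?lee_fin//; last 2 first.
- exact/measurable_EFinP.
- by move=> x _; rewrite lee_fin.
by rewrite EFinM lee_wpmul2l// lee_fin.
Qed.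

Lemma int_indic_xsection S x : measurable S ->
  (\int[leb]_y (\1_S (x, y) : R)%:E = leb (xsection S x))%E.
Proof.
move=> mS; transitivity (\int[leb]_y (\1_(xsection S x) y : R)%:E)%E; last first.
  by rewrite integral_indic ?setIT//; exact: measurable_xsection.
by apply: eq_integral => y _; rewrite !indicE mem_xsection.
Qed.

Lemma int_indic_ysection S y : measurable S ->
  (\int[leb]_x (\1_S (x, y) : R)%:E = leb (ysection S y))%E.
Proof.
move=> mS; transitivity (\int[leb]_x (\1_(ysection S y) x : R)%:E)%E; last first.
  by rewrite integral_indic ?setIT//; exact: measurable_ysection.
by apply: eq_integral => x _; rewrite !indicE mem_ysection.
Qed.

Lemma indic_sqr S p : (\1_S p : R) ^+ 2 = \1_S p.
Proof. by rewrite indicE; case: (_ \in _); rewrite ?expr1n ?expr0n. Qed.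

Lemma measurable_fun_fst H : measurable_fun setT H -> measurable_fun setT (fun p : plane => H p.1).
Proof. by move=> mH; apply: measurableT_comp => //; exact: measurable_fst. Qed.

Lemma measurable_fun_snd H : measurable_fun setT H -> measurable_fun setT (fun p : plane => H p.2).
Proof. by move=> mH; apply: measurableT_comp => //; exact: measurable_snd. Qed.

Lemma measurable_sum_coord : measurable_fun setT (fun p : plane => p.1 + p.2).
Proof. by apply: measurable_funD; [exact: measurable_fst|exact: measurable_snd]. Qed.

Section ProductWeight.
Variables (F G : R -> R) (w : plane -> R) (S : set plane) (A B k r1 r2 b : R).
Hypotheses (mF : measurable_fun setT F) (mG : measurable_fun setT G)
  (mw : measurable_fun setT w) (mS : measurable S)
  (A0 : 0 <= A) (B0 : 0 <= B) (k0 : 0 <= k) (r10 : 0 <= r1) (r20 : 0 <= r2) (b0 : 0 < b)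
  (F2 : (\int[leb]_x (F x ^+ 2)%:E <= (A ^+ 2)%:E)%E)
  (G2 : (\int[leb]_x (G x ^+ 2)%:E <= (B ^+ 2)%:E)%E)
  (Sy : forall y, (leb (ysection S y) <= (r1 ^+ 2)%:E)%E)
  (Sx : forall x, (leb (xsection S x) <= (r2 ^+ 2)%:E)%E)
  (Sb : forall p, S p -> `|p.1| <= b /\ `|p.2| <= b)
  (wS : forall p, `|w p| <= k * (\1_S p * `|F p.1 * G p.2|)).

Let mI : measurable_fun setT (\1_S : plane -> R).
Proof. exact: measurable_indic. Qed.

(** Since [\1_S] is its own square, it can go with both factors of Cauchy-Schwarz: next to F it is
    integrated over the sections that fix xi, next to G over those that fix eta. *)
Let fS1 (p : plane) : R := \1_S p * F p.1.
Let fS2 (p : plane) : R := \1_S p * G p.2.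

Let mfS1 : measurable_fun setT fS1.
Proof. by apply: measurable_funM => //; exact: measurable_fun_fst. Qed.

Let mfS2 : measurable_fun setT fS2.
Proof. by apply: measurable_funM => //; exact: measurable_fun_snd. Qed.

Let int_fS1 : (\int[leb2]_p (fS1 p ^+ 2)%:E <= ((r2 * A) ^+ 2)%:E)%E.
Proof.
rewrite exprMn; under eq_integral do rewrite /fS1 exprMn indic_sqr.
apply: (@int_kernel_fst _ (fun x => F x ^+ 2)) => //.
- by apply: measurable_funX.
- by move=> x; exact: sqr_ge0.
- exact: sqr_ge0.
- by move=> x; rewrite int_indic_xsection.
Qed.

Let int_fS2 : (\int[leb2]_p (fS2 p ^+ 2)%:E <= ((r1 * B) ^+ 2)%:E)%E.
Proof.
rewrite exprMn; under eq_integral do rewrite /fS2 exprMn indic_sqr.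
apply: (@int_kernel_snd _ (fun x => G x ^+ 2)) => //.
- by apply: measurable_funX.
- by move=> x; exact: sqr_ge0.
- exact: sqr_ge0.
- by move=> x; rewrite int_indic_ysection.
Qed.

Lemma product_weight_L1 : (\int[leb2]_p `|w p|%:E <= (k * (r1 * r2 * A * B))%:E)%E.
Proof.
have -> : r1 * r2 * A * B = (r2 * A) * (r1 * B) by ring.
have CS := cauchy_schwarz (mulr_ge0 r20 A0) (mulr_ge0 r10 B0) mfS1 mfS2 int_fS1 int_fS2.
apply: (le_int_abs k0 mw (measurable_funM mfS1 mfS2) _ CS).
move=> p; apply: (le_trans (wS p)); apply: ler_wpM2l => //.
change (\1_S p * `|F p.1 * G p.2| <= `|fS1 p * fS2 p|).
have I0 : 0 <= (\1_S p : R) by rewrite indicE.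
by rewrite /fS1 /fS2 mulrACA -expr2 indic_sqr [leRHS]normrM (ger0_norm I0).
Qed.

Let trig_sqr (c d : nat -> R) (x0 h : R) (N : nat) (y : R) : h * b = pi ->
  (\int[leb]_x ((\1_(`[- b, b]%classic) x * trigc c d x0 h N (x + y)) ^+ 2)%:E <=
    (2 * b * \sum_(n < N) (c n ^+ 2 + d n ^+ 2))%:E)%E.
Proof.
move=> hb; apply: le_trans (trigc_period_l2 c d x0 y N b0 hb).
rewrite [leRHS]integral_mkcond.
rewrite le_eqVlt; apply/orP; left; apply/eqP; apply: eq_integral => x _.
by rewrite /patch indicE; case: (_ \in _); rewrite ?mul1r// mul0r expr0n.
Qed.

Let box1 (p : plane) : R := \1_(`[- b, b]%classic) p.1.
Let box2 (p : plane) : R := \1_(`[- b, b]%classic) p.2.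

Let mtrig c d x0 h N : measurable_fun setT (fun p : plane => trigc c d x0 h N (p.1 + p.2)).
Proof.
apply: measurableT_comp; first exact: continuous_measurable_fun (@continuous_trigc R _ _ _ _ _).
exact: measurable_sum_coord.
Qed.

Let mbox1 : measurable_fun setT box1.
Proof. by apply: measurable_fun_fst; apply: measurable_indic; exact: measurable_itv. Qed.

Let mbox2 : measurable_fun setT box2.
Proof. by apply: measurable_fun_snd; apply: measurable_indic; exact: measurable_itv. Qed.

Let sum_sq_ge0 (c d : nat -> R) N : 0 <= \sum_(n < N) (c n ^+ 2 + d n ^+ 2).
Proof. by apply: sumr_ge0 => n _; apply: addr_ge0; exact: sqr_ge0. Qed.

Let S_box p : S p -> box1 p = 1 /\ box2 p = 1.
Proof.
move=> /Sb [h1 h2]; rewrite /box1 /box2 !indicE !mem_setE !in_itv/= -!ler_norml h1 h2.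
by [].
Qed.

(** Here the indicator of S stays with F alone, at the cost r2 of the sections that fix xi. The
    polynomial goes with G: for fixed eta its square is integrated over xi in [[- b, b]], one
    period, so this factor pays no section measure. Exchanging the two variables gives the version
    with r1. *)
Let trig_bound1 (c d : nat -> R) (x0 h : R) (N : nat) : h * b = pi ->
  (\int[leb2]_p `|trigc c d x0 h N (p.1 + p.2) * w p|%:E <=
    (k * (r2 * A * (Num.sqrt (2 * b * \sum_(n < N) (c n ^+ 2 + d n ^+ 2)) * B)))%:E)%E.
Proof.
move=> hb; set s := 2 * b * _.
have s0 : 0 <= s by apply: mulr_ge0 (sum_sq_ge0 _ _ _); rewrite mulr_ge0// ltW.
pose g (p : plane) := box1 p * trigc c d x0 h N (p.1 + p.2) * G p.2.
have m1 := measurable_funM mbox1 (mtrig c d x0 h N).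
have mg : measurable_fun setT g := measurable_funM m1 (measurable_fun_snd mG).
have ig : (\int[leb2]_p (g p ^+ 2)%:E <= ((Num.sqrt s * B) ^+ 2)%:E)%E.
  rewrite exprMn sqr_sqrtr//; under eq_integral do rewrite /g exprMn.
  apply: (@int_kernel_snd (fun p => (box1 p * trigc c d x0 h N (p.1 + p.2)) ^+ 2) (fun x => G x ^+ 2)) => //.
  - exact: (measurable_funX 2 m1).
  - exact: measurable_funX.
  - by move=> p; exact: sqr_ge0.
  - by move=> x; exact: sqr_ge0.
  - by move=> y; exact: trig_sqr.
have CS := cauchy_schwarz (mulr_ge0 r20 A0) (mulr_ge0 (sqrtr_ge0 s) B0) mfS1 mg int_fS1 ig.
apply: (le_int_abs k0 (measurable_funM (mtrig c d x0 h N) mw) (measurable_funM mfS1 mg) _ CS).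
move=> p; rewrite normrM; apply: (le_trans (ler_wpM2l (normr_ge0 _) (wS p))).
have -> : (fS1 \* g) p = fS1 p * g p by [].
rewrite mulrCA; apply: ler_wpM2l => //; rewrite /fS1 /g indicE.
have [/set_mem/S_box [-> _]|_] := boolP (p \in S); last by rewrite !mul0r mulr0.
by rewrite !mul1r !normrM mulrCA.
Qed.

Let trig_bound2 (c d : nat -> R) (x0 h : R) (N : nat) : h * b = pi ->
  (\int[leb2]_p `|trigc c d x0 h N (p.1 + p.2) * w p|%:E <=
    (k * (r1 * B * (Num.sqrt (2 * b * \sum_(n < N) (c n ^+ 2 + d n ^+ 2)) * A)))%:E)%E.
Proof.
move=> hb; set s := 2 * b * _.
have s0 : 0 <= s by apply: mulr_ge0 (sum_sq_ge0 _ _ _); rewrite mulr_ge0// ltW.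
pose g (p : plane) := box2 p * trigc c d x0 h N (p.1 + p.2) * F p.1.
have m1 := measurable_funM mbox2 (mtrig c d x0 h N).
have mg : measurable_fun setT g := measurable_funM m1 (measurable_fun_fst mF).
have ig : (\int[leb2]_p (g p ^+ 2)%:E <= ((Num.sqrt s * A) ^+ 2)%:E)%E.
  rewrite exprMn sqr_sqrtr//; under eq_integral do rewrite /g exprMn.
  apply: (@int_kernel_fst (fun p => (box2 p * trigc c d x0 h N (p.1 + p.2)) ^+ 2) (fun x => F x ^+ 2)) => //.
  - exact: (measurable_funX 2 m1).
  - exact: measurable_funX.
  - by move=> p; exact: sqr_ge0.
  - by move=> x; exact: sqr_ge0.
  - by move=> x; under eq_integral do rewrite /box2/= [x + _]addrC; exact: trig_sqr.
have CS := cauchy_schwarz (mulr_ge0 r10 B0) (mulr_ge0 (sqrtr_ge0 s) A0) mfS2 mg int_fS2 ig.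
apply: (le_int_abs k0 (measurable_funM (mtrig c d x0 h N) mw) (measurable_funM mfS2 mg) _ CS).
move=> p; rewrite normrM; apply: (le_trans (ler_wpM2l (normr_ge0 _) (wS p))).
have -> : (fS2 \* g) p = fS2 p * g p by [].
rewrite mulrCA; apply: ler_wpM2l => //; rewrite /fS2 /g indicE.
have [/set_mem/S_box [_ ->]|_] := boolP (p \in S); last by rewrite !mul0r mulr0.
by rewrite !mul1r !normrM [`|F _| * _]mulrC mulrCA.
Qed.

Let z (p : plane) : R := p.1 + p.2.

Let w_integrable : leb2.-integrable setT (EFin \o w).
Proof. exact: integrable_of_abs mw product_weight_L1. Qed.

Let w_supp p : w p != 0 -> `|z p| <= b + b.
Proof.
move=> w0; have Sp : S p.
  apply: contrapT => Sp; move: (wS p); rewrite indicE memNset// mul0r mulr0.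
  by rewrite normr_le0 (negbTE w0).
by have [h1 h2] := Sb Sp; rewrite (le_trans (ler_normD _ _))// lerD.
Qed.

Lemma product_weight_continuous_cos : continuous (osc_cos leb2 z w).
Proof.
apply: (@lipschitz_continuous R _ ((b + b) * (k * (r1 * r2 * A * B)))).
exact: (osc_cos_lipschitz (ltW (addr_gt0 b0 b0)) measurable_sum_coord mw product_weight_L1 w_supp).
Qed.

Lemma product_weight_continuous_sin : continuous (osc_sin leb2 z w).
Proof.
apply: (@lipschitz_continuous R _ ((b + b) * (k * (r1 * r2 * A * B)))).
exact: (osc_sin_lipschitz (ltW (addr_gt0 b0 b0)) measurable_sum_coord mw product_weight_L1 w_supp).
Qed.

Lemma product_weight_measurable_amp : measurable_fun setT (osc_amp leb2 z w).
Proof.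
apply: measurable_funD; apply: measurableT_comp => //; apply: continuous_measurable_fun.
  exact: product_weight_continuous_cos.
exact: product_weight_continuous_sin.
Qed.

Lemma product_weight_amp_sup x : osc_amp leb2 z w x <= 2 * (k * (r1 * r2 * A * B)).
Proof.
have mz : measurable_fun setT z := measurable_sum_coord.
by rewrite mulr_natl mulr2n lerD// ?osc_cos_le ?osc_sin_le//; exact: product_weight_L1.
Qed.

(** [bessel] bounds the squared samples over every progression of step pi/b, and
    [ge0_integral_periodized] integrates over the base points. Either [r] is available, according to
    which factor of Cauchy-Schwarz carries the indicator of S. *)
Lemma product_weight_amp_L2 r : r = r1 \/ r = r2 ->
  (\int[leb]_x (osc_amp leb2 z w x ^+ 2)%:E <= ((4 * (k * (r * A * B))) ^+ 2)%:E)%E.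
Proof.
move=> rE; have mz : measurable_fun setT z := measurable_sum_coord.
have r0 : 0 <= r by case: rE => ->.
pose h := pi / b; have hb : h * b = pi by rewrite /h divfK// gt_eqF.
have h0 : 0 < h by rewrite divr_gt0// pi_gt0.
pose C := k * (r * A * B) * Num.sqrt (2 * b).
have C0 : 0 <= C by rewrite /C !mulr_ge0// sqrtr_ge0.
have bes x0 N : \sum_(n < N) (osc_cos leb2 z w (x0 + n%:R * h) ^+ 2 +
    osc_sin leb2 z w (x0 + n%:R * h) ^+ 2) <= C ^+ 2.
  apply: (bessel C0 mz w_integrable) => c d.
  have -> : C * Num.sqrt (\sum_(n < N) (c n ^+ 2 + d n ^+ 2)) =
     k * (r * A * B) * Num.sqrt (2 * b * \sum_(n < N) (c n ^+ 2 + d n ^+ 2)).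
    by rewrite /C -mulrA [in RHS]sqrtrM// mulr_ge0// ltW.
  case: rE => ->.
    have -> : k * (r1 * A * B) * Num.sqrt (2 * b * \sum_(n < N) (c n ^+ 2 + d n ^+ 2)) =
       k * (r1 * B * (Num.sqrt (2 * b * \sum_(n < N) (c n ^+ 2 + d n ^+ 2)) * A)) by ring.
    exact: trig_bound2.
  have -> : k * (r2 * A * B) * Num.sqrt (2 * b * \sum_(n < N) (c n ^+ 2 + d n ^+ 2)) =
       k * (r2 * A * (Num.sqrt (2 * b * \sum_(n < N) (c n ^+ 2 + d n ^+ 2)) * B)) by ring.
  exact: trig_bound1.
have mc := continuous_measurable_fun product_weight_continuous_cos.
have ms := continuous_measurable_fun product_weight_continuous_sin.
have P := @ge0_integral_periodized R (fun x => osc_cos leb2 z w x ^+ 2 + osc_sin leb2 z w x ^+ 2) h (C ^+ 2) h0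
  (measurable_funD (measurable_funX 2 mc) (measurable_funX 2 ms))
  (fun x => addr_ge0 (sqr_ge0 _) (sqr_ge0 _)) bes.
apply: (@le_trans _ _ (\int[leb]_x (2%:E * (osc_cos leb2 z w x ^+ 2 + osc_sin leb2 z w x ^+ 2)%:E))%E).
  apply: ge0_le_integral => //.
  - by move=> x _; rewrite lee_fin sqr_ge0.
  - by apply/measurable_EFinP; apply: measurable_funX; exact: product_weight_measurable_amp.
  - apply/measurable_EFinP; apply: measurable_funM; first exact: measurable_cst.
    by apply: measurable_funD; exact: measurable_funX.
  - move=> x _; rewrite -EFinM lee_fin /osc_amp.
    rewrite -(real_normK (num_real (osc_cos leb2 z w x))) -(real_normK (num_real (osc_sin leb2 z w x))).
    by move: `|_| `|_| => u v; have := sqr_ge0 (u - v); nra.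
rewrite ge0_integralZl//; last 2 first.
- by apply/measurable_EFinP; apply: measurable_funD; exact: measurable_funX.
- by move=> x _; rewrite lee_fin addr_ge0// sqr_ge0.
apply: (@le_trans _ _ (2%:E * (h * C ^+ 2)%:E)%E); first by rewrite lee_wpmul2l.
rewrite -EFinM lee_fin /C exprMn sqr_sqrtr; last by rewrite mulr_ge0// ltW.
(* The factors b cancel through h = pi/b, so the size of the support disappears. The constant 4 of
   the statement comes from 4 pi <= 16. *)
have -> : 2 * (h * ((k * (r * A * B)) ^+ 2 * (2 * b))) = 4 * pi * (k * (r * A * B)) ^+ 2.
  by rewrite -hb; ring.
rewrite [leRHS]exprMn ler_wpM2r ?sqr_ge0//.
have : pi <= 4 :> R.
  by have := pihalf_lt2 R; rewrite ltr_pdivrMr// => /ltW H; apply: (le_trans H); lra.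
by move=> H; nra.
Qed.

End ProductWeight.
End PlaneKernels.

(** * Interpolation between L^2 and the sup norm *)

Section Interpolation.
Context d (T : measurableType d) (R : realType) (mu : {measure set T -> \bar R}).

(** For finite q, |g|^q <= X^(q-2) g^2. For q infinite [qinv] is 0 and the right side reduces to X,
    a zeroth power being 1 even when Y = 0. *)
Lemma Lnorm_interpolate (g : T -> R) (q : \bar R) (X Y : R) : (2%:E <= q)%E ->
  measurable_fun setT g -> 0 <= X -> 0 <= Y ->
  (forall x, `|g x| <= X) -> (\int[mu]_x (g x ^+ 2)%:E <= (Y ^+ 2)%:E)%E ->
  (Lnorm mu q (EFin \o g) <= (X `^ (1 - 2 * qinv q) * Y `^ (2 * qinv q))%:E)%E.
Proof.
move=> q2 mg X0 Y0 gX gY; case: q q2 => [q|_|//].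
  rewrite lee_fin /= => q2.
  have q0 : 0 < q by lra.
  apply: Lnorm_EFin_le => //; first by rewrite mulr_ge0// powR_ge0.
  have -> : (X `^ (1 - 2 * q^-1) * Y `^ (2 * q^-1)) `^ q = X `^ (q - 2) * Y ^+ 2.
    have qn0 : q != 0 by rewrite gt_eqF.
    rewrite powRM ?powR_ge0// -!powRrM.
    have -> : (1 - 2 / q) * q = q - 2 by field.
    have -> : 2 / q * q = 2 by field.
    by rewrite powR_mulrn.
  apply: (@le_trans _ _ (\int[mu]_x ((X `^ (q - 2))%:E * (g x ^+ 2)%:E))%E).
    apply: ge0_le_integral => //.
    - by apply/measurable_EFinP; apply: measurableT_comp (measurable_powR _) _; apply: measurableT_comp.
    - apply/measurable_EFinP; apply: measurable_funM; first exact: measurable_cst.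
      exact: measurable_funX.
    - move=> x _; rewrite -EFinM lee_fin.
      have -> : `|g x| `^ q = `|g x| `^ (q - 2) * g x ^+ 2.
        rewrite -(real_normK (num_real (g x))) -powR_mulrn// -powRD ?subrK//.
        by apply/implyP => /eqP h; rewrite h in q0; rewrite ltxx in q0.
      apply: ler_wpM2r; first exact: sqr_ge0.
      by apply: ge0_ler_powR; rewrite ?nnegrE// subr_ge0.
  rewrite ge0_integralZl//; last 3 first.
  - by apply/measurable_EFinP; exact: measurable_funX.
  - by move=> x _; rewrite lee_fin sqr_ge0.
  - by rewrite lee_fin powR_ge0.
  by rewrite EFinM lee_wpmul2l// lee_fin powR_ge0.
rewrite /= mulr0 subr0 powRr1// powRr0 mulr1 unlock.
case: ifPn => // _.
by apply/ess_supP; apply: nearW => x; rewrite /= lee_fin.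
Qed.

End Interpolation.

(** * Sublevel sets *)

Section PlaneMeasurability.
Context (R : realType).
Notation plane := (measurableTypeR R * measurableTypeR R)%type.

(** The sigma-algebra of [plane] is the product one, while open sets refer to the topology of
    [R * R]. Boxes with rational centres and radii 1/(n+1) form a countable basis; those not
    contained in U are replaced by the empty set, so that the union runs over all indices. *)
Lemma open_measurable_plane (U : set (R * R)) : open U -> measurable (U : set plane).
Proof.
move=> oU.
pose delta (n : nat) : R := n.+1%:R^-1.
pose box (a b : rat) (n : nat) : set plane :=
  ball (ratr a : R) (delta n) `*` ball (ratr b : R) (delta n).
have mbox a b n : measurable (box a b n) by apply: measurableX; exact: measurable_ball.
pose V a b n : set plane := if `[< box a b n `<=` U >] then box a b n else set0.
have key (x y : R) : U (x, y) -> (\bigcup_a \bigcup_b \bigcup_n V a b n) (x, y).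
  move=> Uxy.
  have [e /= e0 eU] : exists2 e : R, 0 < e & ball (x, y) e `<=` U.
    by have /nbhs_ballP[e e0 eU] := open_nbhs_nbhs (conj oU Uxy); exists e.
  have [n ne] : exists n, delta n < e / 2.
    have [n hn] := @ltr_add_invr R 0 (e / 2) ltac:(by rewrite divr_gt0).
    by exists n; move: hn; rewrite add0r.
  have n0 : 0 < delta n by rewrite invr_gt0.
  have lt_pm (u : R) : u - delta n < u + delta n by lra.
  have [a] := rat_in_itvoo (lt_pm x).
  have [b] := rat_in_itvoo (lt_pm y).
  rewrite !in_itv/= => /andP[b1 b2] /andP[a1 a2].
  exists a => //; exists b => //; exists n => //.
  have inb : box a b n (x, y).
    by split; rewrite /ball/= ltr_norml; apply/andP; split; lra.
  rewrite /V; case: asboolP => // -[] [u v] [/= hu hv]; apply: eU.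
  move: hu hv; rewrite /ball/= !ltr_norml => /andP[u1 u2] /andP[v1 v2].
  by split; rewrite /ball/= ltr_norml; apply/andP; split; lra.
have -> : (U : set plane) = \bigcup_a \bigcup_b \bigcup_n V a b n.
  apply/seteqP; split => [[x y]|p [a _ [b _ [n _]]]]; first exact: key.
  by rewrite /V; case: asboolP => // sub; exact: sub.
have mV a b n : measurable (V a b n).
  by rewrite /V; case: asboolP => _ //; exact: measurable0.
apply: bigcupT_measurable_rat => a; apply: bigcupT_measurable_rat => b.
by apply: bigcupT_measurable => n.
Qed.

Lemma continuous_measurable_plane (f : R * R -> R) : continuous f ->
  measurable_fun (setT : set plane) (f : plane -> R).
Proof.
move=> /continuousP cf; apply: (measurability _ (RGenOInfty.measurableE R)).
move=> _ [_ [x ->] <-]; rewrite setTI; apply: open_measurable_plane.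
by apply: cf; exact: interval_open.
Qed.

End PlaneMeasurability.

(** Induction principle for compact sets: the sets A for which P holds on K minus A form a filter
    containing K, proper if P K fails. A cluster point of it in K has a neighbourhood U with P U, so
    the complement of U belongs to the filter, which is absurd. *)
Lemma compact_local_property (T : topologicalType) (K : set T) (P : set T -> Prop) :
  compact K -> P set0 -> (forall A B, A `<=` B -> P B -> P A) ->
  (forall A B, P A -> P B -> P (A `|` B)) ->
  (forall p, K p -> exists2 U, nbhs p U & P U) -> P K.
Proof.
move=> cK P0 Pmono PU Ploc; apply: contrapT => nPK.
pose F : set_system T := [set A | P (K `\` A)].
have FF : ProperFilter F.
  split; first by rewrite /F /= setD0.
  split; rewrite /F /=.
  - by rewrite setDT.
  - by move=> A B /= PA PB; rewrite setDIr; exact: PU.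
  - by move=> A B AB; apply: Pmono; exact: setDS.
have FK : F K by rewrite /F /= setDv.
have [p [Kp clp]] := cK F FF FK.
have [U Up PUU] := Ploc p Kp.
have FU : F (~` U) by apply: Pmono PUU => x [_ /contrapT].
by have [x []] := clp _ _ FU Up.
Qed.

Section Sublevel.
Context (R : realType).
Notation leb := (@lebesgue_measure R).
Implicit Types (A : set (measurableTypeR R)) (h : R -> R).

Lemma leb_le_closed_ball A (x e : R) : measurable A -> 0 <= e ->
  (forall y : R, A y -> `|y - x| <= e) -> (leb A <= (2 * e)%:E)%E.
Proof.
move=> mA e0 H; apply: (@le_trans _ _ (leb `[(x - e)%R, (x + e)%R]%classic)).
  apply: le_measure; rewrite ?inE//.
  by move=> y /H; rewrite ler_distl /= in_itv.
rewrite lebesgue_measure_itv/= lte_fin; case: ifPn => _; last by rewrite lee_fin mulr_ge0.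
by rewrite -EFinB lee_fin; lra.
Qed.

Lemma leb_le_diam A (e : R) : measurable A -> 0 <= e ->
  (forall x y : R, A x -> A y -> `|x - y| <= e) -> (leb A <= (2 * e)%:E)%E.
Proof.
move=> mA e0 H; have [->|/set0P[x Ax]] := eqVneq A set0; first by rewrite measure0 lee_fin mulr_ge0.
by apply: (@leb_le_closed_ball _ x) => // y Ay; exact: H.
Qed.

(* For a convex function the sublevel set [|h| <= lam] need not be short, but of three of its
   points two consecutive ones are close. *)
Lemma leb_le_two_clusters A (e : R) : measurable A -> 0 <= e ->
  (forall x y z : R, A x -> A y -> A z -> e < y - x -> z - y <= e) ->
  (leb A <= (4 * e)%:E)%E.
Proof.
move=> mA e0 H.
have K (x y z : R) : A x -> A y -> A z -> e < y - x -> e < z - y -> False.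
  by move=> Ax Ay Az xy; rewrite ltNge (H x y z).
have [->|/set0P[x Ax]] := eqVneq A set0; first by rewrite measure0 lee_fin mulr_ge0.
have [[y [Ay xy]]|ny] := pselect (exists y : R, A y /\ e < `|y - x|); last first.
  apply: (@le_trans _ _ (2 * e)%:E); last by rewrite lee_fin; lra.
  apply: (@leb_le_closed_ball _ x) => // y Ay.
  by rewrite leNgt; apply/negP => xy; apply: ny; exists y.
have mI (u : R) : measurable (A `&` `[(u - e), (u + e)]%classic).
  by apply: measurableI => //; exact: measurable_itv.
have bI (u : R) : (leb (A `&` `[(u - e)%R, (u + e)%R]%classic) <= (2 * e)%:E)%E.
  by apply: (@leb_le_closed_ball _ u) => // v [_ /=]; rewrite in_itv/= ler_distl.
have sub : A `<=` (A `&` `[(x - e), (x + e)]%classic) `|` (A `&` `[(y - e), (y + e)]%classic).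
  move=> z Az; apply: contrapT => /not_orP[/not_andP[//|]] + /not_andP[//|].
  rewrite /= !in_itv/= -!ler_distl => /negP; rewrite -ltNge ltr_normr => zx /negP.
  rewrite -ltNge ltr_normr => zy; move: xy; rewrite ltr_normr.
  (* All three mutual distances exceed e; whatever the order of x, y, z on the line, the sorted
     triple contradicts [K]. *)
  case/orP: zx => h1; case/orP: zy => h2; case/orP => h3;
    first [by apply: (K x y z) => //; lra | by apply: (K x z y) => //; lra
          |by apply: (K z x y) => //; lra | by apply: (K y z x) => //; lra
          |by apply: (K z y x) => //; lra | by apply: (K y x z) => //; lra].
apply: (le_trans (le_measure leb _ _ sub)); rewrite ?inE//; first exact: measurableU.
apply: (le_trans (measureU2 _ _ _)) => //.
have -> : 4 * e = 2 * e + 2 * e by ring.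
by rewrite EFinD; apply: leeD; exact: bI.
Qed.

Lemma MVT_derive h (h1 : R -> R) (x y : R) : (forall u : R, is_derive u 1 h (h1 u)) -> x <= y ->
  exists2 u, x <= u <= y & h y - h x = h1 u * (y - x).
Proof.
move=> dh xy.
have ch : continuous h.
  by move=> z; have [dz _] := dh z; exact: differentiable_continuous (iffLR (derivable1_diffP h z) dz).
have [u + E] := @MVT_segment R h h1 x y xy (fun z _ => dh z) (continuous_subspaceT ch).
by rewrite in_itv/= => uxy; exists u.
Qed.

(** Mean value theorem between two points of A: h varies by at most 2 lam, so they are at distance
    at most 2 lam / c. The ball is convex, so the intermediate point stays where the derivative is
    bounded below. *)
Lemma sublevel_first_derivative A h (h1 : R -> R) (x0 r c lam : R) : measurable A ->
  0 < c -> 0 <= lam -> (forall u : R, is_derive u 1 h (h1 u)) ->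
  (forall u, ball x0 r u -> c <= `|h1 u|) ->
  (forall u, A u -> ball x0 r u /\ `|h u| <= lam) ->
  (leb A <= (4 / c * lam)%:E)%E.
Proof.
move=> mA c0 l0 dh hc hA.
have -> : 4 / c * lam = 2 * (2 * lam / c) by ring.
apply: leb_le_diam => //; first by rewrite divr_ge0 ?mulr_ge0// ltW.
move=> x y; wlog xy : x y / x <= y.
  by move=> H Ax Ay; have [xy|/ltW yx] := leP x y; [|rewrite distrC]; apply: H.
move=> /hA[bx lx] /hA[b_y ly].
have [u /andP[xu uy] E] := MVT_derive dh xy.
have bu : ball x0 r u.
  by move: bx b_y; rewrite /ball/= !ltr_norml => /andP[? ?] /andP[? ?]; apply/andP; split; lra.
rewrite distrC ler_pdivlMr// mulrC.
apply: (@le_trans _ _ `|h y - h x|); last first.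
  by rewrite (le_trans (ler_normB _ _))//; lra.
by rewrite E normrM ler_wpM2r// hc.
Qed.

(** After subtraction of the parabola (c/2) u^2, h is still convex on the ball, so its slopes
    increase. For x < y < z in A with gaps X and Z this gives (c/2)(X + Z) X Z <= (h z - h y) X - (h
    y - h x) Z <= 2 lam (X + Z), that is X Z <= 4 lam / c. Hence the two gaps cannot both exceed e =
    2 sqrt(lam / c). *)
Lemma sublevel_convex A h (h1 h2 : R -> R) (x0 r c lam : R) : measurable A ->
  0 < c -> 0 <= lam -> (forall u : R, is_derive u 1 h (h1 u)) ->
  (forall u : R, is_derive u 1 h1 (h2 u)) ->
  (forall u, ball x0 r u -> c <= h2 u) ->
  (forall u, A u -> ball x0 r u /\ `|h u| <= lam) ->
  (leb A <= (8 * Num.sqrt (lam / c))%:E)%E.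
Proof.
move=> mA c0 l0 dh dh1 hc hA.
pose e : R := 2 * Num.sqrt (lam / c).
have -> : 8 * Num.sqrt (lam / c) = 4 * e by rewrite /e; ring.
have e0 : 0 <= e by rewrite mulr_ge0// sqrtr_ge0.
have e2 : c * e ^+ 2 = 4 * lam.
  by rewrite /e exprMn sqr_sqrtr ?divr_ge0// 1?ltW//; field; rewrite gt_eqF.
apply: leb_le_two_clusters => // x y z /hA[bx lx] /hA[b_y ly] /hA[bz lz] xy.
rewrite leNgt; apply/negP => yz.
pose g u := h u - c / 2 * (u * u); pose g1 u := h1 u - c * u.
have dg (u : R) : is_derive u 1 g (g1 u).
  have H : is_derive u 1 g _ := is_deriveB (dh u) (is_deriveZ (c / 2)
    (is_deriveM (is_derive_id u (1 : R)) (is_derive_id u (1 : R)))).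
  by apply: (is_derive_eq H); rewrite /g1 /GRing.scale/=; field.
have dg1 (u : R) : is_derive u 1 g1 (h2 u - c).
  have H : is_derive u 1 g1 _ := is_deriveB (dh1 u) (is_deriveZ c (is_derive_id u (1 : R))).
  by apply: (is_derive_eq H); rewrite /GRing.scale/= mulr1.
have [v /andP[xv vy] Ev] := MVT_derive dg (ltac:(lra) : x <= y).
have [u /andP[yu uz] Eu] := MVT_derive dg (ltac:(lra) : y <= z).
have [t /andP[vt tu] Et] := MVT_derive dg1 (le_trans vy yu).
have bt : ball x0 r t.
  by move: bx bz; rewrite /ball/= !ltr_norml => /andP[? ?] /andP[? ?]; apply/andP; split; lra.
have g1uv : 0 <= g1 u - g1 v.
  by rewrite Et mulr_ge0// subr_ge0 ?hc//; lra.
move: Ev Eu; rewrite /g.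
move: lx ly lz; rewrite !ler_norml => /andP[? ?] /andP[? ?] /andP[? ?].
set X := y - x in xy *; set Z := z - y in yz *.
move: (g1 u) (g1 v) g1uv => G1 G2 G12 E2 E1.
have X0 : 0 < X by apply: le_lt_trans xy.
have Z0 : 0 < Z by apply: le_lt_trans yz.
have K1 : c / 2 * (X + Z) * (X * Z) <= (h z - h y) * X - (h y - h x) * Z.
  have -> : (h z - h y) * X - (h y - h x) * Z =
     (h z - c / 2 * (z * z) - (h y - c / 2 * (y * y))) * X
     - (h y - c / 2 * (y * y) - (h x - c / 2 * (x * x))) * Z + c / 2 * (X + Z) * (X * Z).
    by rewrite /X /Z; ring.
  rewrite E1 E2 lerDr.
  have -> : G1 * Z * X - G2 * X * Z = (G1 - G2) * (X * Z) by ring.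
  by rewrite mulr_ge0// mulr_ge0// ltW.
have K2 : (h z - h y) * X - (h y - h x) * Z <= 2 * lam * (X + Z).
  have k1 : (h z - h y) * X <= 2 * lam * X by rewrite ler_wpM2r ?(ltW X0)//; lra.
  have k2 : - (h y - h x) * Z <= 2 * lam * Z by rewrite ler_wpM2r ?(ltW Z0)//; lra.
  by rewrite [2 * lam * _]mulrDr -mulNr; exact: lerD.
have K3 : e ^+ 2 < X * Z.
  by rewrite expr2; apply: ltr_pM.
have : (X + Z) * (c * (X * Z)) <= (X + Z) * (4 * lam) by lra.
have XZ : 0 < X + Z by rewrite addr_gt0.
rewrite (ler_pM2l XZ) leNgt => /negP; apply.
by apply: (@le_lt_trans _ _ (c * e ^+ 2)); [rewrite e2|rewrite ltr_pM2l].
Qed.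

Lemma sublevel_second_derivative A h (h1 h2 : R -> R) (x0 r c lam : R) : measurable A ->
  0 < c -> 0 <= lam -> (forall u : R, is_derive u 1 h (h1 u)) ->
  (forall u : R, is_derive u 1 h1 (h2 u)) ->
  (forall u, ball x0 r u -> c <= h2 u) \/ (forall u, ball x0 r u -> h2 u <= - c) ->
  (forall u, A u -> ball x0 r u /\ `|h u| <= lam) ->
  (leb A <= (8 * Num.sqrt (lam / c))%:E)%E.
Proof.
move=> mA c0 l0 dh dh1 [hc|hc] hA; first exact: (sublevel_convex mA c0 l0 dh dh1 hc hA).
apply: (@sublevel_convex A (- h) (- h1) (- h2) x0 r c lam) => //.
- by move=> u /hc; rewrite lerNr.
- by move=> u /hA[bu lu]; rewrite /= normrN.
Qed.

End Sublevel.

(** * Sections of the level sets of the phase *)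

Section PhaseCalculus.
Context (R : realType).

Lemma smooth_derivatives (f : R -> R) : smooth f -> exists f1 f2 : R -> R,
  [/\ forall x : R, is_derive x 1 f (f1 x), forall x : R, is_derive x 1 f1 (f2 x),
      continuous f1 & continuous f2].
Proof.
move=> sf; exists (fun x => derive f x 1), (fun x => derive (fun x => derive f x 1) x 1).
have [_ d0] := sf [::]; have [c1 d1] := sf [:: 1]; have [c2 _] := sf [:: 1; 1].
by split=> // x; apply: derivableP.
Qed.

Lemma is_derive_comp_affine (f f1 : R -> R) (u v s : R) :
  (forall x : R, is_derive x 1 f (f1 x)) ->
  is_derive s 1 (fun s : R => f (u + s * v)) (f1 (u + s * v) * v).
Proof.
move=> df; have h : is_derive s 1 (fun s : R => u + s * v) v.
  have H : is_derive s 1 (fun s : R => u + s * v) _ :=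
    is_deriveD (is_derive_cst u s (1 : R)) (is_deriveM (is_derive_id s (1 : R)) (is_derive_cst v s (1 : R))).
  by apply: (is_derive_eq H); rewrite /GRing.scale/=; ring.
exact: (@is_derive1_comp R f _ s _ _ (df _) h).
Qed.

(** The two difference quotients are the same function, so directional derivatives in the plane
    reduce to one-variable calculus, without Frechet differentiability. *)
Lemma derive_line (f : R * R -> R) (p v : R * R) :
  derive f p v = derive (fun s : R => f (p.1 + s * v.1, p.2 + s * v.2)) 0 1.
Proof.
rewrite /derive; set g1 := (X in lim (X @ _)); set g2 := (X in _ = lim (X @ _)).
suff -> : g1 = g2 by []. apply/funext => h; rewrite /g1 /g2 /=.
rewrite [h%:A]/GRing.scale/= mulr1 !mul0r !addr0.
by rewrite {g1 g2}; case: p v => [x y] [v1 v2] /=; rewrite [x + _]addrC [y + _]addrC.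
Qed.

Lemma derive_phase (a b c a1 b1 c1 : R -> R) (p v : R * R) :
  (forall x : R, is_derive x 1 a (a1 x)) -> (forall x : R, is_derive x 1 b (b1 x)) ->
  (forall x : R, is_derive x 1 c (c1 x)) ->
  derive (phase a b c) p v = - a1 (p.1 + p.2) * (v.1 + v.2) + b1 p.1 * v.1 + c1 p.2 * v.2.
Proof.
move=> da db dc; rewrite derive_line; apply: derive_val.
have -> : (fun s : R => phase a b c (p.1 + s * v.1, p.2 + s * v.2)) =
   (fun s : R => - a (p.1 + p.2 + s * (v.1 + v.2)) + b (p.1 + s * v.1) + c (p.2 + s * v.2)).
  by apply/funext => s; rewrite /phase/=; congr (- a _ + _ + _); ring.
have H : is_derive (0 : R) 1 (fun s : R => - a (p.1 + p.2 + s * (v.1 + v.2)) + b (p.1 + s * v.1) + c (p.2 + s * v.2)) _ :=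
  is_deriveD (is_deriveD (is_deriveN (is_derive_comp_affine (p.1 + p.2) (v.1 + v.2) 0 da))
  (is_derive_comp_affine p.1 v.1 0 db)) (is_derive_comp_affine p.2 v.2 0 dc).
by apply: (is_derive_eq H); rewrite !mul0r !addr0 mulNr.
Qed.

(** A directional derivative of a phase is again a phase, built from rescaled first derivatives, so
    the formula for one derivative can be applied a second time. *)
Lemma dphiE (a b c a1 b1 c1 : R -> R) (v : R * R) :
  (forall x : R, is_derive x 1 a (a1 x)) -> (forall x : R, is_derive x 1 b (b1 x)) ->
  (forall x : R, is_derive x 1 c (c1 x)) ->
  dphi a b c v = phase (fun x => a1 x * (v.1 + v.2)) (fun x => b1 x * v.1) (fun x => c1 x * v.2).
Proof.
move=> da db dc; apply/funext => p; rewrite /dphi (derive_phase p v da db dc) /phase.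
by rewrite mulNr.
Qed.

Lemma is_derive_mulr (f : R -> R) (x f1 k : R) : is_derive x 1 f f1 ->
  is_derive x 1 (fun x => f x * k) (f1 * k).
Proof.
move=> df; have H : is_derive x 1 (fun x => f x * k) _ := is_deriveM df (is_derive_cst k x (1 : R)).
by apply: (is_derive_eq H); rewrite /GRing.scale/=; ring.
Qed.

Lemma d2phiE (a b c a1 b1 c1 a2 b2 c2 : R -> R) (v w p : R * R) :
  (forall x : R, is_derive x 1 a (a1 x)) -> (forall x : R, is_derive x 1 b (b1 x)) ->
  (forall x : R, is_derive x 1 c (c1 x)) ->
  (forall x : R, is_derive x 1 a1 (a2 x)) -> (forall x : R, is_derive x 1 b1 (b2 x)) ->
  (forall x : R, is_derive x 1 c1 (c2 x)) ->
  d2phi a b c v w p = - a2 (p.1 + p.2) * (w.1 + w.2) * (v.1 + v.2)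
    + b2 p.1 * w.1 * v.1 + c2 p.2 * w.2 * v.2.
Proof.
move=> da db dc da1 db1 dc1; rewrite /d2phi (dphiE w da db dc).
have Ha (x : R) := is_derive_mulr (w.1 + w.2) (da1 x).
have Hb (x : R) := is_derive_mulr w.1 (db1 x).
have Hc (x : R) := is_derive_mulr w.2 (dc1 x).
by rewrite (derive_phase p v Ha Hb Hc); ring.
Qed.

Lemma is_derive_phase_fst (a b c a1 b1 : R -> R) (x y : R) :
  (forall x : R, is_derive x 1 a (a1 x)) -> (forall x : R, is_derive x 1 b (b1 x)) ->
  is_derive x 1 (fun x : R => phase a b c (x, y)) (- a1 (x + y) + b1 x).
Proof.
move=> da db.
have ha := is_derive_comp_affine y 1 x da.
have H : is_derive x 1 (fun x : R => - a (y + x * 1) + b x + c y) _ :=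
  is_deriveD (is_deriveD (is_deriveN ha) (db x)) (is_derive_cst (c y) x (1 : R)).
have -> : (fun x : R => phase a b c (x, y)) = (fun x : R => - a (y + x * 1) + b x + c y).
  by apply/funext => u; rewrite /phase/= mulr1 [y + u]addrC.
by apply: (is_derive_eq H); rewrite !mulr1 addr0 [y + x]addrC.
Qed.

Lemma is_derive_coord (gam : R -> R * R) (s : R) : derivable gam s 1 ->
  is_derive s 1 (fun s => (gam s).1) (derive gam s 1).1 /\
  is_derive s 1 (fun s => (gam s).2) (derive gam s 1).2.
Proof.
move=> dg.
have cv : (fun h : R => h^-1 *: ((gam \o shift s) (h *: 1) - gam s)) @ 0^' --> derive gam s 1 by exact: dg.
have cv1 : (fun h : R => h^-1 *: (((fun s => (gam s).1) \o shift s) (h *: 1) - (gam s).1)) @ 0^'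
    --> (derive gam s 1).1.
  exact: (cvg_comp _ _ cv (@cvg_fst _ _ _ _ _)).
have cv2 : (fun h : R => h^-1 *: (((fun s => (gam s).2) \o shift s) (h *: 1) - (gam s).2)) @ 0^'
    --> (derive gam s 1).2.
  exact: (cvg_comp _ _ cv (@cvg_snd _ _ _ _ _)).
split; apply: DeriveDef; [by apply/cvg_ex; eexists; exact: cv1|exact: (cvg_lim _ cv1)
  |by apply/cvg_ex; eexists; exact: cv2|exact: (cvg_lim _ cv2)].
Qed.

(** At the end points 0 and 1 the function is known to vanish on one side only. The two-sided
    derivative exists by hypothesis, so it can be computed along increments that point into the
    interval. *)
Lemma derive_zero_on_itv (h : R -> R) (s l : R) : is_derive s 1 h l ->
  (forall x, 0 <= x <= 1 -> h x = 0) -> 0 <= s <= 1 -> l = 0.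
Proof.
move=> [dh <-] h0 /andP[s0 s1]; apply/eqP/negPn/negP => l0.
have cv : (fun e : R => e^-1 *: ((h \o shift s) (e *: 1) - h s)) @ 0^' --> derive h s 1 by exact: dh.
have lp : 0 < `|derive h s 1| by rewrite normr_gt0.
have [d d0 H] : exists2 d : R, 0 < d & forall t : R, ball (0 : R) d t -> t != 0 ->
    `|derive h s 1 - t^-1 *: (h (t *: 1 + s) - h s)| < `|derive h s 1|.
  have /cvgrPdist_lt/(_ _ lp) H0 := cv.
  by have /nbhs_ballP[d d0 H] := H0; exists d.
pose e0 := Num.min (d / 2) 2^-1.
have e00 : 0 < e0 by rewrite lt_min divr_gt0//= invr_gt0.
have e0d : e0 < d by rewrite gt_min; apply/orP; left; lra.
have e0h : e0 <= 2^-1 by rewrite ge_min lexx orbT.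
(* An increment of size at most 1/2 towards the farther end of [[0, 1]] stays inside. There the
   difference quotient is 0, hence no closer to the derivative than its absolute value. *)
have [e [en ed es]] : exists e : R, [/\ e != 0, `|e| < d & 0 <= e + s <= 1].
  have [sh|sh] := leP s 2^-1.
    exists e0; split; [by rewrite gt_eqF|by rewrite gtr0_norm|].
    by apply/andP; split; lra.
  exists (- e0); split; [by rewrite oppr_eq0 gt_eqF|by rewrite normrN gtr0_norm|].
  by apply/andP; split; lra.
have := H e; rewrite /ball/= sub0r normrN => /(_ ed en).
have -> : e *: (1 : R) = e by rewrite /GRing.scale/= mulr1.
by rewrite (h0 (e + s))// (h0 s) ?s0// subrr scaler0 subr0 ltxx.
Qed.

End PhaseCalculus.

Section SectionBounds.
Context (R : realType).
Notation leb := (@lebesgue_measure R).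
Notation plane := (measurableTypeR R * measurableTypeR R)%type.
Implicit Types (phi : plane -> R) (E : set plane).

Definition sublevel phi E (lam : R) : set plane := E `&` [set p | `|phi p| <= lam].

(* [ysection E y] fixes the second coordinate, so [ysec_bound] is governed by the derivatives of
   [phi] in the first one. *)
Definition ysec_bound phi E (sigma : R) := exists2 C : R, 0 <= C &
  forall lam : R, 0 < lam -> lam <= 1 ->
  forall y, (leb (ysection (sublevel phi E lam) y) <= (C * lam `^ sigma)%:E)%E.

(** Encoded by exchanging coordinates, so that every statement on sections with fixed second
    coordinate carries over. *)
Definition xsec_bound phi E (sigma : R) := ysec_bound (phi \o swap) (swap @^-1` E) sigma.

Lemma measurable_sublevel phi E lam : measurable_fun setT phi -> measurable E ->
  measurable (sublevel phi E lam).
Proof.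
move=> mphi mE; apply: measurableI => //.
have mn : measurable_fun setT (fun p => `|phi p|) by exact: measurableT_comp.
have := mn measurableT _ (measurable_itv `]-oo, lam]); rewrite setTI.
by congr (measurable _); apply/seteqP; split => p /=; rewrite in_itv.
Qed.

Lemma ysec_bound_sub phi E E' sigma : measurable_fun setT phi -> measurable E -> measurable E' ->
  E `<=` E' -> ysec_bound phi E' sigma -> ysec_bound phi E sigma.
Proof.
move=> mphi mE mE' EE' [C C0 H]; exists C => // lam l0 l1 y.
apply: le_trans (H lam l0 l1 y); apply: le_measure; rewrite ?inE.
- by apply: measurable_ysection; exact: measurable_sublevel.
- by apply: measurable_ysection; exact: measurable_sublevel.
- by move=> x; rewrite !ysectionE /= => -[/EE'].
Qed.

Lemma ysec_boundU phi E E' sigma : measurable_fun setT phi -> measurable E -> measurable E' ->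
  ysec_bound phi E sigma -> ysec_bound phi E' sigma -> ysec_bound phi (E `|` E') sigma.
Proof.
move=> mphi mE mE' [C C0 H] [C' C'0 H']; exists (C + C'); first exact: addr_ge0.
move=> lam l0 l1 y.
have mS F : measurable F -> measurable (ysection (sublevel phi F lam) y).
  by move=> mF; apply: measurable_ysection; exact: measurable_sublevel.
apply: (@le_trans _ _ (leb (ysection (sublevel phi E lam) y `|` ysection (sublevel phi E' lam) y))).
  apply: le_measure; rewrite ?inE.
  - by apply: mS; exact: measurableU.
  - by apply: measurableU; exact: mS.
  - by move=> x; rewrite /setU !ysectionE /= => -[[|] ? ?]; [left|right].
apply: (le_trans (measureU2 _ _ _)); [exact: mS|exact: mS|].
by rewrite mulrDl EFinD; apply: leeD; [exact: H|exact: H'].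
Qed.

Lemma measurable_preimage_swap E : measurable E -> measurable (swap @^-1` E : set plane).
Proof. by move=> mE; rewrite -[_ @^-1` _]setTI; exact: measurable_swap. Qed.

Lemma xsec_bound_sub phi E E' sigma : measurable_fun setT phi -> measurable E -> measurable E' ->
  E `<=` E' -> xsec_bound phi E' sigma -> xsec_bound phi E sigma.
Proof.
move=> mphi mE mE' EE'; apply: ysec_bound_sub.
- by apply: measurableT_comp => //; exact: measurable_swap.
- exact: measurable_preimage_swap.
- exact: measurable_preimage_swap.
- by move=> p /EE'.
Qed.

Lemma xsec_boundU phi E E' sigma : measurable_fun setT phi -> measurable E -> measurable E' ->
  xsec_bound phi E sigma -> xsec_bound phi E' sigma -> xsec_bound phi (E `|` E') sigma.
Proof.
move=> mphi mE mE'; apply: ysec_boundU.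
- by apply: measurableT_comp => //; exact: measurable_swap.
- exact: measurable_preimage_swap.
- exact: measurable_preimage_swap.
Qed.

Lemma ysec_bound_set0 phi sigma : ysec_bound phi set0 sigma.
Proof.
exists 0 => // lam l0 l1 y; rewrite mul0r /sublevel set0I.
by have -> : ysection (set0 : set plane) y = set0; [exact: ysection0|rewrite measure0].
Qed.

Lemma leb_ball_le (A : set (measurableTypeR R)) (x r : R) : measurable A -> 0 <= r ->
  (forall y : R, A y -> ball x r y) -> (leb A <= (2 * r)%:E)%E.
Proof.
move=> mA r0 H; apply: (@leb_le_closed_ball R A x) => // y /H.
by rewrite /ball/= distrC => /ltW.
Qed.

Lemma ysec_bound_trivial phi (p : R * R) (r : R) : measurable_fun setT phi -> 0 <= r ->
  measurable (ball p r : set plane) -> ysec_bound phi (ball p r) 0.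
Proof.
move=> mphi r0 mB; exists (2 * r); first exact: mulr_ge0.
move=> lam l0 l1 y; rewrite powRr0 mulr1; apply: (@leb_ball_le _ p.1) => //.
  by apply: measurable_ysection; exact: measurable_sublevel.
by move=> x; rewrite ysectionE => -[[]].
Qed.

(** Away from the zero set any exponent is allowed: the sublevel set is empty for lam < c, and for
    lam >= c the size of the ball is absorbed by the factor c^(-sigma). *)
Lemma ysec_bound_neq0 phi (p : R * R) (r c sigma : R) : measurable_fun setT phi ->
  0 <= r -> measurable (ball p r : set plane) -> 0 < c -> 0 <= sigma ->
  (forall q, ball p r q -> c <= `|phi q|) -> ysec_bound phi (ball p r) sigma.
Proof.
move=> mphi r0 mB c0 s0 hc; exists (2 * r / c `^ sigma).
  by rewrite divr_ge0 ?powR_ge0// mulr_ge0.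
move=> lam l0 l1 y; have [cl|lc] := leP c lam.
  apply: (@le_trans _ _ (2 * r)%:E).
    apply: (@leb_ball_le _ p.1) => //.
      by apply: measurable_ysection; exact: measurable_sublevel.
    by move=> x; rewrite ysectionE => -[[]].
  rewrite lee_fin mulrAC ler_pdivlMr ?powR_gt0// ler_wpM2l ?mulr_ge0//.
  by apply: ge0_ler_powR; rewrite ?nnegrE// ltW.
have -> : ysection (sublevel phi (ball p r) lam) y = set0.
  apply/seteqP; split => // x; rewrite ysectionE => -[/hc /= h1 h2].
  by move: (le_lt_trans (le_trans h1 h2) lc); rewrite ltxx.
by rewrite measure0 lee_fin mulr_ge0 ?powR_ge0// divr_ge0 ?powR_ge0// mulr_ge0.
Qed.

Lemma measurable_ball_plane (p : R * R) (r : R) : measurable (ball p r : set plane).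
Proof.
have -> : (ball p r : set plane) = (ball p.1 r : set (measurableTypeR R)) `*` (ball p.2 r : set (measurableTypeR R)).
  by apply/seteqP; split.
by apply: measurableX; exact: measurable_ball.
Qed.

Lemma continuous_fst_comp (f : R -> R) : continuous f -> continuous (fun q : R * R => f q.1).
Proof. by move=> cf q; apply: continuous_comp; [exact: cvg_fst|exact: cf]. Qed.

Lemma continuous_snd_comp (f : R -> R) : continuous f -> continuous (fun q : R * R => f q.2).
Proof. by move=> cf q; apply: continuous_comp; [exact: cvg_snd|exact: cf]. Qed.

Lemma continuous_sum_comp (f : R -> R) : continuous f -> continuous (fun q : R * R => f (q.1 + q.2)).
Proof.
move=> cf q; apply: (@continuous_comp _ _ _ (fun q : R * R => q.1 + q.2) f); last exact: cf.
by apply: (@continuous_addr _ _ (fun z => _) (fun z => _)); [exact: cvg_fst|exact: cvg_snd].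
Qed.

Lemma continuous_phase (a b c : R -> R) : continuous a -> continuous b -> continuous c ->
  continuous (phase a b c).
Proof.
move=> ca cb cc q.
apply: (@continuous_addr _ _ (fun z => _) (fun z => _)); last exact: (continuous_snd_comp cc).
apply: (@continuous_addr _ _ (fun z => _) (fun z => _)); last exact: (continuous_fst_comp cb).
have h : (fun q : R * R => - a (q.1 + q.2)) = (fun q => 0 - a (q.1 + q.2)) by apply/funext => u; rewrite sub0r.
by rewrite h; apply: (@continuous_subr _ _ (fun z => _) (fun z => _));
  [exact: cst_continuous|exact: (continuous_sum_comp ca)].
Qed.

(** Two forms of nonvanishing are recorded: a lower bound on the absolute value suffices for the
    phase and its first derivatives, while a second derivative needs a constant sign, to make the
    phase convex or concave. *)
Lemma continuous_neq0_ball (f : R * R -> R) (p : R * R) : continuous f -> f p != 0 ->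
  exists r c : R, [/\ 0 < r, 0 < c, forall q, ball p r q -> c <= `|f q| &
    (forall q, ball p r q -> c <= f q) \/ (forall q, ball p r q -> f q <= - c)].
Proof.
move=> cf fp; have l0 : 0 < `|f p| / 2 by rewrite divr_gt0 ?normr_gt0.
have [r r0 H] : exists2 r : R, 0 < r & forall q, ball p r q -> `|f p - f q| < `|f p| / 2.
  have /cvgrPdist_lt/(_ _ l0) H0 := cf p.
  by have /nbhs_ballP[r r0 H] := H0; exists r.
have [fp0|fp0|fp0] := ltgtP (f p) 0; last by rewrite fp0 eqxx in fp.
- have K q : ball p r q -> f q <= - (`|f p| / 2).
    by move=> /H /=; rewrite ltr_distl ltr0_norm// => /andP[? ?]; lra.
  exists r, (`|f p| / 2); split => //; last by right.
  by move=> q /K fq; rewrite ler_normr; apply/orP; right; lra.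
- have K q : ball p r q -> `|f p| / 2 <= f q.
    by move=> /H /=; rewrite ltr_distl gtr0_norm// => /andP[? ?]; lra.
  exists r, (`|f p| / 2); split => //; last by left.
  by move=> q /K fq; rewrite ler_normr fq.
Qed.

Section PhaseSections.
Variables (a b c a1 b1 a2 b2 : R -> R).
Hypotheses (da : forall x : R, is_derive x 1 a (a1 x)) (db : forall x : R, is_derive x 1 b (b1 x))
  (da1 : forall x : R, is_derive x 1 a1 (a2 x)) (db1 : forall x : R, is_derive x 1 b1 (b2 x))
  (ca1 : continuous a1) (cb1 : continuous b1) (ca2 : continuous a2) (cb2 : continuous b2)
  (mphi : measurable_fun setT (phase a b c : plane -> R)).

Lemma ysec_bound_derivative_neq0 (p : R * R) : - a1 (p.1 + p.2) + b1 p.1 != 0 ->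
  exists2 r : R, 0 < r & ysec_bound (phase a b c) (ball p r) 1.
Proof.
(* The derivative of the phase in xi is the phase built from [a1], [b1] and 0, which settles its
   continuity. *)
move=> np; have cf : continuous (phase a1 b1 (fun=> 0)).
  by apply: continuous_phase => // x; exact: cst_continuous.
have [|r [k [r0 k0 hk _]]] := @continuous_neq0_ball _ p cf; first by rewrite /phase addr0.
exists r => //; exists (4 / k); first by rewrite divr_ge0// ltW.
move=> lam l0 l1 y; rewrite powRr1 ?(ltW l0)//.
have [by_|nby] := pselect (ball p.2 r y); last first.
  have -> : ysection (sublevel (phase a b c) (ball p r) lam) y = set0.
    by apply/seteqP; split => // x; rewrite ysectionE => -[[]].
  by rewrite measure0 lee_fin mulr_ge0 ?divr_ge0// ltW.
apply: (@sublevel_first_derivative R _ (fun x => phase a b c (x, y)) (fun x => - a1 (x + y) + b1 x) p.1 r) => //.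
- apply: measurable_ysection; apply: measurable_sublevel => //; exact: measurable_ball_plane.
- exact: ltW.
- by move=> u; exact: is_derive_phase_fst.
- by move=> u bu; have := hk (u, y) (conj bu by_); rewrite /phase/= addr0.
- by move=> u; rewrite ysectionE => -[[]].
Qed.

Lemma ysec_bound_second_derivative_neq0 (p : R * R) : - a2 (p.1 + p.2) + b2 p.1 != 0 ->
  exists2 r : R, 0 < r & ysec_bound (phase a b c) (ball p r) 2^-1.
Proof.
move=> np; have cf : continuous (phase a2 b2 (fun=> 0)).
  by apply: continuous_phase => // x; exact: cst_continuous.
have [|r [k [r0 k0 _ hk]]] := @continuous_neq0_ball _ p cf; first by rewrite /phase addr0.
exists r => //; exists (8 / Num.sqrt k); first by rewrite divr_ge0// sqrtr_ge0.
move=> lam l0 l1 y; rewrite powR12_sqrt ?(ltW l0)//.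
have [by_|nby] := pselect (ball p.2 r y); last first.
  have -> : ysection (sublevel (phase a b c) (ball p r) lam) y = set0.
    by apply/seteqP; split => // x; rewrite ysectionE => -[[]].
  by rewrite measure0 lee_fin mulr_ge0 ?divr_ge0// sqrtr_ge0.
have -> : 8 / Num.sqrt k * Num.sqrt lam = 8 * Num.sqrt (lam / k).
  by rewrite sqrtrM ?(ltW l0)// sqrtrV ?(ltW k0)//; ring.
apply: (@sublevel_second_derivative R _ (fun x => phase a b c (x, y)) (fun x => - a1 (x + y) + b1 x)
  (fun x => - a2 (x + y) + b2 x) p.1 r) => //.
- apply: measurable_ysection; apply: measurable_sublevel => //; exact: measurable_ball_plane.
- exact: ltW.
- by move=> u; exact: is_derive_phase_fst.
- move=> u; have H := @is_derive_phase_fst R a1 b1 (fun=> 0) a2 b2 u y da1 db1.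
  have -> // : (fun x : R => - a1 (x + y) + b1 x) = (fun x => phase a1 b1 (fun=> 0) (x, y)).
  by apply/funext => x; rewrite /phase/= addr0.
- case: hk => hk; [left|right] => u bu; have := hk (u, y) (conj bu by_); by rewrite /phase/= addr0.
- by move=> u; rewrite ysectionE => -[[]].
Qed.

End PhaseSections.

(** Exchanging xi and eta exchanges b and c, since a sees only the sum. Facts about the derivatives
    in eta follow from those in xi for the phase of [a], [c], [b]. *)
Lemma phase_swap (a b c : R -> R) : (phase a b c : plane -> R) \o swap = phase a c b.
Proof. by apply/funext => -[x y]; rewrite /phase/= [y + x]addrC; ring. Qed.

Lemma xsec_bound_ball (phi : plane -> R) (p : R * R) (r sigma : R) :
  ysec_bound (phi \o swap) (ball (p.2, p.1) r) sigma -> xsec_bound phi (ball p r) sigma.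
Proof.
rewrite /xsec_bound; have -> // : swap @^-1` (ball p r) = ball (p.2, p.1) r :> set plane.
by apply/seteqP; split => -[x y] [].
Qed.

Definition good phi E (sigma tau : R) := [/\ measurable E, ysec_bound phi E sigma & xsec_bound phi E tau].

(** [E1] collects the balls with exponents (sigma, tau), [E2] those with (tau, sigma).
    [compact_local_property] glues them, because section bounds add up under unions. *)
Lemma good_cover (phi : plane -> R) (K : set (R * R)) (sigma tau : R) :
  measurable_fun setT phi -> compact K ->
  (forall p, K p -> exists2 r : R, 0 < r & good phi (ball p r) sigma tau \/ good phi (ball p r) tau sigma) ->
  exists E1 E2, [/\ good phi E1 sigma tau, good phi E2 tau sigma & K `<=` E1 `|` E2].
Proof.
move=> mphi cK loc.
have good0 s t : good phi set0 s t.
  split; [exact: measurable0|exact: ysec_bound_set0|].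
  by rewrite /xsec_bound preimage_set0; exact: ysec_bound_set0.
have goodU E E' s t : good phi E s t -> good phi E' s t -> good phi (E `|` E') s t.
  move=> [mE yE xE] [mE' yE' xE']; split; first exact: measurableU.
  - exact: ysec_boundU.
  - exact: xsec_boundU.
apply: (@compact_local_property _ K (fun A => exists E1 E2 : set plane,
   [/\ good phi E1 sigma tau, good phi E2 tau sigma & A `<=` E1 `|` E2])) => //.
- by exists set0, set0; split.
- move=> A B AB [E1 [E2 [g1 g2 BE]]]; exists E1, E2; split => //; exact: subset_trans BE.
- move=> A B [E1 [E2 [g1 g2 AE]]] [E1' [E2' [g1' g2' BE]]].
  exists (E1 `|` E1'), (E2 `|` E2'); split; [exact: goodU|exact: goodU|].
  by move=> x [/AE[]|/BE[]] h; [left; left|right; left|left; right|right; right].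
- move=> p /loc[r r0 g]; exists (ball p r); first exact: nbhsx_ballx.
  case: g => g; [exists (ball p r), set0|exists set0, (ball p r)]; split => //.
Qed.

End SectionBounds.

(** * Dyadic summation *)

Section OscAdditive.
Context d (T : measurableType d) (R : realType) (mu : {measure set T -> \bar R}).
Variable z : T -> R.
Hypothesis mz : measurable_fun setT z.

Lemma osc_cosD (w w1 w2 : T -> R) :
  mu.-integrable setT (EFin \o w1) -> mu.-integrable setT (EFin \o w2) ->
  (forall p, w p = w1 p + w2 p) ->
  osc_cos mu z w = osc_cos mu z w1 \+ osc_cos mu z w2.
Proof.
move=> i1 i2 ww; apply/funext => x; rewrite /osc_cos /= -RintegralD//; try exact: integrable_osc_cos.
by apply: eq_Rintegral => p _; rewrite ww mulrDr.
Qed.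

Lemma osc_sinD (w w1 w2 : T -> R) :
  mu.-integrable setT (EFin \o w1) -> mu.-integrable setT (EFin \o w2) ->
  (forall p, w p = w1 p + w2 p) ->
  osc_sin mu z w = osc_sin mu z w1 \+ osc_sin mu z w2.
Proof.
move=> i1 i2 ww; apply/funext => x; rewrite /osc_sin /= -RintegralD//; try exact: integrable_osc_sin.
by apply: eq_Rintegral => p _; rewrite ww mulrDr.
Qed.

End OscAdditive.

Section GoodSections.
Context (R : realType).
Notation leb := (@lebesgue_measure R).
Notation plane := (measurableTypeR R * measurableTypeR R)%type.

Lemma xsec_le (phi : plane -> R) (E : set plane) (rho C lam : R) (x : measurableTypeR R) :
  (forall y, (leb (ysection (sublevel (phi \o swap) (swap @^-1` E) lam) y) <= (C * lam `^ rho)%:E)%E) ->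
  (leb (xsection (sublevel phi E lam) x) <= (C * lam `^ rho)%:E)%E.
Proof.
by move=> /(_ x); congr (leb _ <= _)%E; apply/seteqP; split => y; rewrite ysectionE xsectionE.
Qed.

(** One constant for both directions, taken at least 1 so that sqrt D <= D can be used later. *)
Lemma good_sections (phi : plane -> R) (E : set plane) (s t : R) : good phi E s t ->
  exists2 D : R, 1 <= D & forall lam : R, 0 < lam -> lam <= 1 ->
  (forall y, (leb (ysection (sublevel phi E lam) y) <= (D * lam `^ s)%:E)%E) /\
  (forall x, (leb (xsection (sublevel phi E lam) x) <= (D * lam `^ t)%:E)%E).
Proof.
move=> [mE [C C0 H] [C' C'0 H']]; exists (1 + C + C'); first by rewrite -addrA lerDl addr_ge0.
move=> lam l0 l1; split => [y|x].
  apply: (le_trans (H lam l0 l1 y)); rewrite lee_fin ler_wpM2r ?powR_ge0//; lra.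
have X : (leb (xsection (sublevel phi E lam) x) <= (C' * lam `^ t)%:E)%E.
  by apply: xsec_le; exact: H'.
apply: (le_trans X); rewrite lee_fin ler_wpM2r ?powR_ge0//; lra.
Qed.

End GoodSections.

Section DyadicSums.
Context (R : realType).
Notation leb := (@lebesgue_measure R).
Notation leb2 := (product_measure1 leb leb).
Notation plane := (measurableTypeR R * measurableTypeR R)%type.
Variables (F G : R -> R) (A B b : R) (q : \bar R).
Hypotheses (mF : measurable_fun setT F) (mG : measurable_fun setT G)
  (A0 : 0 <= A) (B0 : 0 <= B) (b0 : 0 < b) (q2 : (2%:E <= q)%E)
  (F2 : (\int[leb]_x (F x ^+ 2)%:E <= (A ^+ 2)%:E)%E)
  (G2 : (\int[leb]_x (G x ^+ 2)%:E <= (B ^+ 2)%:E)%E).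
Implicit Types (w : plane -> R) (S E : set plane).

Let z (p : plane) : R := p.1 + p.2.
Let amp w := osc_amp leb2 z w.
Let h S (p : plane) : R := \1_S p * `|F p.1 * G p.2|.

(* The conclusion for one weight [w]: integrability and measurability accompany the norm
   bound so that such weights can be added. *)
Definition amp_bound w (M : R) := [/\ leb2.-integrable setT (EFin \o w),
  measurable_fun setT (osc_cos leb2 z w), measurable_fun setT (osc_sin leb2 z w) &
  (Lnorm leb q (EFin \o amp w) <= M%:E)%E].

Lemma measurable_amp w : measurable_fun setT (osc_cos leb2 z w) ->
  measurable_fun setT (osc_sin leb2 z w) -> measurable_fun setT (amp w).
Proof. by move=> mc ms; apply: measurable_funD; exact: measurableT_comp. Qed.

Let qgt0 : (0 < q)%E. Proof. exact: lt_le_trans q2. Qed.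
Let qge1 : (1 <= q)%E. Proof. by apply: le_trans q2; rewrite lee_fin; lra. Qed.

Lemma qinv_itv : 0 <= qinv q <= 2^-1.
Proof.
case: q q2 => [r|_|//] /=; last by rewrite lexx invr_ge0 ler0n.
rewrite lee_fin => r2; have r0 : 0 < r by lra.
by rewrite invr_ge0 (ltW r0) /= lef_pV2// posrE.
Qed.

Lemma amp_bound_add w w1 w2 M1 M2 : (forall p, w p = w1 p + w2 p) ->
  amp_bound w1 M1 -> amp_bound w2 M2 -> amp_bound w (M1 + M2).
Proof.
move=> ww [i1 c1 s1 n1] [i2 c2 s2 n2].
have mz : measurable_fun setT z by exact: measurable_sum_coord.
have cE := osc_cosD mz i1 i2 ww; have sE := osc_sinD mz i1 i2 ww.
have mc : measurable_fun setT (osc_cos leb2 z w) by rewrite cE; exact: measurable_funD.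
have ms : measurable_fun setT (osc_sin leb2 z w) by rewrite sE; exact: measurable_funD.
have m1 := measurable_amp c1 s1; have m2 := measurable_amp c2 s2.
split => //.
  by have := integrableD measurableT i1 i2; apply: eq_integrable => // p _ /=; rewrite ww EFinD.
have amp0 w' x : 0 <= amp w' x by rewrite addr_ge0.
apply: (@le_trans _ _ (Lnorm leb q (EFin \o (amp w1 \+ amp w2)))).
  apply: Lnorm_mono => //; [exact: measurable_amp|exact: measurable_funD|].
  move=> x /=; rewrite !ger0_norm ?addr_ge0//.
  by rewrite /amp /osc_amp cE sE /= addrACA lerD// ler_normD.
apply: (le_trans (@eminkowski _ (measurableTypeR R) R leb (amp w1) (amp w2) q m1 m2 qge1)).
by rewrite EFinD; exact: leeD.
Qed.

(** With r1^2 = D lam^sigma and r2^2 = D lam^tau, the sup bound carries lam^((sigma + tau)/2) and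
    the L^2 bound lam^(rho/2), rho being the exponent of the chosen direction. Interpolation puts
    the power 1 - 2/q on the former and 2/q on the latter. *)
Lemma amp_bound_piece w S (D lam sigma tau k : R) : 0 <= k -> 0 < lam -> 1 <= D ->
  measurable_fun setT w -> measurable S ->
  (forall p, S p -> `|p.1| <= b /\ `|p.2| <= b) ->
  (forall p, `|w p| <= k * h S p) ->
  (forall y, (leb (ysection S y) <= (D * lam `^ sigma)%:E)%E) ->
  (forall x, (leb (xsection S x) <= (D * lam `^ tau)%:E)%E) ->
  forall rho, rho = sigma \/ rho = tau ->
  amp_bound w (4 * D * k * A * B * lam `^ (rho * qinv q + (sigma + tau) / 2 * (1 - 2 * qinv q))).
Proof.
move=> k0 l0 D1 mw mS Sb wS Sy Sx rho rhoE.
have D0 : 0 <= D by lra.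
have powsq u : (Num.sqrt D * lam `^ (u / 2)) ^+ 2 = D * lam `^ u.
  by rewrite exprMn sqr_sqrtr// -powR_mulrn ?powR_ge0// -powRrM divfK// pnatr_eq0.
pose r1 := Num.sqrt D * lam `^ (sigma / 2); pose r2 := Num.sqrt D * lam `^ (tau / 2).
have r10 : 0 <= r1 by rewrite mulr_ge0 ?sqrtr_ge0// powR_ge0.
have r20 : 0 <= r2 by rewrite mulr_ge0 ?sqrtr_ge0// powR_ge0.
have Sy' y : (leb (ysection S y) <= (r1 ^+ 2)%:E)%E by rewrite powsq.
have Sx' x : (leb (xsection S x) <= (r2 ^+ 2)%:E)%E by rewrite powsq.
pose r := Num.sqrt D * lam `^ (rho / 2).
have rE : r = r1 \/ r = r2 by case: rhoE => e; [left|right]; rewrite /r e.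
have L1 := product_weight_L1 mF mG mw mS A0 B0 k0 r10 r20 F2 G2 Sy' Sx' wS.
have iw := integrable_of_abs mw L1.
have ma := product_weight_measurable_amp mF mG mw mS A0 B0 k0 r10 r20 b0 F2 G2 Sy' Sx' Sb wS.
have cc := product_weight_continuous_cos mF mG mw mS A0 B0 k0 r10 r20 b0 F2 G2 Sy' Sx' Sb wS.
have cs := product_weight_continuous_sin mF mG mw mS A0 B0 k0 r10 r20 b0 F2 G2 Sy' Sx' Sb wS.
have sup := product_weight_amp_sup mF mG mw mS A0 B0 k0 r10 r20 F2 G2 Sy' Sx' wS.
have L2 := product_weight_amp_L2 mF mG mw mS A0 B0 k0 r10 r20 b0 F2 G2 Sy' Sx' Sb wS rE.
split => //; [exact: continuous_measurable_fun cc|exact: continuous_measurable_fun cs|].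
(* A common prefactor for the sup and the L^2 bound comes out of the interpolation unchanged ([ZE]);
   it dominates both because D >= 1. *)
pose Z := 4 * D * k * A * B.
have Z0 : 0 <= Z by rewrite /Z !mulr_ge0.
have sD : Num.sqrt D <= D.
  rewrite -{2}(sqr_sqrtr D0) expr2 ler_peMl ?sqrtr_ge0//.
  by rewrite -(sqrtr1 R) ler_wsqrtr.
have /andP[qi0 qi2] := qinv_itv.
have X0 : 0 <= Z * lam `^ ((sigma + tau) / 2) by rewrite mulr_ge0 ?powR_ge0.
have Y0 : 0 <= Z * lam `^ (rho / 2) by rewrite mulr_ge0 ?powR_ge0.
have supX x : `|amp w x| <= Z * lam `^ ((sigma + tau) / 2).
  rewrite ger0_norm ?addr_ge0//; apply: (le_trans (sup x)).
  have -> : r1 * r2 = D * lam `^ ((sigma + tau) / 2).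
    rewrite /r1 /r2 mulrACA -expr2 sqr_sqrtr// -powRD; last first.
      by apply/implyP => _; rewrite gt_eqF.
    by congr (D * lam `^ _); rewrite mulrDl.
  have P0 := powR_ge0 lam ((sigma + tau) / 2).
  have -> : 2 * (k * (D * lam `^ ((sigma + tau) / 2) * A * B)) = 2^-1 * (Z * lam `^ ((sigma + tau) / 2)).
    by rewrite /Z; field.
  by rewrite ler_piMl//; lra.
have L2Y : (\int[leb]_x (amp w x ^+ 2)%:E <= ((Z * lam `^ (rho / 2)) ^+ 2)%:E)%E.
  apply: (le_trans L2); rewrite lee_fin ler_sqr ?nnegrE//; last first.
    by rewrite !mulr_ge0// ?sqrtr_ge0// powR_ge0.
  have -> : 4 * (k * (r * A * B)) = 4 * k * A * B * lam `^ (rho / 2) * Num.sqrt D by rewrite /r; ring.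
  have -> : Z * lam `^ (rho / 2) = 4 * k * A * B * lam `^ (rho / 2) * D by rewrite /Z; ring.
  by apply: ler_wpM2l => //; rewrite !mulr_ge0// powR_ge0.
apply: (le_trans (@Lnorm_interpolate _ (measurableTypeR R) R leb (amp w) q _ _ q2 ma X0 Y0 supX L2Y)).
have ZE : Z `^ (1 - 2 * qinv q) * Z `^ (2 * qinv q) = Z.
  by rewrite -powRD ?subrK ?powRr1// oner_eq0.
rewrite lee_fin (powRM _ Z0 (powR_ge0 lam _)) (powRM _ Z0 (powR_ge0 lam _)) mulrACA ZE.
rewrite -!powRrM -powRD; last by apply/implyP => _; rewrite gt_eqF.
rewrite le_eqVlt; apply/orP; left; apply/eqP; congr (_ * lam `^ _); by field.
Qed.

Variables (phi : plane -> R) (S0 E1 E2 : set plane) (sigma tau D : R).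
Hypotheses (mphi : measurable_fun setT phi) (mS0 : measurable S0)
  (S0b : forall p, S0 p -> `|p.1| <= b /\ `|p.2| <= b)
  (mE1 : measurable E1) (mE2 : measurable E2) (S0E : S0 `<=` E1 `|` E2) (D1 : 1 <= D)
  (H1 : forall lam : R, 0 < lam -> lam <= 1 ->
    (forall y, (leb (ysection (sublevel phi E1 lam) y) <= (D * lam `^ sigma)%:E)%E) /\
    (forall x, (leb (xsection (sublevel phi E1 lam) x) <= (D * lam `^ tau)%:E)%E))
  (H2 : forall lam : R, 0 < lam -> lam <= 1 ->
    (forall y, (leb (ysection (sublevel phi E2 lam) y) <= (D * lam `^ tau)%:E)%E) /\
    (forall x, (leb (xsection (sublevel phi E2 lam) x) <= (D * lam `^ sigma)%:E)%E)).

(** Exponent of [amp_bound_piece] for rho = sigma. The sum sigma + tau being symmetric, the pieces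
    on [E1] and [E2] share it. *)
Let gam := sigma * qinv q + (sigma + tau) / 2 * (1 - 2 * qinv q).

Let h_ge0 S p : 0 <= h S p.
Proof. by rewrite mulr_ge0// indicE. Qed.

Let restrict_le w S S' (k : R) : 0 <= k -> (forall p, `|w p| <= k * h S p) ->
  (forall p, `|\1_S' p * w p| <= k * h (S `&` S') p).
Proof.
move=> k0 H p; rewrite /h indicI /= normrM [\1_S' p]indicE.
have [pS'|pS'] := boolP (p \in S').
  by rewrite normr1 mul1r mulr1; exact: H.
by rewrite normr0 mul0r mulr0 mul0r mulr0.
Qed.

(** Degenerate use of [amp_bound_piece] with lam = 1 and both exponents 0: the sections are bounded
    by the box alone. The 1 added to 2 b meets the requirement that D be at least 1. *)
Lemma amp_bound_bounded w (k : R) : 0 <= k ->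
  measurable_fun setT w -> (forall p, `|w p| <= k * h S0 p) ->
  amp_bound w (4 * (2 * b + 1) * (k * A * B)).
Proof.
move=> k0 mw wS; pose d := 2 * b + 1.
have sec (U : set (measurableTypeR R)) : measurable U -> (forall y : R, U y -> `|y| <= b) ->
   (leb U <= d%:E)%E.
  move=> mU Ub; apply: (@le_trans _ _ (2 * b)%:E).
    by apply: (@leb_le_closed_ball R U 0) => // [|y /Ub]; [exact: ltW|rewrite subr0].
  by rewrite lee_fin /d lerDl.
have d1 : 1 <= d by rewrite /d lerDr mulr_ge0// ltW.
have := @amp_bound_piece w S0 d 1 0 0 k k0 ltr01 d1 mw mS0 S0b wS _ _ 0 (or_introl erefl).
rewrite mul0r addr0 mul0r mul0r addr0 powRr0 !mulr1.
have -> : 4 * d * k * A * B = 4 * d * (k * A * B) by ring.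
move=> H; apply: H.
- move=> y; apply: sec; first exact: measurable_ysection.
  by move=> x; rewrite ysectionE => /S0b[].
- move=> x; apply: sec; first exact: measurable_xsection.
  by move=> y; rewrite xsectionE => /S0b[].
Qed.

(** The set is cut along [E1]; what remains lies in [E2], where the two directions are exchanged. In
    both pieces the L^2 bound uses the direction of exponent sigma, hence [or_introl] for the first
    and [or_intror] for the second, and both yield lam^gam. *)
Lemma amp_bound_level w (k lam : R) : 0 <= k -> 0 < lam -> lam <= 1 ->
  measurable_fun setT w -> (forall p, `|w p| <= k * h (S0 `&` [set p | `|phi p| <= lam]) p) ->
  amp_bound w (8 * D * (k * A * B) * lam `^ gam).
Proof.
move=> k0 l0 l1 mw wS; set S := S0 `&` _ in wS.
have mS : measurable S.
  by apply: measurableI => //; have := measurable_sublevel lam mphi measurableT; rewrite /sublevel setTI.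
have mI U : measurable U -> measurable_fun setT (fun p : plane => \1_U p * w p).
  by move=> mU; apply: measurable_funM => //; exact: measurable_indic.
have [H1y H1x] := H1 l0 l1; have [H2y H2x] := H2 l0 l1.
have sub1 : S `&` E1 `<=` sublevel phi E1 lam by move=> p [[_ ?] ?]; split.
have sub2 : S `&` ~` E1 `<=` sublevel phi E2 lam.
  by move=> p [[/S0E[? //|?] ?] ?]; split.
have Sb U p : (S `&` U) p -> `|p.1| <= b /\ `|p.2| <= b by move=> [[/S0b]].
have ysub (U V : set plane) y M : measurable U -> measurable V -> U `<=` V ->
    (leb (ysection V y) <= M)%E -> (leb (ysection U y) <= M)%E.
  move=> mU mV UV; apply: le_trans; apply: le_measure; rewrite ?inE; try exact: measurable_ysection.
  by move=> x; rewrite !ysectionE; exact: UV.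
have xsub (U V : set plane) x M : measurable U -> measurable V -> U `<=` V ->
    (leb (xsection V x) <= M)%E -> (leb (xsection U x) <= M)%E.
  move=> mU mV UV; apply: le_trans; apply: le_measure; rewrite ?inE; try exact: measurable_xsection.
  by move=> y; rewrite !xsectionE; exact: UV.
have mSE1 : measurable (S `&` E1) by exact: measurableI.
have mSE2 : measurable (S `&` ~` E1) by apply: measurableI => //; exact: measurableC.
have msub E : measurable E -> measurable (sublevel phi E lam) by exact: measurable_sublevel.
have P1 := @amp_bound_piece (fun p => \1_E1 p * w p) (S `&` E1) D lam sigma tau k k0 l0 D1 (mI _ mE1)
  mSE1 (Sb _) (restrict_le _ k0 wS) (fun y => ysub _ _ y _ mSE1 (msub _ mE1) sub1 (H1y y))
  (fun x => xsub _ _ x _ mSE1 (msub _ mE1) sub1 (H1x x)) sigma (or_introl erefl).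
have P2 := @amp_bound_piece (fun p => \1_(~` E1) p * w p) (S `&` ~` E1) D lam tau sigma k k0 l0 D1
  (mI _ (measurableC mE1))
  mSE2 (Sb _) (restrict_le _ k0 wS) (fun y => ysub _ _ y _ mSE2 (msub _ mE2) sub2 (H2y y))
  (fun x => xsub _ _ x _ mSE2 (msub _ mE2) sub2 (H2x x)) sigma (or_intror erefl).
have ww p : w p = \1_E1 p * w p + \1_(~` E1) p * w p.
  by rewrite -mulrDl !indicE in_setC; case: (p \in E1); rewrite ?addr0 ?add0r mul1r.
have := amp_bound_add ww P1 P2; rewrite [tau + sigma]addrC -/gam.
have -> : 4 * D * k * A * B * lam `^ gam + 4 * D * k * A * B * lam `^ gam =
  8 * D * (k * A * B) * lam `^ gam by ring.
by [].
Qed.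

(* Splitting at [|phi| <= 2^-J] turns the bound for [J] into the one for [J + 1]. *)
Lemma amp_bound_dyadic (J : nat) w (k : R) : 0 <= k ->
  measurable_fun setT w -> (forall p, `|w p| <= 2 ^+ J.+1 * k * h S0 p) ->
  (forall p, `|w p| * `|phi p| <= k * h S0 p) ->
  amp_bound w ((8 * (2 * b + 1) + 32 * D) * (k * A * B) * (1 + \sum_(j < J) (2 ^+ j) `^ (1 - gam))).
Proof.
pose K1 := 4 * (2 * b + 1); pose K2 := 8 * D.
have K10 : 0 <= K1 by rewrite /K1; have := b0; lra.
have K20 : 0 <= K2 by rewrite /K2; have := D1; lra.
have -> : 8 * (2 * b + 1) + 32 * D = 2 * K1 + 4 * K2 by rewrite /K1 /K2; ring.
elim: J w k => [|J IH] w k k0 mw wJ wphi.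
  have k20 : 0 <= 2 * k by exact: mulr_ge0.
  have [i mc ms n] := amp_bound_bounded k20 mw wJ.
  split => //; apply: (le_trans n); rewrite lee_fin big_ord0 addr0 mulr1.
  have h0 : 0 <= k * A * B by rewrite !mulr_ge0.
  have -> : 4 * (2 * b + 1) * (2 * k * A * B) = 2 * K1 * (k * A * B) by rewrite /K1; ring.
  by apply: ler_wpM2r => //; rewrite lerDl mulr_ge0.
(* On the level 2^-J the weight is at most 2^(J+2) k, so it costs 2^(J+2) 2^(-J gam), four times the
   new summand (2^J)^(1 - gam). *)
pose lam : R := (2 ^+ J)^-1.
have p2 : 0 < 2 ^+ J :> R by rewrite exprn_gt0.
have l0 : 0 < lam by rewrite invr_gt0.
have l1 : lam <= 1 by rewrite invf_le1// exprn_ege1// ler1n.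
pose L : set plane := [set p | `|phi p| <= lam].
have mL : measurable L.
  by have := measurable_sublevel lam mphi measurableT; rewrite /sublevel setTI.
have mI U : measurable U -> measurable_fun setT (fun p : plane => \1_U p * w p).
  by move=> mU; apply: measurable_funM => //; exact: measurable_indic.
have k2 : 0 <= 2 ^+ J.+2 * k by rewrite mulr_ge0// exprn_ge0.
have P1 := amp_bound_level k2 l0 l1 (mI _ mL) (restrict_le _ k2 wJ).
have P2 : amp_bound (fun p => \1_(~` L) p * w p)
    ((2 * K1 + 4 * K2) * (k * A * B) * (1 + \sum_(j < J) (2 ^+ j) `^ (1 - gam))).
  apply: IH => //; first by apply: mI; exact: measurableC.
    move=> p; rewrite indicE; have [/set_mem /= nL|_] := boolP (p \in _); last first.
      by rewrite mul0r normr0 mulr_ge0// mulr_ge0// exprn_ge0.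
    rewrite mul1r; have phil : lam < `|phi p| by rewrite ltNge; apply/negP.
    have ph0 : 0 < `|phi p| by exact: lt_trans phil.
    (* Off the level set 1/|phi| < 2^J, so the decay hypothesis alone supplies the sup bound needed
       for the induction, with a factor 2 to spare. *)
    have : `|w p| * lam <= k * h S0 p.
      by apply: le_trans (wphi p); apply: ler_wpM2l => //; exact: ltW.
    rewrite /lam ler_pdivrMr// => H; apply: (le_trans H).
    rewrite exprSr; have kh : 0 <= k * h S0 p := mulr_ge0 k0 (h_ge0 S0 p).
    have -> : 2 ^+ J * 2 * k * h S0 p = 2 * (k * h S0 p * 2 ^+ J) by ring.
    by rewrite ler_peMl// ?mulr_ge0// ?ltW//; lra.
  move=> p; apply: le_trans (wphi p); apply: ler_wpM2r => //.
  by rewrite normrM ler_piMl// indicE; case: (_ \in _); rewrite ?normr1 ?normr0.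
have ww p : w p = \1_L p * w p + \1_(~` L) p * w p.
  by rewrite -mulrDl !indicE in_setC; case: (p \in L); rewrite ?addr0 ?add0r mul1r.
have [i mc ms n] := amp_bound_add ww P1 P2.
split => //; apply: (le_trans n); rewrite lee_fin big_ord_recr/=.
have -> : lam `^ gam = (2 ^+ J) `^ (- gam) by rewrite /lam -powR_inv1 ?(ltW p2)// -powRrM mulN1r.
have -> : 8 * D * (2 ^+ J.+2 * k * A * B) * (2 ^+ J) `^ (- gam) =
   4 * K2 * (k * A * B) * (2 ^+ J) `^ (1 - gam).
  rewrite [(2 ^+ J) `^ (1 - gam)]powRD; last by apply/implyP => _; rewrite gt_eqF.
  by rewrite powRr1 ?(ltW p2)// /K2 !exprS; ring.
rewrite [1 + (_ + _)]addrA [leRHS]mulrDr [leLHS]addrC lerD2l; apply: ler_wpM2r; first exact: powR_ge0.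
by apply: ler_wpM2r; [rewrite !mulr_ge0|rewrite lerDr mulr_ge0].
Qed.

End DyadicSums.

(** * Time integral and Fourier data *)

Section ComplexModulus.
Context (R : realType).
Implicit Types (u v : R[i]).

Lemma cabs_ge0 u : 0 <= cabs u.
Proof. exact: sqrtr_ge0. Qed.

Lemma cabs_sqr u : cabs u ^+ 2 = complex.Re u ^+ 2 + complex.Im u ^+ 2.
Proof. by rewrite /cabs sqr_sqrtr// addr_ge0// sqr_ge0. Qed.

Lemma cabsM u v : cabs (u * v) = cabs u * cabs v.
Proof.
rewrite /cabs -sqrtrM ?addr_ge0 ?sqr_ge0//; congr Num.sqrt.
by case: u v => [a b] [c d] /=; ring.
Qed.

Lemma normr_Re_le u : `|complex.Re u| <= cabs u.
Proof. by rewrite -[leLHS]sqrtr_sqr ler_wsqrtr// lerDl sqr_ge0. Qed.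

Lemma normr_Im_le u : `|complex.Im u| <= cabs u.
Proof. by rewrite -[leLHS]sqrtr_sqr ler_wsqrtr// lerDr sqr_ge0. Qed.

Lemma cabs_le_add u : cabs u <= `|complex.Re u| + `|complex.Im u|.
Proof.
rewrite -[leRHS]ger0_norm ?addr_ge0// -[leRHS]sqrtr_sqr ler_wsqrtr//.
rewrite sqrrD !real_normK ?num_real// lerD2r lerDl mulrn_wge0// mulr_ge0//.
Qed.

Lemma cabsD u v : cabs (u + v) <= cabs u + cabs v.
Proof.
rewrite -[leRHS]ger0_norm ?addr_ge0 ?cabs_ge0// -[leRHS]sqrtr_sqr ler_wsqrtr//.
rewrite sqrrD !cabs_sqr.
have : complex.Re u * complex.Re v + complex.Im u * complex.Im v <= cabs u * cabs v.
  rewrite -[leRHS]ger0_norm ?mulr_ge0 ?cabs_ge0//.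
  rewrite (le_trans (ler_norm _))// -(ler_sqr _ _) ?nnegrE// !real_normK ?num_real//.
  rewrite exprMn !cabs_sqr; case: u v => [a b] [c d] /=.
  by have := sqr_ge0 (a * d - b * c); nra.
by case: u v => [a b] [c d] /= H; rewrite !expr2 mulr2n; nra.
Qed.

Lemma cabs_expi (x : R) : cabs (expi x) = 1.
Proof. by rewrite /cabs /= cos2Dsin2 sqrtr1. Qed.

Lemma cabs_i : cabs ('i : R[i]) = 1.
Proof. by rewrite /cabs /= expr0n expr1n add0r sqrtr1. Qed.

Lemma cabsN u : cabs (- u) = cabs u.
Proof. by case: u => [a b]; rewrite /cabs /= !sqrrN. Qed.

Definition cmeasurable d (T : measurableType d) (f : T -> R[i]) :=
  measurable_fun setT (fun x => complex.Re (f x)) /\ measurable_fun setT (fun x => complex.Im (f x)).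

Lemma cmeasurableM d (T : measurableType d) (f g : T -> R[i]) :
  cmeasurable f -> cmeasurable g -> cmeasurable (fun x => f x * g x).
Proof.
move=> [f1 f2] [g1 g2]; split.
- have -> : (fun x => complex.Re (f x * g x)) =
    (fun x => complex.Re (f x) * complex.Re (g x) - complex.Im (f x) * complex.Im (g x)).
    by apply/funext => x; case: (f x) (g x) => [a b] [c d'].
  by apply: measurable_funB; exact: measurable_funM.
- have -> : (fun x => complex.Im (f x * g x)) =
    (fun x => complex.Re (f x) * complex.Im (g x) + complex.Im (f x) * complex.Re (g x)).
    by apply/funext => x; case: (f x) (g x) => [a b] [c d'].
  by apply: measurable_funD; exact: measurable_funM.
Qed.

Lemma cmeasurableB d (T : measurableType d) (f g : T -> R[i]) :
  cmeasurable f -> cmeasurable g -> cmeasurable (fun x => f x - g x).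
Proof.
move=> [f1 f2] [g1 g2]; split.
- have -> : (fun x => complex.Re (f x - g x)) = (fun x => complex.Re (f x) - complex.Re (g x)).
    by apply/funext => x; case: (f x) (g x) => [a b] [c d'].
  exact: measurable_funB.
- have -> : (fun x => complex.Im (f x - g x)) = (fun x => complex.Im (f x) - complex.Im (g x)).
    by apply/funext => x; case: (f x) (g x) => [a b] [c d'].
  exact: measurable_funB.
Qed.

Lemma cmeasurable_cabs d (T : measurableType d) (f : T -> R[i]) :
  cmeasurable f -> measurable_fun setT (fun x => cabs (f x)).
Proof.
move=> [f1 f2]; have -> : (fun x => cabs (f x)) =
    (fun x => (complex.Re (f x) ^+ 2 + complex.Im (f x) ^+ 2) `^ 2^-1).
  by apply/funext => x; rewrite powR12_sqrt// addr_ge0// sqr_ge0.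
apply: (@measurableT_comp _ _ _ _ _ _ (fun x : R => x `^ 2^-1)); first exact: measurable_powR.
by apply: measurable_funD; exact: measurable_funX.
Qed.

Lemma cmeasurable_expi d (T : measurableType d) (f : T -> R) :
  measurable_fun setT f -> cmeasurable (fun x => expi (f x)).
Proof.
move=> mf; split => /=.
- by apply: measurableT_comp => //; exact: continuous_measurable_fun (@continuous_cos R).
- by apply: measurableT_comp => //; exact: continuous_measurable_fun (@continuous_sin R).
Qed.

End ComplexModulus.

Section TimeIntegral.
Context (R : realType).
Notation leb := (@lebesgue_measure R).
Variable t : R.
Hypothesis t0 : 0 < t.

Lemma Rintegral_le_len (f : R -> R) (M : R) : continuous f ->
  (forall s, 0 <= s <= t -> `|f s| <= M) -> `|Rintegral leb `[0, t] f| <= M * t.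
Proof.
move=> cf fM; have mi : measurable (`[0, t] : set (measurableTypeR R)) by exact: measurable_itv.
have H : `|Rintegral leb `[0, t] f| <= Rintegral leb `[0, t] (fun s => `|f s|).
  by apply: le_normr_Rintegral; [exact: measurable_itv|exact: continuous_integrable_itv].
apply: (le_trans H).
have -> : M * t = Rintegral leb `[0, t] (fun=> M).
  by rewrite (@Rintegral_cst _ (measurableTypeR R) R leb _ mi)//= lebesgue_measure_itv/= lte_fin t0 /= subr0.
apply: le_Rintegral => //.
- by apply: continuous_integrable_itv => x; apply: continuous_comp; [exact: cf|exact: norm_continuous].
- by apply: continuous_integrable_itv => x; exact: cst_continuous.
Qed.

Let tc (y : R) : R := Rintegral leb `[0, t] (fun s => cos (s * y)).
Let ts (y : R) : R := Rintegral leb `[0, t] (fun s => sin (s * y)).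

Lemma continuous_cosMr (y : R) : continuous (fun s : R => cos (s * y)).
Proof. by under eq_fun do rewrite mulrC; exact: continuous_cosM. Qed.

Lemma continuous_sinMr (y : R) : continuous (fun s : R => sin (s * y)).
Proof. by under eq_fun do rewrite mulrC; exact: continuous_sinM. Qed.

Lemma time_cos_le y : `|tc y| <= t.
Proof.
rewrite -[leRHS]mul1r; apply: Rintegral_le_len; first exact: continuous_cosMr.
by move=> s _; exact: cos_le1n.
Qed.

Lemma time_sin_le y : `|ts y| <= t.
Proof.
rewrite -[leRHS]mul1r; apply: Rintegral_le_len; first exact: continuous_sinMr.
by move=> s _; exact: sin_le1n.
Qed.

(** The antiderivative sin(s y)/y gives a bound uniform in t; the product form covers y = 0 without
    division. *)
Lemma time_cos_decay y : `|tc y| * `|y| <= 2.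
Proof.
have [->|y0] := eqVneq y 0; first by rewrite normr0 mulr0.
have dF (s : R) : is_derive s 1 (fun s => y^-1 * sin (y * (s + 0))) (cos (s * y)).
  have H : is_derive s 1 (fun s => y^-1 * sin (y * (s + 0))) _ := is_deriveZ y^-1 (is_derive_sin_affine y 0 s).
  by apply: (is_derive_eq H); rewrite addr0 /GRing.scale/= [s * y]mulrC; field.
rewrite /tc (Rintegral_FTC t0 (@continuous_cosMr y) dF) !addr0 mulr0 sin0 mulr0 subr0.
rewrite -normrM mulrAC mulVf// mul1r; apply: (le_trans (sin_le1n _)); lra.
Qed.

Lemma time_sin_decay y : `|ts y| * `|y| <= 2.
Proof.
have [->|y0] := eqVneq y 0; first by rewrite normr0 mulr0.
have dF (s : R) : is_derive s 1 (fun s => - y^-1 * cos (y * (s + 0))) (sin (s * y)).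
  have H : is_derive s 1 (fun s => - y^-1 * cos (y * (s + 0))) _ := is_deriveZ (- y^-1) (is_derive_cos_affine y 0 s).
  by apply: (is_derive_eq H); rewrite addr0 /GRing.scale/= [s * y]mulrC; field.
rewrite /ts (Rintegral_FTC t0 (@continuous_sinMr y) dF) !addr0 mulr0 cos0 -mulrBr -normrM.
rewrite mulrAC mulNr mulVf// mulN1r normrN.
by apply: (le_trans (ler_normB _ _)); rewrite normr1 -[2]/(1 + 1) lerD2r cos_le1n.
Qed.

Lemma time_cos_lipschitz y y' : `|tc y - tc y'| <= t * t * `|y - y'|.
Proof.
rewrite /tc -RintegralB; try (apply: continuous_integrable_itv; exact: continuous_cosMr);
  last exact: measurable_itv.
rewrite mulrAC; apply: Rintegral_le_len.
  by move=> s; apply: (@continuous_subr _ _ (fun z => _) (fun z => _)); exact: continuous_cosMr.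
move=> s /andP[s0 st]; apply: (le_trans (cos_lipschitz _ _)).
by rewrite -mulrBr normrM ger0_norm// ler_wpM2r.
Qed.

Lemma time_sin_lipschitz y y' : `|ts y - ts y'| <= t * t * `|y - y'|.
Proof.
rewrite /ts -RintegralB; try (apply: continuous_integrable_itv; exact: continuous_sinMr);
  last exact: measurable_itv.
rewrite mulrAC; apply: Rintegral_le_len.
  by move=> s; apply: (@continuous_subr _ _ (fun z => _) (fun z => _)); exact: continuous_sinMr.
move=> s /andP[s0 st]; apply: (le_trans (sin_lipschitz _ _)).
by rewrite -mulrBr normrM ger0_norm// ler_wpM2r.
Qed.

Definition time_factor (y : R) : R[i] := cint leb `[0, t] (fun s => expi (s * y)).

Lemma time_factor_le y : cabs (time_factor y) <= 2 * t.
Proof.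
apply: (le_trans (cabs_le_add _)); rewrite /time_factor /cint /=.
by rewrite mulr_natl mulr2n lerD// ?time_cos_le ?time_sin_le.
Qed.

Lemma time_factor_decay y : cabs (time_factor y) * `|y| <= 4.
Proof.
apply: (@le_trans _ _ ((`|tc y| + `|ts y|) * `|y|)).
  by apply: ler_wpM2r => //; exact: cabs_le_add.
rewrite mulrDl; have := time_cos_decay y; have := time_sin_decay y; lra.
Qed.

Lemma cmeasurable_time_factor d (T : measurableType d) (f : T -> R) :
  measurable_fun setT f -> cmeasurable (fun x => time_factor (f x)).
Proof.
move=> mf; split => /=.
- apply: (measurableT_comp (f := tc)) => //; apply: continuous_measurable_fun.
  exact: (lipschitz_continuous time_cos_lipschitz).
- apply: (measurableT_comp (f := ts)) => //; apply: continuous_measurable_fun.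
  exact: (lipschitz_continuous time_sin_lipschitz).
Qed.

End TimeIntegral.

(** * L^2 bound for the Fourier data *)

Section TruncatedFourier.
Context (R : realType).
Notation leb := (@lebesgue_measure R).

(** One-dimensional sampling argument in place of Plancherel: Cauchy-Schwarz against trigonometric
    polynomials on [[- b, b]], then [bessel], then integration over base points. The factor obtained
    is 2 b h = 2 pi, at most 9 since pi <= 4; hence the 3. *)
Lemma amp_L2_interval (w : R -> R) (b A : R) : 0 < b -> 0 <= A -> measurable_fun setT w ->
  (forall x, w x != 0 -> `|x| <= b) -> (\int[leb]_x (w x ^+ 2)%:E <= (A ^+ 2)%:E)%E ->
  [/\ leb.-integrable setT (EFin \o w), continuous (osc_cos leb id w), continuous (osc_sin leb id w) &
  (\int[leb]_x ((osc_cos leb id w x) ^+ 2 + (osc_sin leb id w x) ^+ 2)%:E <= ((3 * A) ^+ 2)%:E)%E].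
Proof.
move=> b0 A0 mw wb w2.
have mid : measurable_fun setT (id : measurableTypeR R -> R) by exact: measurable_id.
have b2 : 0 <= 2 * b by rewrite mulr_ge0// ltW.
pose I : R -> R := \1_(`[- b, b]%classic).
have mI : measurable_fun setT I by apply: measurable_indic; exact: measurable_itv.
have Iw x : I x * w x = w x.
  have [->|w0] := eqVneq (w x) 0; first by rewrite mulr0.
  by rewrite /I indicE mem_set ?mul1r//= in_itv/= -ler_norml wb.
have trig (c d : nat -> R) (x0 h : R) (N : nat) : h * b = pi ->
  (\int[leb]_x `|trigc c d x0 h N x * w x|%:E <=
    (Num.sqrt (2 * b * \sum_(n < N) (c n ^+ 2 + d n ^+ 2)) * A)%:E)%E.
  move=> hb; set s := 2 * b * _.
  have s0 : 0 <= s.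
    by apply: mulr_ge0; [rewrite mulr_ge0// ltW|apply: sumr_ge0 => n _; apply: addr_ge0; exact: sqr_ge0].
  have mt : measurable_fun setT (trigc c d x0 h N).
    by apply: continuous_measurable_fun; exact: continuous_trigc.
  have := @cauchy_schwarz _ (measurableTypeR R) R leb (Num.sqrt s) A (fun x => I x * trigc c d x0 h N x) w
    (sqrtr_ge0 s) A0 (measurable_funM mI mt) mw.
  have -> : (fun x => `|I x * trigc c d x0 h N x * w x|%:E) = (fun x => `|trigc c d x0 h N x * w x|%:E).
    by apply/funext => x; rewrite mulrAC Iw mulrC.
  apply => //; rewrite sqr_sqrtr//; apply: le_trans (trigc_period_l2 c d x0 0 N b0 hb).
  rewrite [leRHS]integral_mkcond le_eqVlt; apply/orP; left; apply/eqP; apply: eq_integral => x _.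
  by rewrite /patch /I indicE addr0; case: (_ \in _); rewrite ?mul1r// mul0r expr0n.
have w1 : (\int[leb]_x `|w x|%:E <= (Num.sqrt (2 * b) * A)%:E)%E.
  have := @cauchy_schwarz _ (measurableTypeR R) R leb (Num.sqrt (2 * b)) A I w
    (sqrtr_ge0 _) A0 mI mw.
  have -> : (fun x => `|I x * w x|%:E) = (fun x => `|w x|%:E) by apply/funext => x; rewrite Iw.
  apply => //; rewrite (sqr_sqrtr b2).
  have -> : (fun x => (I x ^+ 2)%:E) = (fun x => (\1_(`[- b, b]%classic) x : R)%:E).
    by apply/funext => x; rewrite /I indicE; case: (_ \in _); rewrite ?expr1n ?expr0n.
  have -> : (\int[leb]_x (\1_(`[(- b)%R, b]%classic) x : R)%:E = leb `[(- b)%R, b]%classic)%E.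
    by rewrite integral_indic ?setIT//; exact: measurable_itv.
  by rewrite lebesgue_measure_itv/= lte_fin gtrN//= opprK lee_fin mulr_natl mulr2n.
have iw := @integrable_of_abs _ (measurableTypeR R) R leb w _ mw w1.
have cc : continuous (osc_cos leb id w).
  exact: (lipschitz_continuous (@osc_cos_lipschitz _ (measurableTypeR R) R leb id w _ b (ltW b0) mid mw w1 wb)).
have cs : continuous (osc_sin leb id w).
  exact: (lipschitz_continuous (@osc_sin_lipschitz _ (measurableTypeR R) R leb id w _ b (ltW b0) mid mw w1 wb)).
split => //.
pose h := pi / b; have hb : h * b = pi by rewrite /h divfK// gt_eqF.
have h0 : 0 < h by rewrite divr_gt0// pi_gt0.
pose C := Num.sqrt (2 * b) * A.
have C0 : 0 <= C by rewrite mulr_ge0// sqrtr_ge0.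
have bes x0 N : \sum_(n < N) (osc_cos leb id w (x0 + n%:R * h) ^+ 2 +
    osc_sin leb id w (x0 + n%:R * h) ^+ 2) <= C ^+ 2.
  apply: (@bessel _ (measurableTypeR R) R leb id w C x0 h N C0 mid iw) => c d; apply: (le_trans (trig c d x0 h N hb)).
  by rewrite lee_fin /C [in leLHS]sqrtrM// mulrAC.
have mc := continuous_measurable_fun cc; have ms := continuous_measurable_fun cs.
have P := @ge0_integral_periodized R (fun x => osc_cos leb id w x ^+ 2 + osc_sin leb id w x ^+ 2) h (C ^+ 2) h0
  (measurable_funD (measurable_funX 2 mc) (measurable_funX 2 ms))
  (fun x => addr_ge0 (sqr_ge0 _) (sqr_ge0 _)) bes.
apply: (le_trans P); rewrite lee_fin /C exprMn (sqr_sqrtr b2).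
have -> : h * (2 * b * A ^+ 2) = 2 * pi * A ^+ 2 by rewrite -hb; ring.
rewrite exprMn ler_wpM2r ?sqr_ge0//.
have : pi <= 4 :> R by have := pihalf_lt2 R; rewrite ltr_pdivrMr// => /ltW H; apply: (le_trans H); lra.
by move=> ?; lra.
Qed.

Lemma L2_le_fine (f : R -> R) : measurable_fun setT f ->
  (Lnorm leb 2%:E (EFin \o f) < +oo)%E ->
  (\int[leb]_x (f x ^+ 2)%:E <= (fine (Lnorm leb 2%:E (EFin \o f)) ^+ 2)%:E)%E.
Proof.
move=> mf flt; have L0 : (0 <= Lnorm leb 2%:E (EFin \o f))%E by exact: Lnorm_ge0.
have := @Lnorm_EFin_ge _ (measurableTypeR R) R leb 2 (fine (Lnorm leb 2%:E (EFin \o f))) f (ltr0Sn _ _) (fine_ge0 L0).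
rewrite fineK ?ge0_fin_numE// lexx => /(_ isT); rewrite powR_mulrn ?fine_ge0//.
by under eq_integral do rewrite powR_mulrn// real_normK ?num_real//.
Qed.

Lemma L2_Lnorm_le (f : R -> R) (A : R) : 0 <= A ->
  (\int[leb]_x (f x ^+ 2)%:E <= (A ^+ 2)%:E)%E -> (Lnorm leb 2%:E (EFin \o f) <= A%:E)%E.
Proof.
move=> A0 H; apply: (@Lnorm_EFin_le _ (measurableTypeR R) R leb 2) => //; rewrite powR_mulrn//.
by under eq_integral do rewrite powR_mulrn// real_normK ?num_real//.
Qed.

(** The real and imaginary parts of f, cut to the window, are treated separately; their cosine and
    sine transforms recombine, and the squared modulus integrates to at most 2 (9 A^2 + 9 A^2) = (6
    A)^2, uniformly in n. *)
Lemma FTtrunc_bound (f : R -> R[i]) (n : nat) : inL2 f ->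
  cmeasurable (FTtrunc f n) /\
  (Lnorm leb 2%:E (EFin \o (fun xi => cabs (FTtrunc f n xi))) <= (6 * fine (L2norm f))%:E)%E.
Proof.
move=> [m1 [m2 flt]].
have mabs : measurable_fun setT (fun x => cabs (f x)) by exact: cmeasurable_cabs (conj m1 m2).
pose A := fine (L2norm f).
have A0 : 0 <= A by rewrite fine_ge0// Lnorm_ge0.
have f2 : (\int[leb]_x (cabs (f x) ^+ 2)%:E <= (A ^+ 2)%:E)%E by exact: L2_le_fine.
pose D : set R := `[- n%:R, n%:R]%classic.
have mD : measurable (D : set (measurableTypeR R)) by exact: measurable_itv.
pose w1 x : R := \1_D x * complex.Re (f x); pose w2 x : R := \1_D x * complex.Im (f x).
have mID : measurable_fun setT (\1_D : measurableTypeR R -> R) by exact: measurable_indic.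
have mw1 : measurable_fun setT w1 by exact: measurable_funM.
have mw2 : measurable_fun setT w2 by exact: measurable_funM.
(* The window is a point for n = 0; enlarging it by 1 gives it positive length. *)
have b0 : (0 : R) < n%:R + 1 by rewrite ltr_wpDl.
have wb (g : R -> R) x : \1_D x * g x != 0 -> `|x| <= n%:R + 1.
  rewrite indicE; have [/set_mem|_] := boolP (x \in D); last by rewrite mul0r eqxx.
  by rewrite /D /= in_itv/= -ler_norml => h _; rewrite (le_trans h)// lerDl.
have le2 (g : R -> R) : measurable_fun setT g -> (forall x, `|g x| <= cabs (f x)) ->
  (\int[leb]_x ((\1_D x * g x) ^+ 2)%:E <= (A ^+ 2)%:E)%E.
  move=> mg gf; apply: le_trans f2; apply: ge0_le_integral => //.
  - by move=> x _; rewrite lee_fin sqr_ge0.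
  - by apply/measurable_EFinP; apply: measurable_funX; exact: measurable_funM.
  - by apply/measurable_EFinP; exact: measurable_funX.
  - move=> x _; rewrite lee_fin -real_normK ?num_real// ler_sqr ?nnegrE ?cabs_ge0//.
    apply: le_trans (gf x); rewrite normrM ler_piMl// indicE.
    by case: (_ \in _); rewrite ?normr1 ?normr0.
have [i1 c1 s1 n1] := amp_L2_interval b0 A0 mw1 (wb _) (le2 _ m1 (fun x => normr_Re_le _)).
have [i2 c2 s2 n2] := amp_L2_interval b0 A0 mw2 (wb _) (le2 _ m2 (fun x => normr_Im_le _)).
have mid : measurable_fun setT (id : measurableTypeR R -> R) by exact: measurable_id.
have ReE xi : complex.Re (FTtrunc f n xi) = osc_cos leb id w1 xi + osc_sin leb id w2 xi.
  rewrite /FTtrunc /cint [LHS]/= Rintegral_mkcond /osc_cos /osc_sin -RintegralD//; last 2 first.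
  - exact: integrable_osc_cos.
  - exact: integrable_osc_sin.
  apply: eq_Rintegral => x _; rewrite /patch /w1 /w2 indicE -/D.
  case: (_ \in D); last by rewrite !mul0r !mulr0 addr0.
  by case: (f x) => [u v] /=; rewrite !mul1r cosN sinN [x * xi]mulrC; ring.
have ImE xi : complex.Im (FTtrunc f n xi) = osc_cos leb id w2 xi - osc_sin leb id w1 xi.
  rewrite /FTtrunc /cint [LHS]/= Rintegral_mkcond /osc_cos /osc_sin -RintegralB//; last 2 first.
  - exact: integrable_osc_cos.
  - exact: integrable_osc_sin.
  apply: eq_Rintegral => x _; rewrite /patch /w1 /w2 indicE -/D.
  case: (_ \in D); last by rewrite !mul0r !mulr0 subr0.
  by case: (f x) => [u v] /=; rewrite !mul1r cosN sinN [x * xi]mulrC; ring.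
have mFT : cmeasurable (FTtrunc f n).
  split.
  - under eq_fun do rewrite ReE.
    by apply: measurable_funD; exact: continuous_measurable_fun.
  - under eq_fun do rewrite ImE.
    by apply: measurable_funB; exact: continuous_measurable_fun.
split => //; apply: L2_Lnorm_le; first by rewrite mulr_ge0.
pose Q w xi := osc_cos leb id w xi ^+ 2 + osc_sin leb id w xi ^+ 2.
have mQ w : continuous (osc_cos leb id w) -> continuous (osc_sin leb id w) -> measurable_fun setT (Q w).
  by move=> cw sw; apply: measurable_funD; apply: measurable_funX; exact: continuous_measurable_fun.
have Q0 w xi : 0 <= Q w xi by rewrite addr_ge0// sqr_ge0.
apply: (@le_trans _ _ (\int[leb]_xi (2%:E * ((Q w1 xi)%:E + (Q w2 xi)%:E)))%E).
  apply: ge0_le_integral => //.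
  - by move=> x _; rewrite lee_fin sqr_ge0.
  - by apply/measurable_EFinP; apply: measurable_funX; exact: cmeasurable_cabs.
  - apply/measurable_EFinP; apply: measurable_funM; first exact: measurable_cst.
    by apply: measurable_funD; exact: mQ.
  - move=> xi _; rewrite -EFinD -EFinM lee_fin cabs_sqr ReE ImE /Q.
    move: (osc_cos leb id w1 xi) (osc_sin leb id w1 xi) (osc_cos leb id w2 xi) (osc_sin leb id w2 xi) => a b c d.
    by have := sqr_ge0 (a - d); have := sqr_ge0 (c + b); nra.
rewrite ge0_integralZl//; last 2 first.
- by apply/measurable_EFinP; apply: measurable_funD; exact: mQ.
- by move=> x _; rewrite adde_ge0// lee_fin.
rewrite ge0_integralD//; last 4 first.
- by move=> x _; rewrite lee_fin.
- by apply/measurable_EFinP; exact: mQ.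
- by move=> x _; rewrite lee_fin.
- by apply/measurable_EFinP; exact: mQ.
apply: (@le_trans _ _ (2%:E * (((3 * A) ^+ 2)%:E + ((3 * A) ^+ 2)%:E))%E).
  by apply: lee_wpmul2l => //; apply: leeD.
by rewrite -EFinD -EFinM lee_fin -/A le_eqVlt; apply/orP; left; apply/eqP; ring.
Qed.

(** Triangle inequality against the truncated transforms: the error tends to 0 in L^2, and the bound
    on the truncations does not depend on n. *)
Lemma is_FT2_bound (f F : R -> R[i]) : inL2 f -> is_FT2 f F ->
  cmeasurable F /\ (\int[leb]_xi (cabs (F xi) ^+ 2)%:E <= ((6 * fine (L2norm f)) ^+ 2)%:E)%E.
Proof.
move=> fL [m1 [m2 cv]]; have mF : cmeasurable F by [].
split => //; set C := 6 * _.
have C0 : 0 <= C by rewrite mulr_ge0// fine_ge0// Lnorm_ge0.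
pose e n : \bar R := Lnorm leb 2%:E (EFin \o (fun xi => cabs (F xi - FTtrunc f n xi))).
have H n : (Lnorm leb 2%:E (EFin \o (fun xi => cabs (F xi))) <= e n + C%:E)%E.
  have [mT nT] := FTtrunc_bound n fL.
  have mB : cmeasurable (fun xi => F xi - FTtrunc f n xi).
    exact: cmeasurableB.
  have ma := cmeasurable_cabs mB; have mb := cmeasurable_cabs mT.
  apply: (@le_trans _ _ (Lnorm leb 2%:E (EFin \o (
    (fun xi => cabs (F xi - FTtrunc f n xi)) \+ (fun xi => cabs (FTtrunc f n xi)))))).
    apply: Lnorm_mono => //; [exact: cmeasurable_cabs|exact: measurable_funD|].
    move=> xi /=; rewrite !ger0_norm ?addr_ge0 ?cabs_ge0//.
    by have := cabsD (F xi - FTtrunc f n xi) (FTtrunc f n xi); rewrite subrK.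
  have l2 : (1%:E <= (2%:E : \bar R))%E by rewrite lee_fin; lra.
  apply: (le_trans (@eminkowski _ (measurableTypeR R) R leb _ _ 2%:E ma mb l2)).
  exact: leeD.
have key : (Lnorm leb 2%:E (EFin \o (fun xi => cabs (F xi))) <= C%:E)%E.
  apply/lee_addgt0Pr => d d0.
  have d1 : (0 < d%:E :> \bar R)%E by rewrite lte_fin.
  have := cv [set y | y < d%:E]%E => /(_ _) [].
    by apply: open_nbhs_nbhs; split; [exact: open_ereal_lt_ereal|].
  move=> n _ /(_ n (leqnn n)) /= en; apply: (le_trans (H n)).
  by rewrite addeC; apply: leeD => //; exact: ltW.
have mabs := cmeasurable_cabs mF.
have lt : (Lnorm leb 2%:E (EFin \o (fun xi => cabs (F xi))) < +oo)%E by rewrite (le_lt_trans key)// ltry.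
apply: (le_trans (L2_le_fine mabs lt)).
have L0 : (0 <= Lnorm leb 2%:E (EFin \o (fun xi => cabs (F xi))))%E by exact: Lnorm_ge0.
rewrite lee_fin ler_sqr ?nnegrE ?fine_ge0//.
by rewrite -lee_fin fineK// ge0_fin_numE.
Qed.

End TruncatedFourier.

(** * From weights to solutions *)

Section SolutionBound.
Context (R : realType).
Notation leb := (@lebesgue_measure R).
Notation leb2 := (product_measure1 leb leb).
Notation plane := (measurableTypeR R * measurableTypeR R)%type.
Variables (a b c : R -> R) (m : R * R -> R[i]) (F G : R -> R[i]) (t : R).
Hypotheses (t0 : 0 < t) (ma : measurable_fun setT a)
  (mphi : measurable_fun setT (phase a b c : plane -> R))
  (mm : cmeasurable (m : plane -> R[i])) (mF : cmeasurable F) (mG : cmeasurable G).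

Let z (p : plane) : R := p.1 + p.2.

Definition sol_weight (p : plane) : R[i] :=
  expi (t * a (p.1 + p.2)) * time_factor t (phase a b c p) * m p * F p.1 * G p.2.

Let w1 (p : plane) : R := complex.Re (sol_weight p).
Let w2 (p : plane) : R := complex.Im (sol_weight p).

Lemma cmeasurable_sol_weight : cmeasurable sol_weight.
Proof.
apply: cmeasurableM; last first.
  by split; [exact: (@measurable_fun_snd R _ mG.1)|exact: (@measurable_fun_snd R _ mG.2)].
apply: cmeasurableM; last first.
  by split; [exact: (@measurable_fun_fst R _ mF.1)|exact: (@measurable_fun_fst R _ mF.2)].
apply: cmeasurableM => //; apply: cmeasurableM; last exact: cmeasurable_time_factor.
apply: cmeasurable_expi; apply: measurable_funM; first exact: measurable_cst.
by apply: measurableT_comp => //; exact: measurable_sum_coord.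
Qed.

Lemma cabs_sol_weight p : cabs (sol_weight p) =
  cabs (time_factor t (phase a b c p)) * cabs (m p) * (cabs (F p.1) * cabs (G p.2)).
Proof. by rewrite /sol_weight !cabsM cabs_expi mul1r !mulrA. Qed.

(** Separating real and imaginary parts of e^{ixz} (w1 + i w2) leaves four real oscillatory
    integrals, exactly those in the two amplitudes; the prefactor -i has modulus 1. *)
Lemma Lnorm_sol (q : \bar R) (M1 M2 : R) : (1 <= q)%E ->
  amp_bound q w1 M1 -> amp_bound q w2 M2 ->
  (Lnorm leb q (fun x => (cabs (sol a b c m F G t x))%:E) <= (M1 + M2)%:E)%E.
Proof.
move=> q1 [i1 c1 s1 n1] [i2 c2 s2 n2].
have mz : measurable_fun setT z by exact: measurable_sum_coord.
pose S x : R[i] := Complex (osc_cos leb2 z w1 x - osc_sin leb2 z w2 x) (osc_cos leb2 z w2 x + osc_sin leb2 z w1 x).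
have solE x : sol a b c m F G t x = - 'i * S x.
  rewrite /sol; congr (- 'i * _); rewrite /cint /S; congr Complex.
  - rewrite /osc_cos /osc_sin -RintegralB//; [|exact: integrable_osc_cos|exact: integrable_osc_sin].
    apply: eq_Rintegral => p _; rewrite /w1 /w2 -!mulrA.
    have -> : expi (x * (p.1 + p.2)) * (expi (t * a (p.1 + p.2)) *
       (cint leb `[0, t] (fun s => expi (s * phase a b c p)) * (m p * (F p.1 * G p.2)))) =
       expi (x * z p) * sol_weight p by rewrite /sol_weight /time_factor !mulrA.
    by case: (sol_weight p).
  - rewrite /osc_cos /osc_sin -RintegralD//; [|exact: integrable_osc_cos|exact: integrable_osc_sin].
    apply: eq_Rintegral => p _; rewrite /w1 /w2 -!mulrA.
    have -> : expi (x * (p.1 + p.2)) * (expi (t * a (p.1 + p.2)) *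
       (cint leb `[0, t] (fun s => expi (s * phase a b c p)) * (m p * (F p.1 * G p.2)))) =
       expi (x * z p) * sol_weight p by rewrite /sol_weight /time_factor !mulrA.
    by case: (sol_weight p).
have mS : cmeasurable S.
  by split => /=; [exact: measurable_funB|exact: measurable_funD].
have cabsE : (fun x => (cabs (sol a b c m F G t x))%:E) = EFin \o (fun x => cabs (S x)).
  by apply/funext => x; rewrite /= solE cabsM cabsN cabs_i mul1r.
have m1 : measurable_fun setT (osc_amp leb2 z w1) by exact: measurable_amp.
have m2 : measurable_fun setT (osc_amp leb2 z w2) by exact: measurable_amp.
rewrite cabsE; apply: (@le_trans _ _ (Lnorm leb q (EFin \o (osc_amp leb2 z w1 \+ osc_amp leb2 z w2)))).
  apply: Lnorm_mono; [exact: lt_le_trans q1|exact: cmeasurable_cabs|exact: measurable_funD|].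
  move=> x /=; rewrite !ger0_norm ?cabs_ge0 ?addr_ge0//.
  apply: (le_trans (cabs_le_add _)); rewrite /S /osc_amp /=.
  by apply: (le_trans (lerD (ler_normB _ _) (ler_normD _ _))); lra.
apply: (le_trans (@eminkowski _ (measurableTypeR R) R leb _ _ q m1 m2 q1)).
by rewrite EFinD; exact: leeD.
Qed.

End SolutionBound.

(** Only the L^2 size of the Fourier data matters; 36 is the square of the constant 6 with which
    [is_FT2_bound] passes from f, g to F, G. *)
Lemma estimate_of_L2_data (R : realType) (a b c : R -> R) (m : R * R -> R[i]) (q : \bar R) (alpha : R -> R) :
  (exists2 K : R, 0 <= K & forall (t : R) (F G : R -> R[i]) (A B : R), 0 < t -> 0 <= A -> 0 <= B ->
     cmeasurable F -> cmeasurable G ->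
     (\int[@lebesgue_measure R]_x (cabs (F x) ^+ 2)%:E <= (A ^+ 2)%:E)%E ->
     (\int[@lebesgue_measure R]_x (cabs (G x) ^+ 2)%:E <= (B ^+ 2)%:E)%E ->
     (Lnorm (@lebesgue_measure R) q (fun x => (cabs (sol a b c m F G t x))%:E) <= (K * alpha t * A * B)%:E)%E) ->
  estimate a b c m q alpha.
Proof.
move=> [K K0 H]; exists (36 * K) => t f g F G t0 fL gL fF gG.
have [mF F2] := is_FT2_bound fL fF; have [mG G2] := is_FT2_bound gL gG.
have Af : 0 <= fine (L2norm f) by rewrite fine_ge0// Lnorm_ge0.
have Ag : 0 <= fine (L2norm g) by rewrite fine_ge0// Lnorm_ge0.
have A0 : 0 <= 6 * fine (L2norm f) by rewrite mulr_ge0.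
have B0 : 0 <= 6 * fine (L2norm g) by rewrite mulr_ge0.
apply: (le_trans (H t F G _ _ t0 A0 B0 mF mG F2 G2)).
have fE : L2norm f = (fine (L2norm f))%:E.
  by rewrite fineK// ge0_fin_numE; [exact: fL.2.2|exact: Lnorm_ge0].
have gE : L2norm g = (fine (L2norm g))%:E.
  by rewrite fineK// ge0_fin_numE; [exact: gL.2.2|exact: Lnorm_ge0].
rewrite [in leRHS]fE [in leRHS]gE -!EFinM lee_fin le_eqVlt; apply/orP; left; apply/eqP; ring.
Qed.

(** * Growth of the dyadic sums *)

Section DyadicGrowth.
Context (R : realType).

(** J is minimal: 2^J reaches t, as the bound of the weight by a multiple of t requires, and yet 2^j
    < t for every term of the sum. *)
Lemma dyadic_index (t : R) : exists J : nat, t <= 2 ^+ J /\ forall j, (j < J)%N -> 2 ^+ j < t.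
Proof.
have ex : exists n, t <= 2 ^+ n.
  exists (Num.bound t); apply: (le_trans (ler_norm t)); apply: ltW.
  apply: (lt_le_trans (archi_boundP (normr_ge0 t))).
  have -> : Num.bound `|t| = Num.bound t by rewrite /Num.bound normr_id.
  by rewrite -natrX ler_nat ltnW// ltn_expl.
exists (ex_minn ex); case: ex_minnP => J tJ min; split => // j jJ.
by rewrite ltNge; apply/negP => /min; rewrite leqNgt jJ.
Qed.

(** A geometric sum of ratio r = 2^delta > 1 is controlled by its last term, and 2^(J-1) < t if J >
    0. The 1 in the constant accounts for the leading 1, as t^delta >= 1. *)
Lemma dyadic_sum_pow (delta : R) : 0 < delta -> exists2 C : R, 0 <= C & forall (t : R) (J : nat),
  1 <= t -> (forall j, (j < J)%N -> 2 ^+ j < t) ->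
  1 + \sum_(j < J) (2 ^+ j) `^ delta <= C * t `^ delta.
Proof.
move=> d0; pose r : R := 2 `^ delta.
have r1 : 1 < r.
  have h : (1 : R) `^ delta < 2 `^ delta by apply: gt0_ltr_powR; rewrite ?nnegrE//; lra.
  by rewrite powR1 in h.
have rj j : (2 ^+ j : R) `^ delta = r ^+ j.
  by rewrite -powR_mulrn// -powRrM mulrC powRrM powR_mulrn// powR_ge0.
have geo J : (\sum_(j < J) r ^+ j) * (r - 1) <= r ^+ J.
  elim: J => [|J IH]; first by rewrite big_ord0 mul0r expr0.
  by rewrite big_ord_recr/= mulrDl exprSr; move: IH; nra.
exists (1 + r / (r - 1)); first by rewrite addr_ge0// divr_ge0; lra.
move=> t J t1 Jt.
have td : 1 <= t `^ delta by rewrite -(powRr0 t); apply: ler_powR => //; exact: ltW.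
rewrite mulrDl mul1r lerD//.
under eq_bigr do rewrite rj.
have r10 : 0 < r - 1 by lra.
rewrite mulrAC ler_pdivlMr//; apply: (le_trans (geo J)).
case: J Jt => [|J] Jt; first by rewrite expr0; nra.
rewrite exprS ler_wpM2l//; first lra.
rewrite -rj; apply: ge0_ler_powR; rewrite ?nnegrE ?exprn_ge0//; try lra.
exact/ltW/Jt.
Qed.

(** At exponent 0 the sum counts its J terms, and 2^(J-1) < t gives J <= 1 + ln t / ln 2. The
    bracket [jap] dominates both 1 and ln t. *)
Lemma dyadic_sum_log : exists2 C : R, 0 <= C & forall (t : R) (J : nat),
  1 <= t -> (forall j, (j < J)%N -> 2 ^+ j < t) ->
  1 + \sum_(j < J) (2 ^+ j) `^ (0 : R) <= C * jap (ln t).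
Proof.
have l2 : 0 < ln (2 : R) by rewrite ln_gt0// ltr1n.
exists (2 + (ln 2)^-1); first by rewrite addr_ge0// invr_ge0 ltW.
move=> t J t1 Jt; under eq_bigr do rewrite powRr0.
rewrite sumr_const card_ord.
have j1 : 1 <= jap (ln t).
  by rewrite /jap -[leLHS]sqrtr1 ler_wsqrtr// lerDl sqr_ge0.
have j2 : ln t <= jap (ln t).
  by rewrite (le_trans (ler_norm _))// -sqrtr_sqr /jap ler_wsqrtr// lerDr.
have : J%:R <= 1 + ln t / ln 2.
  case: J Jt => [|J] Jt; first by apply: addr_ge0 => //; apply: divr_ge0; [exact: ln_ge0|exact: ltW].
  rewrite -natr1 addrC lerD2l ler_pdivlMr//.
  have -> : J%:R * ln 2 = ln ((2 : R) ^+ J) by rewrite lnXn// mulr_natl.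
  by rewrite ler_ln ?posrE ?exprn_gt0//; [exact: ltW (Jt J _)|lra].
move=> H; rewrite -[1 *+ J]/(J%:R).
have i2 : 0 < (ln (2 : R))^-1 by rewrite invr_gt0.
rewrite mulrDl; have : ln t / ln 2 <= (ln 2)^-1 * jap (ln t) by rewrite mulrC ler_wpM2l// ltW.
lra.
Qed.

End DyadicGrowth.


(** * From local section bounds to estimates on the solution *)

Section Estimates.
Context (R : realType).
Notation leb := (@lebesgue_measure R).
Notation leb2 := (product_measure1 leb leb).
Notation plane := (measurableTypeR R * measurableTypeR R)%type.
Variables (a b c : R -> R) (m : R * R -> R[i]) (q : \bar R).
Hypotheses (ca : continuous a) (cb : continuous b) (cc : continuous c)
  (cm1 : continuous (fun p => complex.Re (m p))) (cm2 : continuous (fun p => complex.Im (m p)))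
  (Km : compact (supp m)) (q2 : (2%:E <= q)%E).

Let phi : plane -> R := phase a b c.
Let S0 : set plane := [set p | m p != 0].

Let mphi : measurable_fun setT phi.
Proof. by apply: continuous_measurable_plane; exact: continuous_phase. Qed.

Let mm : cmeasurable (m : plane -> R[i]).
Proof. by split; exact: continuous_measurable_plane. Qed.

Let S0_supp : S0 `<=` supp m.
Proof. exact: subset_closure. Qed.

Let mS0 : measurable S0.
Proof.
have mc := cmeasurable_cabs mm.
have -> : S0 = (fun p : plane => cabs (m p)) @^-1` `]0, +oo[.
  apply/seteqP; split => p; rewrite /S0 /= in_itv/= andbT.
    move=> m0; rewrite lt_neqAle cabs_ge0 andbT eq_sym; apply: contra m0 => /eqP E.
    have := cabs_sqr (m p); rewrite E expr0n /= => /esym/eqP.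
    rewrite paddr_eq0 ?sqr_ge0// !sqrf_eq0; case: (m p) => [u v] /= /andP[/eqP-> /eqP->].
    exact: eqxx.
  by apply: contraTneq => ->; rewrite /cabs /= expr0n addr0 sqrtr0 ltxx.
by rewrite -[X in measurable X]setTI; exact: mc.
Qed.

Let supp_bounded : exists2 r : R, 0 < r & forall p, supp m p -> `|p.1| <= r /\ `|p.2| <= r.
Proof.
apply: (@compact_local_property _ (supp m) (fun A : set (R * R) => exists2 r : R, 0 < r &
   forall p, A p -> `|p.1| <= r /\ `|p.2| <= r)) => //.
- by exists 1.
- by move=> A B AB [r r0 H]; exists r => // p /AB /H.
- move=> A B [r r0 H] [s s0 H']; exists (r + s); first exact: addr_gt0.
  by move=> p [/H|/H'] [h1 h2]; split; lra.
- move=> p _; exists (ball p 1); first exact: nbhsx_ballx.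
  exists (`|p.1| + `|p.2| + 1); first by rewrite ltr_wpDl// addr_ge0.
  move=> r [] /=; rewrite /ball/= => h1 h2.
  have e1' : `|r.1| <= `|p.1| + `|p.1 - r.1|.
    by rewrite -[X in `|X| <= _](subKr p.1) (le_trans (ler_normB _ _)).
  have e2' : `|r.2| <= `|p.2| + `|p.2 - r.2|.
    by rewrite -[X in `|X| <= _](subKr p.2) (le_trans (ler_normB _ _)).
  have := normr_ge0 p.1; have := normr_ge0 p.2; split; lra.
Qed.

Let m_bounded : exists2 M : R, 0 <= M & forall p, cabs (m p) <= M.
Proof.
have [M M0 H] : exists2 M : R, 0 <= M & forall p, supp m p -> cabs (m p) <= M.
  apply: (@compact_local_property _ (supp m) (fun A : set (R * R) => exists2 M : R, 0 <= M &
     forall p, A p -> cabs (m p) <= M)) => //.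
  - by exists 0.
  - by move=> A B AB [r r0 H]; exists r => // p /AB /H.
  - move=> A B [r r0 H] [s s0 H']; exists (r + s); first exact: addr_ge0.
    by move=> p [/H|/H'] h; lra.
  - move=> p _.
    exists [set r | `|complex.Re (m p) - complex.Re (m r)| < 1 /\ `|complex.Im (m p) - complex.Im (m r)| < 1].
      apply: filterI; [have /cvgrPdist_lt/(_ _ ltr01) := @cm1 p|have /cvgrPdist_lt/(_ _ ltr01) := @cm2 p]; exact.
    exists (`|complex.Re (m p)| + `|complex.Im (m p)| + 2); first by rewrite !addr_ge0.
    move=> r [h1 h2]; apply: (le_trans (cabs_le_add _)).
    have e1' : `|complex.Re (m r)| <= `|complex.Re (m p)| + `|complex.Re (m p) - complex.Re (m r)|.
      by rewrite -[X in `|X| <= _](subKr (complex.Re (m p))) (le_trans (ler_normB _ _)).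
    have e2' : `|complex.Im (m r)| <= `|complex.Im (m p)| + `|complex.Im (m p) - complex.Im (m r)|.
      by rewrite -[X in `|X| <= _](subKr (complex.Im (m p))) (le_trans (ler_normB _ _)).
    lra.
exists M => // p; have [m0|m0] := eqVneq (m p) 0; last exact/H/S0_supp.
by rewrite m0 /cabs /= expr0n addr0 sqrtr0.
Qed.

Section Weights.
Variables (t A B : R) (F G : R -> R[i]).
Hypotheses (t0 : 0 < t) (A0 : 0 <= A) (B0 : 0 <= B) (mF : cmeasurable F) (mG : cmeasurable G)
  (F2 : (\int[leb]_x (cabs (F x) ^+ 2)%:E <= (A ^+ 2)%:E)%E)
  (G2 : (\int[leb]_x (cabs (G x) ^+ 2)%:E <= (B ^+ 2)%:E)%E).

Let f (x : R) := cabs (F x).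
Let g (x : R) := cabs (G x).
Let W := sol_weight a b c m F G t.

Let mf : measurable_fun setT f. Proof. exact: cmeasurable_cabs. Qed.
Let mg : measurable_fun setT g. Proof. exact: cmeasurable_cabs. Qed.
Let mW : cmeasurable W.
Proof. exact: cmeasurable_sol_weight t0 (continuous_measurable_fun ca) mphi mm mF mG. Qed.

Let W_le (M k : R) p : (forall p, cabs (m p) <= M) -> 0 <= k -> (S0 p -> cabs (time_factor t (phi p)) <= k) ->
  cabs (W p) <= k * M * (\1_S0 p * `|f p.1 * g p.2|).
Proof.
move=> mM k0 Tk; rewrite /W cabs_sol_weight /indic.
have [/set_mem S0p|nS0] := boolP (p \in S0).
  rewrite mul1r [`|_|]ger0_norm ?mulr_ge0 ?cabs_ge0//; apply: ler_wpM2r; first by rewrite mulr_ge0 ?cabs_ge0.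
  by apply: ler_pM; rewrite ?cabs_ge0//; exact: Tk.
have -> : m p = 0 by apply/eqP; move: nS0; rewrite notin_setE /S0 /= => /negP; rewrite negbK.
by rewrite [cabs 0]/cabs /= expr0n addr0 sqrtr0 !(mulr0, mul0r).
Qed.

Let W_phi_le (M : R) p : (forall p, cabs (m p) <= M) ->
  cabs (W p) * `|phi p| <= 4 * M * (\1_S0 p * `|f p.1 * g p.2|).
Proof.
move=> mM; rewrite /W cabs_sol_weight /indic.
have [_|nS0] := boolP (p \in S0).
  rewrite mul1r [`|_ * _|]ger0_norm ?mulr_ge0 ?cabs_ge0//.
  have -> : cabs (time_factor t (phase a b c p)) * cabs (m p) * (cabs (F p.1) * cabs (G p.2)) * `|phi p| =
    cabs (time_factor t (phi p)) * `|phi p| * cabs (m p) * (f p.1 * g p.2) by rewrite /f /g /phi; ring.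
  apply: ler_wpM2r; first by rewrite mulr_ge0 ?cabs_ge0.
  by apply: ler_pM; rewrite ?mulr_ge0 ?cabs_ge0//; exact: time_factor_decay.
have -> : m p = 0 by apply/eqP; move: nS0; rewrite notin_setE /S0 /= => /negP; rewrite negbK.
by rewrite [cabs 0]/cabs /= expr0n addr0 sqrtr0 !(mulr0, mul0r).
Qed.

Lemma Lnorm_sol_bounded (M r k : R) : (forall p, cabs (m p) <= M) -> 0 <= M -> 0 < r ->
  (forall p, supp m p -> `|p.1| <= r /\ `|p.2| <= r) -> 0 <= k ->
  (forall p, S0 p -> cabs (time_factor t (phi p)) <= k) ->
  (Lnorm leb q (fun x => (cabs (sol a b c m F G t x))%:E) <= (8 * (2 * r + 1) * M * k * A * B)%:E)%E.
Proof.
move=> mM M0 r0 sr k0 Tk.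
have Sr p : S0 p -> `|p.1| <= r /\ `|p.2| <= r by move=> /S0_supp /sr.
have kM : 0 <= k * M by exact: mulr_ge0.
have wb (w : plane -> R) : (forall p, `|w p| <= cabs (W p)) ->
    forall p, `|w p| <= k * M * (\1_S0 p * `|f p.1 * g p.2|).
  by move=> H p; apply: (le_trans (H p)); apply: W_le => //; exact: Tk.
have B1 := amp_bound_bounded mf mg A0 B0 r0 q2 F2 G2 mS0 Sr kM mW.1 (wb _ (fun p => normr_Re_le _)).
have B2 := amp_bound_bounded mf mg A0 B0 r0 q2 F2 G2 mS0 Sr kM mW.2 (wb _ (fun p => normr_Im_le _)).
have q1 : (1 <= q)%E by apply: le_trans q2; rewrite lee_fin; lra.
apply: (le_trans (Lnorm_sol q1 B1 B2)).
by rewrite lee_fin le_eqVlt; apply/orP; left; apply/eqP; ring.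
Qed.

(** Both halves of the bound min(t, 1/|phi|) are fed to [amp_bound_dyadic] with k = 4 M: the 4 is
    that of [time_factor_decay], and 2 t M <= 2^(J+1) (4 M) because t <= 2^J. *)
Lemma Lnorm_sol_dyadic (M r sigma tau D : R) (E1 E2 : set plane) (J : nat) :
  (forall p, cabs (m p) <= M) -> 0 <= M -> 0 < r ->
  (forall p, supp m p -> `|p.1| <= r /\ `|p.2| <= r) ->
  measurable E1 -> measurable E2 -> supp m `<=` E1 `|` E2 -> 1 <= D ->
  (forall lam : R, 0 < lam -> lam <= 1 ->
    (forall y, (leb (ysection (sublevel phi E1 lam) y) <= (D * lam `^ sigma)%:E)%E) /\
    (forall x, (leb (xsection (sublevel phi E1 lam) x) <= (D * lam `^ tau)%:E)%E)) ->
  (forall lam : R, 0 < lam -> lam <= 1 ->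
    (forall y, (leb (ysection (sublevel phi E2 lam) y) <= (D * lam `^ tau)%:E)%E) /\
    (forall x, (leb (xsection (sublevel phi E2 lam) x) <= (D * lam `^ sigma)%:E)%E)) ->
  t <= 2 ^+ J ->
  (Lnorm leb q (fun x => (cabs (sol a b c m F G t x))%:E) <=
   (8 * (8 * (2 * r + 1) + 32 * D) * M * (1 + \sum_(j < J)
      (2 ^+ j) `^ (1 - (sigma * qinv q + (sigma + tau) / 2 * (1 - 2 * qinv q)))) * A * B)%:E)%E.
Proof.
move=> mM M0 r0 sr mE1 mE2 sE D1 H1 H2 tJ.
have Sr p : S0 p -> `|p.1| <= r /\ `|p.2| <= r by move=> /S0_supp /sr.
have S0E : S0 `<=` E1 `|` E2 by move=> p /S0_supp /sE.
have M4 : 0 <= 4 * M by exact: mulr_ge0.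
have wb (w : plane -> R) : (forall p, `|w p| <= cabs (W p)) ->
    forall p, `|w p| <= 2 ^+ J.+1 * (4 * M) * (\1_S0 p * `|f p.1 * g p.2|).
  move=> H p; apply: (le_trans (H p)).
  have t2 : 0 <= 2 * t by rewrite mulr_ge0// ltW.
  apply: (le_trans (W_le mM t2 (fun _ => time_factor_le t0 _))).
  apply: ler_wpM2r; first by rewrite mulr_ge0// indicE.
  have -> : 2 ^+ J.+1 * (4 * M) = 8 * 2 ^+ J * M by rewrite exprS; ring.
  by apply: ler_wpM2r => //; lra.
have wp (w : plane -> R) : (forall p, `|w p| <= cabs (W p)) ->
    forall p, `|w p| * `|phi p| <= 4 * M * (\1_S0 p * `|f p.1 * g p.2|).
  by move=> H p; apply: le_trans (W_phi_le p mM); apply: ler_wpM2r.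
have re p : `|complex.Re (W p)| <= cabs (W p) by exact: normr_Re_le.
have im p : `|complex.Im (W p)| <= cabs (W p) by exact: normr_Im_le.
have B1 := amp_bound_dyadic mf mg A0 B0 r0 q2 F2 G2 mphi mS0 Sr mE1 mE2 S0E D1 H1 H2 M4 mW.1 (wb _ re) (wp _ re).
have B2 := amp_bound_dyadic mf mg A0 B0 r0 q2 F2 G2 mphi mS0 Sr mE1 mE2 S0E D1 H1 H2 M4 mW.2 (wb _ im) (wp _ im).
have q1 : (1 <= q)%E by apply: le_trans q2; rewrite lee_fin; lra.
apply: (le_trans (Lnorm_sol q1 B1 B2)).
by rewrite lee_fin le_eqVlt; apply/orP; left; apply/eqP; ring.
Qed.

End Weights.

Lemma estimate_linear : estimate a b c m q (fun t => t).
Proof.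
have [M M0 mM] := m_bounded; have [r r0 sr] := supp_bounded.
apply: estimate_of_L2_data; exists (8 * (2 * r + 1) * M * 2).
  by rewrite !mulr_ge0// addr_ge0// mulr_ge0// ltW.
move=> t F G A B t0 A0 B0 mF mG F2 G2.
have t2 : 0 <= 2 * t by rewrite mulr_ge0// ltW.
have := Lnorm_sol_bounded t0 A0 B0 mF mG F2 G2 mM M0 r0 sr t2 (fun p _ => time_factor_le t0 _).
by congr (_ <= _)%E; congr EFin; ring.
Qed.

(** On the compact support |phi| is at least some k > 0, so the time factor is at most 4 / k for all
    t. *)
Lemma estimate_nonresonant : (forall p, supp m p -> phase a b c p != 0) ->
  estimate a b c m q (fun _ => 1).
Proof.
move=> nz; have [M M0 mM] := m_bounded; have [r r0 sr] := supp_bounded.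
have [k k0 hk] : exists2 k : R, 0 < k & forall p, supp m p -> k <= `|phi p|.
  apply: (@compact_local_property _ (supp m) (fun A : set (R * R) => exists2 k : R, 0 < k &
     forall p, A p -> k <= `|phi p|)) => //.
  - by exists 1.
  - by move=> A B AB [k k0 H]; exists k => // p /AB /H.
  - move=> A B [k k0 H] [s s0 H']; exists (Num.min k s); first by rewrite lt_min k0.
    by move=> p [/H|/H'] h; rewrite ge_min h ?orbT.
  - move=> p /nz phip; have [s [k [s0 k0 H _]]] := continuous_neq0_ball (continuous_phase ca cb cc) phip.
    by exists (ball p s); [exact: nbhsx_ballx|exists k].
apply: estimate_of_L2_data; exists (8 * (2 * r + 1) * M * (4 / k)).
  by rewrite !mulr_ge0// ?addr_ge0// ?mulr_ge0// ?invr_ge0 ltW.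
move=> t F G A B t0 A0 B0 mF mG F2 G2.
have k4 : 0 <= 4 / k by rewrite divr_ge0// ltW.
have Tk p : S0 p -> cabs (time_factor t (phi p)) <= 4 / k.
  move=> /S0_supp /hk kp; rewrite ler_pdivlMr//; apply: le_trans (time_factor_decay t0 (phi p)).
  by apply: ler_wpM2l; first exact: cabs_ge0.
have := Lnorm_sol_bounded t0 A0 B0 mF mG F2 G2 mM M0 r0 sr k4 Tk.
by congr (_ <= _)%E; congr EFin; ring.
Qed.

(** The dyadic sum is used for t >= 1. For t < 1 the bound of the time factor by 2 t suffices, given
    alpha(t) >= t there. *)
Lemma estimate_sections (sigma tau : R) (alpha : R -> R) :
  (forall p, supp m p -> exists2 r : R, 0 < r &
     good phi (ball p r) sigma tau \/ good phi (ball p r) tau sigma) ->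
  (forall t, 0 < t -> t <= 1 -> t <= alpha t) ->
  (exists2 C : R, 0 <= C & forall (t : R) (J : nat), 1 <= t -> (forall j, (j < J)%N -> 2 ^+ j < t) ->
     1 + \sum_(j < J) (2 ^+ j) `^ (1 - (sigma * qinv q + (sigma + tau) / 2 * (1 - 2 * qinv q)))
       <= C * alpha t) ->
  estimate a b c m q alpha.
Proof.
move=> loc al1 [C C0 HC].
have [M M0 mM] := m_bounded; have [r r0 sr] := supp_bounded.
have [E1 [E2 [g1 g2 sE]]] := good_cover mphi Km loc.
have [D1 D11 H1] := good_sections g1; have [D2 D21 H2] := good_sections g2.
have [mE1 _ _] := g1; have [mE2 _ _] := g2.
pose D := D1 + D2; have D1' : 1 <= D by rewrite /D; lra.
have up (X : \bar R) (d s lam : R) : d <= D -> (X <= (d * lam `^ s)%:E)%E -> (X <= (D * lam `^ s)%:E)%E.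
  by move=> dD XD; apply: (le_trans XD); rewrite lee_fin ler_wpM2r// powR_ge0.
have dD1 : D1 <= D by rewrite /D; lra.
have dD2 : D2 <= D by rewrite /D; lra.
have H1' (lam : R) : 0 < lam -> lam <= 1 ->
    (forall y, (leb (ysection (sublevel phi E1 lam) y) <= (D * lam `^ sigma)%:E)%E) /\
    (forall x, (leb (xsection (sublevel phi E1 lam) x) <= (D * lam `^ tau)%:E)%E).
  by move=> l0 l1; have [hy hx] := H1 _ l0 l1; split => u; apply: (up _ D1).
have H2' (lam : R) : 0 < lam -> lam <= 1 ->
    (forall y, (leb (ysection (sublevel phi E2 lam) y) <= (D * lam `^ tau)%:E)%E) /\
    (forall x, (leb (xsection (sublevel phi E2 lam) x) <= (D * lam `^ sigma)%:E)%E).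
  by move=> l0 l1; have [hy hx] := H2 _ l0 l1; split => u; apply: (up _ D2).
pose K1 := 8 * (8 * (2 * r + 1) + 32 * D) * M; pose K2 := 8 * (2 * r + 1) * M * 2.
have K10 : 0 <= K1 by rewrite !mulr_ge0//; lra.
have K20 : 0 <= K2 by rewrite !mulr_ge0//; lra.
apply: estimate_of_L2_data; exists (K1 * C + K2); first by rewrite addr_ge0// mulr_ge0.
move=> t F G A B t0 A0 B0 mF mG F2 G2.
have [t1|t1] := leP 1 t.
  have [J [tJ Jt]] := dyadic_index t.
  apply: (le_trans (Lnorm_sol_dyadic t0 A0 B0 mF mG F2 G2 mM M0 r0 sr mE1 mE2 sE D1' H1' H2' tJ)).
  have HJ := HC t J t1 Jt.
  rewrite lee_fin; apply: ler_wpM2r => //; apply: ler_wpM2r => //.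
  rewrite -/K1; apply: (le_trans (ler_wpM2l K10 HJ)); rewrite mulrA; apply: ler_wpM2r; last by rewrite lerDl.
  (* No sign of alpha is assumed for t >= 1; it is nonnegative because C alpha(t) >= 1 with C >=
     0. *)
  rewrite leNgt; apply/negP => al0.
  have S1 : 1 <= 1 + \sum_(j < J) (2 ^+ j) `^ (1 - (sigma * qinv q + (sigma + tau) / 2 * (1 - 2 * qinv q))) :> R.
    by rewrite lerDl; apply: sumr_ge0 => j _; exact: powR_ge0.
  have : C * alpha t <= 0 by rewrite mulr_ge0_le0// ltW.
  by move: (le_trans S1 HJ); lra.
have t2 : 0 <= 2 * t by rewrite mulr_ge0// ltW.
apply: (le_trans (Lnorm_sol_bounded t0 A0 B0 mF mG F2 G2 mM M0 r0 sr t2 (fun p _ => time_factor_le t0 _))).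
rewrite lee_fin; apply: ler_wpM2r => //; apply: ler_wpM2r => //.
have ta := al1 t t0 (ltW t1).
have -> : 8 * (2 * r + 1) * M * (2 * t) = K2 * t by rewrite /K2; ring.
apply: (le_trans (ler_wpM2l K20 ta)); apply: ler_wpM2r; first by rewrite (le_trans _ ta)// ltW.
by rewrite lerDr mulr_ge0.
Qed.

Lemma estimate_sections_pow (sigma tau delta : R) : 0 < delta -> delta <= 1 ->
  delta = 1 - (sigma * qinv q + (sigma + tau) / 2 * (1 - 2 * qinv q)) ->
  (forall p, supp m p -> exists2 r : R, 0 < r &
     good phi (ball p r) sigma tau \/ good phi (ball p r) tau sigma) ->
  estimate a b c m q (fun t => t `^ delta).
Proof.
move=> d0 d1 dE loc; apply: (estimate_sections loc); rewrite -?dE.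
  move=> t t0 t1; rewrite -{1}(powRr1 (ltW t0)); apply: ger_powR => //.
  by rewrite t0 t1.
exact: dyadic_sum_pow.
Qed.

End Estimates.

(** * Resonant set *)

Section Resonance.
Context (R : realType).
Notation plane := (measurableTypeR R * measurableTypeR R)%type.
Implicit Types (phi : plane -> R) (p : R * R).

Definition local_ysec phi p (sigma : R) := exists2 r : R, 0 < r & ysec_bound phi (ball p r) sigma.
Definition local_xsec phi p (tau : R) := exists2 r : R, 0 < r & xsec_bound phi (ball p r) tau.
Definition local_good phi p (sigma tau : R) := exists2 r : R, 0 < r &
  good phi (ball p r) sigma tau \/ good phi (ball p r) tau sigma.

Lemma local_xsec_weaken phi p (s s' : R) : s' <= s -> local_xsec phi p s -> local_xsec phi p s'.
Proof.
move=> ss [r r0 [C C0 H]]; exists r => //; exists C => // lam l0 l1 y.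
apply: (le_trans (H lam l0 l1 y)); rewrite lee_fin; apply: ler_wpM2l => //.
by apply: ger_powR => //; rewrite l0 l1.
Qed.

Lemma good_of_local phi p (s t : R) : measurable_fun setT phi ->
  local_ysec phi p s -> local_xsec phi p t -> exists2 r : R, 0 < r & good phi (ball p r) s t.
Proof.
move=> mphi [r r0 yr] [r' r'0 xr]; exists (Num.min r r'); first by rewrite lt_min r0.
have mB s' : measurable (ball p s' : set plane) := measurable_ball_plane p s'.
split; first exact: mB.
- apply: (ysec_bound_sub mphi _ _ _ yr) => //; apply: le_ball; by rewrite ge_min lexx.
- apply: (xsec_bound_sub mphi _ _ _ xr) => //; apply: le_ball; by rewrite ge_min lexx orbT.
Qed.

Lemma local_good_l phi p (s t : R) : measurable_fun setT phi ->
  local_ysec phi p s -> local_xsec phi p t -> local_good phi p s t.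
Proof. by move=> mphi ly lx; have [r r0 g] := good_of_local mphi ly lx; exists r => //; left. Qed.

Lemma local_good_r phi p (s t : R) : measurable_fun setT phi ->
  local_ysec phi p t -> local_xsec phi p s -> local_good phi p s t.
Proof. by move=> mphi ly lx; have [r r0 g] := good_of_local mphi ly lx; exists r => //; right. Qed.

Lemma local_xsec_swap (a b c : R -> R) p (s : R) :
  local_ysec (phase a c b) (p.2, p.1) s -> local_xsec (phase a b c) p s.
Proof.
by move=> [r r0 H]; exists r => //; apply: xsec_bound_ball; rewrite phase_swap.
Qed.

Lemma local_ysec_trivial phi p : measurable_fun setT phi -> local_ysec phi p 0.
Proof.
move=> mphi; exists 1 => //; apply: ysec_bound_trivial => //; exact: measurable_ball_plane.
Qed.

Lemma local_ysec_neq0 (phi : R * R -> R) p (s : R) : measurable_fun setT (phi : plane -> R) ->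
  continuous phi -> phi p != 0 -> 0 <= s -> local_ysec phi p s.
Proof.
move=> mphi cphi np s0; have [r [k [r0 k0 hk _]]] := continuous_neq0_ball cphi np.
exists r => //; apply: (ysec_bound_neq0 mphi (ltW r0) _ k0 s0 hk); exact: measurable_ball_plane.
Qed.

Lemma is_derive_phase_curve (a b c a1 b1 c1 x y : R -> R) (s u v : R) :
  (forall x : R, is_derive x 1 a (a1 x)) -> (forall x : R, is_derive x 1 b (b1 x)) ->
  (forall x : R, is_derive x 1 c (c1 x)) -> is_derive s 1 x u -> is_derive s 1 y v ->
  is_derive s 1 (fun s => phase a b c (x s, y s))
    (- a1 (x s + y s) * (u + v) + b1 (x s) * u + c1 (y s) * v).
Proof.
move=> da db dc dx dy.
have dz : is_derive s 1 (fun s => x s + y s) (u + v) := is_deriveD dx dy.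
have H : is_derive s 1 (fun s => - a (x s + y s) + b (x s) + c (y s)) _ :=
  is_deriveD (is_deriveD (is_deriveN (@is_derive1_comp R a _ s _ _ (da _) dz))
   (@is_derive1_comp R b _ s _ _ (db _) dx)) (@is_derive1_comp R c _ s _ _ (dc _) dy).
by apply: (is_derive_eq H); rewrite mulNr.
Qed.

Section CurveInZeroSet.
Variables (a b c a1 b1 c1 a2 b2 c2 : R -> R) (gam : R -> R * R).
Hypotheses (da : forall x : R, is_derive x 1 a (a1 x)) (db : forall x : R, is_derive x 1 b (b1 x))
  (dc : forall x : R, is_derive x 1 c (c1 x)) (da1 : forall x : R, is_derive x 1 a1 (a2 x))
  (db1 : forall x : R, is_derive x 1 b1 (b2 x)) (dc1 : forall x : R, is_derive x 1 c1 (c2 x))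
  (sg : smooth gam) (g0 : forall s, 0 <= s <= 1 -> phase a b c (gam s) = 0).

Let x (s : R) : R := (gam s).1.
Let y (s : R) : R := (gam s).2.
Let u (s : R) : R := (vel gam s).1.
Let v (s : R) : R := (vel gam s).2.

Let dx (s : R) : is_derive s 1 x (u s).
Proof. by have [_ d] := sg [::]; have [] := is_derive_coord (d s 1). Qed.
Let dy (s : R) : is_derive s 1 y (v s).
Proof. by have [_ d] := sg [::]; have [] := is_derive_coord (d s 1). Qed.
Let du (s : R) : is_derive s 1 u (acc gam s).1.
Proof. by have [_ d] := sg [:: 1]; have [] := @is_derive_coord R (vel gam) s (d s 1). Qed.
Let dv (s : R) : is_derive s 1 v (acc gam s).2.
Proof. by have [_ d] := sg [:: 1]; have [] := @is_derive_coord R (vel gam) s (d s 1). Qed.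

(** Chain rule on phi(gam(s)) = 0, valid up to the end points by [derive_zero_on_itv]. *)
Lemma curve_gradient (s : R) : 0 <= s <= 1 ->
  (- a1 (x s + y s) + b1 (x s)) * u s + (- a1 (x s + y s) + c1 (y s)) * v s = 0.
Proof.
move=> s01; have D := is_derive_phase_curve da db dc (dx s) (dy s).
have E : (fun s => phase a b c (x s, y s)) = (fun s => phase a b c (gam s)).
  by apply/funext => s'; rewrite /x /y; case: (gam s').
rewrite E in D; rewrite -[RHS](derive_zero_on_itv D g0 s01); ring.
Qed.

(** The relation of [curve_gradient] differentiated once more; its terms pairing gradient and
    acceleration are what brings in the curvature. *)
Lemma curve_hessian (s : R) : 0 <= s <= 1 ->
  (- a2 (x s + y s) * (u s + v s) + b2 (x s) * u s) * u s
  + (- a2 (x s + y s) * (u s + v s) + c2 (y s) * v s) * v s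
  + (- a1 (x s + y s) + b1 (x s)) * (acc gam s).1 + (- a1 (x s + y s) + c1 (y s)) * (acc gam s).2 = 0.
Proof.
move=> s01.
have dz : is_derive s 1 (fun s => x s + y s) (u s + v s) := is_deriveD (dx s) (dy s).
have A : is_derive s 1 (fun s => - a1 (x s + y s)) _ :=
  is_deriveN (@is_derive1_comp R a1 _ s _ _ (da1 _) dz).
have P : is_derive s 1 (fun s => - a1 (x s + y s) + b1 (x s)) _ :=
  is_deriveD A (@is_derive1_comp R b1 _ s _ _ (db1 _) (dx s)).
have Q : is_derive s 1 (fun s => - a1 (x s + y s) + c1 (y s)) _ :=
  is_deriveD A (@is_derive1_comp R c1 _ s _ _ (dc1 _) (dy s)).
have D : is_derive s 1 (fun s => (- a1 (x s + y s) + b1 (x s)) * u s + (- a1 (x s + y s) + c1 (y s)) * v s) _ :=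
  is_deriveD (is_deriveM P (du s)) (is_deriveM Q (dv s)).
rewrite -[RHS](derive_zero_on_itv D curve_gradient s01) /GRing.scale/=; ring.
Qed.

End CurveInZeroSet.
End Resonance.

(** * Section exponents read off the resonant set, case by case *)

Section ResonantSets.
Context (R : realType).
Notation plane := (measurableTypeR R * measurableTypeR R)%type.
Variables (a b c : R -> R) (m : R * R -> R[i]) (q : \bar R).
Variables (a1 b1 c1 a2 b2 c2 : R -> R).
Hypotheses (ca : continuous a) (cb : continuous b) (cc : continuous c)
  (cm1 : continuous (fun p => complex.Re (m p))) (cm2 : continuous (fun p => complex.Im (m p)))
  (Km : compact (supp m)) (q2 : (2%:E <= q)%E)
  (da : forall x : R, is_derive x 1 a (a1 x)) (db : forall x : R, is_derive x 1 b (b1 x))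
  (dc : forall x : R, is_derive x 1 c (c1 x)) (da1 : forall x : R, is_derive x 1 a1 (a2 x))
  (db1 : forall x : R, is_derive x 1 b1 (b2 x)) (dc1 : forall x : R, is_derive x 1 c1 (c2 x))
  (ca1 : continuous a1) (cb1 : continuous b1) (cc1 : continuous c1)
  (ca2 : continuous a2) (cb2 : continuous b2) (cc2 : continuous c2).
Implicit Types p : R * R.

Let phi : R * R -> R := phase a b c.
Let mphi : measurable_fun setT (phi : plane -> R).
Proof. by apply: continuous_measurable_plane; exact: continuous_phase. Qed.
Let mphi' : measurable_fun setT (phase a c b : plane -> R).
Proof. by apply: continuous_measurable_plane; exact: continuous_phase. Qed.

Let phi_x p := - a1 (p.1 + p.2) + b1 p.1.
Let phi_y p := - a1 (p.1 + p.2) + c1 p.2.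
Let phi_xx p := - a2 (p.1 + p.2) + b2 p.1.
Let phi_yy p := - a2 (p.1 + p.2) + c2 p.2.

Let ysec1 p : phi_x p != 0 -> local_ysec phi p 1.
Proof. exact: (@ysec_bound_derivative_neq0 R a b c a1 b1 da db ca1 cb1 mphi p). Qed.

Let ysec2 p : phi_xx p != 0 -> local_ysec phi p 2^-1.
Proof. exact: (@ysec_bound_second_derivative_neq0 R a b c a1 b1 a2 b2 da db da1 db1 ca2 cb2 mphi p). Qed.

Let xsec1 p : phi_y p != 0 -> local_xsec phi p 1.
Proof.
rewrite /phi_y [p.1 + _]addrC => h; apply: local_xsec_swap.
exact: (@ysec_bound_derivative_neq0 R a c b a1 c1 da dc ca1 cc1 mphi' (p.2, p.1)).
Qed.

Let xsec2 p : phi_yy p != 0 -> local_xsec phi p 2^-1.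
Proof.
rewrite /phi_yy [p.1 + _]addrC => h; apply: local_xsec_swap.
exact: (@ysec_bound_second_derivative_neq0 R a c b a1 c1 a2 c2 da dc da1 dc1 ca2 cc2 mphi' (p.2, p.1)).
Qed.

Let ysec0 p : local_ysec phi p 0.
Proof. exact: (@local_ysec_trivial R phi p mphi). Qed.

Let xsec0 p : local_xsec phi p 0.
Proof. by apply: local_xsec_swap; exact: (local_ysec_trivial _ mphi'). Qed.

Let good_l p (s t : R) : local_ysec phi p s -> local_xsec phi p t -> local_good phi p s t.
Proof. exact: (local_good_l mphi). Qed.

Let good_r p (s t : R) : local_ysec phi p t -> local_xsec phi p s -> local_good phi p s t.
Proof. exact: (local_good_r mphi). Qed.

(** Off the zero set of the phase [local_ysec_neq0] gives any exponents, so only points of [Gamma]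
    remain to be examined. *)
Let local_of_Gamma (sigma tau : R) : 0 <= sigma -> 0 <= tau ->
  (forall p, Gamma a b c m p -> local_good phi p sigma tau) ->
  forall p, supp m p -> local_good phi p sigma tau.
Proof.
move=> s0 t0 H p sp; have [p0|np] := eqVneq (phi p) 0; first exact: H.
apply: good_l; first exact: (local_ysec_neq0 mphi (continuous_phase ca cb cc) np s0).
apply: local_xsec_swap; apply: (local_ysec_neq0 mphi' (continuous_phase ca cc cb)) => //.
have -> : phase a c b (p.2, p.1) = phi p by rewrite -phase_swap /=; case: (p).
exact: np.
Qed.

Let gradE p : grad_zero a b c p <-> phi_x p = 0 /\ phi_y p = 0.
Proof.
rewrite /grad_zero /dphi !(derive_phase _ _ da db dc) /= !(addr0, add0r, mulr0, mulr1).
by [].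
Qed.

Let qi : 0 <= qinv q <= 2^-1 := qinv_itv q2.

(** A definite form is nonzero on the coordinate vectors, so both pure second derivatives of phi are
    nonzero at the point and both directions have exponent 1/2. *)
Lemma estimate_point p0 : Gamma a b c m = [set p0] -> hess_definite a b c p0 ->
  estimate a b c m q (fun t => t `^ (2^-1 + qinv q / 2)).
Proof.
have /andP[qi0 qi2] := qi.
have [h0 d0 d1 dE] : [/\ 0 <= 2^-1 :> R, 0 < 2^-1 + qinv q / 2, 2^-1 + qinv q / 2 <= 1 &
   2^-1 + qinv q / 2 = 1 - (2^-1 * qinv q + (2^-1 + 2^-1) / 2 * (1 - 2 * qinv q))] by split; lra.
move=> G0 hd.
have nz (v : R * R) : v != 0 -> hess_form a b c p0 v != 0.
  by case: hd => H /H; [move/lt0r_neq0|move/ltr0_neq0].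
have n1 : phi_xx p0 != 0.
  have : (1, 0) != 0 :> R * R by rewrite xpair_eqE oner_eq0.
  move=> /nz; rewrite /hess_form !(d2phiE _ _ _ da db dc da1 db1 dc1) /=.
  by rewrite !(mul1r, mul0r, mulr1, mulr0, addr0, add0r).
have n2 : phi_yy p0 != 0.
  have : (0, 1) != 0 :> R * R by rewrite xpair_eqE oner_eq0 andbF.
  move=> /nz; rewrite /hess_form !(d2phiE _ _ _ da db dc da1 db1 dc1) /=.
  by rewrite !(mul1r, mul0r, mulr1, mulr0, addr0, add0r).
apply: (@estimate_sections_pow R a b c m q ca cb cc cm1 cm2 Km q2 2^-1 2^-1 _ d0 d1 dE).
apply: (local_of_Gamma h0 h0) => p Gp.
have -> : p = p0 by move: Gp; rewrite G0.
by apply: good_l; [exact: ysec2|exact: xsec2].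
Qed.

Section Curve.
Variable gam : R -> R * R.
Hypotheses (gamP : is_curve (Gamma a b c m) gam) (o1 : order_one a b c (Gamma a b c m)).

Let gam0 s : 0 <= s <= 1 -> phase a b c (gam s) = 0.
Proof.
have [_ [_ G]] := gamP; move=> s01; have : Gamma a b c m (gam s); last by case.
by rewrite G; exists s => //=; rewrite in_itv.
Qed.

Let curveP p : Gamma a b c m p -> exists s, [/\ 0 <= s <= 1, gam s = p, s \in `[0, 1],
  phi_x p * (vel gam s).1 + phi_y p * (vel gam s).2 = 0 & (phi_x p != 0) || (phi_y p != 0)].
Proof.
move=> Gp; have [sg [_ G]] := gamP.
have : (gam @` `[0, 1]) p by rewrite -G.
move=> [s s01 E]; have s01' : 0 <= s <= 1 by move: s01; rewrite /= in_itv.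
exists s; split => //; first by rewrite -E; exact: (curve_gradient da db dc sg gam0 s01').
rewrite -negb_and; apply/negP => /andP[/eqP h1 /eqP h2].
by apply: (o1 Gp); apply/gradE.
Qed.

(** Only one component of the gradient is known to be nonzero: exponent 1 in that direction, the
    trivial 0 in the other. The outcome does not depend on q because 1/q + (1/2)(1 - 2/q) = 1/2. *)
Lemma estimate_general_curve : estimate a b c m q (fun t => t `^ (2^-1)).
Proof.
have [d0 d1 dE] : [/\ 0 < 2^-1 :> R, 2^-1 <= 1 :> R &
   2^-1 = 1 - (1 * qinv q + (1 + 0) / 2 * (1 - 2 * qinv q))] by split; lra.
apply: (@estimate_sections_pow R a b c m q ca cb cc cm1 cm2 Km q2 1 0 _ d0 d1 dE).
apply: (local_of_Gamma ler01 (lexx 0)) => p /curveP[s [_ _ _ _ /orP[h|h]]].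
- by apply: good_l; [exact: ysec1|exact: xsec0].
- by apply: good_r; [exact: ysec0|exact: xsec1].
Qed.

(** Suppose phi_x = 0 at a point. Then phi_y is not 0, the tangent (u, v) has v = 0, and
    [curve_hessian] reduces to phi_xx u^2 + phi_y a_v = 0 with a_v the second component of the
    acceleration. The curvature is u a_v, so phi_xx cannot vanish and the degenerate direction has
    exponent 1/2. The case phi_y = 0 is symmetric. *)
Lemma estimate_curved : nonzero_curvature gam ->
  estimate a b c m q (fun t => t `^ (4^-1 + qinv q / 2)).
Proof.
have /andP[qi0 qi2] := qi.
have [h0 lw1 d0 d1 dE] : [/\ 0 <= 2^-1 :> R, 2^-1 <= 1 :> R, 0 < 4^-1 + qinv q / 2, 4^-1 + qinv q / 2 <= 1 &
   4^-1 + qinv q / 2 = 1 - (1 * qinv q + (1 + 2^-1) / 2 * (1 - 2 * qinv q))] by split; lra.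
move=> nc; have [sg [vn G]] := gamP.
apply: (@estimate_sections_pow R a b c m q ca cb cc cm1 cm2 Km q2 1 2^-1 _ d0 d1 dE).
apply: (local_of_Gamma ler01 h0) => p /curveP[s [s01 E s01' grad nP]].
have := curve_hessian da db dc da1 db1 dc1 sg gam0 s01.
have := nc s s01'; have := vn s s01'; rewrite E -!/(phi_x p) -!/(phi_y p).
case: (vel gam s) (acc gam s) grad => [u v] [au av] /= grad uv curv hess.
have [x0|nx] := eqVneq (phi_x p) 0.
  have ny : phi_y p != 0 by move: nP; rewrite x0 eqxx.
  have v0 : v = 0 by move: grad; rewrite x0 mul0r add0r => /eqP; rewrite mulf_eq0 (negbTE ny) => /eqP.
  apply: good_r; last exact: xsec1.
  apply: ysec2; apply/eqP => xx; move: hess curv uv; rewrite x0 v0 !(mulr0, addr0, mul0r, subr0).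
  rewrite -mulrDl -/(phi_xx p) xx !mul0r add0r => /eqP; rewrite mulf_eq0 (negbTE ny) => /eqP ->.
  by rewrite mulr0 eqxx.
have [y0|ny] := eqVneq (phi_y p) 0; last first.
  (* With both components nonzero the exponents are (1, 1), weakened to (1, 1/2). *)
  by apply: good_l; [exact: ysec1|exact: local_xsec_weaken lw1 (xsec1 ny)].
have u0 : u = 0 by move: grad; rewrite y0 mul0r addr0 => /eqP; rewrite mulf_eq0 (negbTE nx) => /eqP.
apply: good_l; first exact: ysec1.
apply: xsec2; apply/eqP => yy; move: hess curv uv; rewrite y0 u0 !(mulr0, addr0, add0r, mul0r, sub0r).
rewrite -mulrDl -/(phi_yy p) yy !mul0r add0r => /eqP; rewrite mulf_eq0 (negbTE nx) => /eqP ->.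
by rewrite mulr0 oppr0 eqxx.
Qed.

(** The gradient is orthogonal to a tangent with nonzero components, so if one of its components
    vanished, both would. Hence exponent 1 in both directions and a dyadic sum of exponent 1/q,
    which becomes a logarithm when q is infinite. *)
Lemma estimate_noncharacteristic : noncharacteristic gam ->
  estimate a b c m q (fun t => if q == +oo%E then jap (ln t) else t `^ (qinv q)).
Proof.
move=> nc; have /andP[qi0 qi2] := qi.
have loc : forall p, supp m p -> local_good phi p 1 1.
  apply: local_of_Gamma => // p /curveP[s [_ _ s01 grad nP]].
  have [v0 u0 _] := nc s s01.
  have nx : phi_x p != 0.
    apply: contraL nP => /eqP x0; move: grad; rewrite x0 mul0r add0r => /eqP.
    by rewrite mulf_eq0 (negbTE v0) orbF => /eqP ->; rewrite eqxx.
  have ny : phi_y p != 0.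
    apply: contraL nP => /eqP y0; move: grad; rewrite y0 mul0r addr0 => /eqP.
    by rewrite mulf_eq0 (negbTE u0) orbF => /eqP ->; rewrite eqxx.
  by apply: good_l; [exact: ysec1|exact: xsec1].
have [qoo|qfin] := eqVneq q +oo%E.
  apply: (@estimate_sections R a b c m q ca cb cc cm1 cm2 Km q2 1 1 _ loc).
    move=> t t0 t1; apply: (le_trans t1).
    by rewrite /jap -[leLHS]sqrtr1 ler_wsqrtr// lerDl sqr_ge0.
  have [C C0 H] := dyadic_sum_log R; exists C => // t J t1 Jt.
  apply: le_trans (H t J t1 Jt); rewrite qoo /= le_eqVlt; apply/orP; left; apply/eqP.
  congr (_ + _); apply: eq_bigr => j _; congr (_ `^ _); lra.
apply: (@estimate_sections_pow R a b c m q ca cb cc cm1 cm2 Km q2 1 1) => //; try lra.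
case: q q2 qfin => [r|//|//] /=; rewrite lee_fin => r2 _; rewrite invr_gt0; lra.
Qed.

End Curve.
End ResonantSets.

Unset Implicit Arguments. Set Strict Implicit. Set Printing Implicit Defensive.

Theorem theorem3p1 (R : realType) (a b c : R -> R) (m : R * R -> R[i])
  (q : \bar R) :
  smooth a -> smooth b -> smooth c ->
  smooth (fun p => complex.Re (m p)) -> smooth (fun p => complex.Im (m p)) ->
  compact (supp m) ->
  (2%:E <= q)%E ->
  (* (a) general case *)
  estimate a b c m q (fun t => t) /\
  (* (b) Gamma empty *)
  (Gamma a b c m = set0 -> estimate a b c m q (fun _ => 1)) /\
  (* (c) Gamma a single point where phi vanishes at order two *)
  (forall p0 : R * R, Gamma a b c m = [set p0] ->
     grad_zero a b c p0 -> hess_definite a b c p0 ->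
     estimate a b c m q (fun t => t `^ (2^-1 + qinv q / 2))) /\
  (* (d) non-characteristic curve, phi vanishing at order one *)
  (forall gam : R -> R * R, is_curve (Gamma a b c m) gam ->
     noncharacteristic gam -> order_one a b c (Gamma a b c m) ->
     estimate a b c m q
       (fun t => if q == +oo%E then jap (ln t) else t `^ (qinv q))) /\
  (* (e) curve with non-vanishing curvature, phi vanishing at order one *)
  (forall gam : R -> R * R, is_curve (Gamma a b c m) gam ->
     nonzero_curvature gam -> order_one a b c (Gamma a b c m) ->
     estimate a b c m q (fun t => t `^ (4^-1 + qinv q / 2))) /\
  (* (f) general smooth curve, phi vanishing at order one *)
  (forall gam : R -> R * R, is_curve (Gamma a b c m) gam ->
     order_one a b c (Gamma a b c m) ->
     estimate a b c m q (fun t => t `^ (2^-1))).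
Proof.
move=> sa sb sc sm1 sm2 Km q2.
have [ca _] := sa [::]; have [cb _] := sb [::]; have [cc _] := sc [::].
have [cm1 _] := sm1 [::]; have [cm2 _] := sm2 [::].
have [a1 [a2 [da da1 ca1 ca2]]] := smooth_derivatives sa.
have [b1 [b2 [db db1 cb1 cb2]]] := smooth_derivatives sb.
have [c1 [c2 [dc dc1 cc1 cc2]]] := smooth_derivatives sc.
split; first exact: estimate_linear.
split.
  move=> G0; apply: estimate_nonresonant => // p sp; apply/eqP => p0.
  have : Gamma a b c m p by [].
  by rewrite G0.
split.
  move=> p0 G0 _ hd.
  exact: (estimate_point ca cb cc cm1 cm2 Km q2 da db dc da1 db1 dc1 ca2 cb2 cc2 G0 hd).
split.
  move=> gam gamP nc o1.
  exact: (estimate_noncharacteristic ca cb cc cm1 cm2 Km q2 da db dc ca1 cb1 cc1 gamP o1 nc).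
split.
  move=> gam gamP nc o1.
  exact: (estimate_curved ca cb cc cm1 cm2 Km q2 da db dc da1 db1 dc1 ca1 cb1 cc1 ca2 cb2 cc2 gamP o1 nc).
move=> gam gamP o1.
exact: (estimate_general_curve ca cb cc cm1 cm2 Km q2 da db dc ca1 cb1 cc1 gamP o1).
Qed.
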